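(* For every integer $r\ge 3$ and every integer $d\ge 2r-3$, the dual variety $Y(r-2,d-r+2)^*\subset(\mathbb{P}^r)^*$ of the scroll surface $Y(r-2,d-r+2)\subset\mathbb{P}^r$ defined in the context is a hypersurface of degree $d$, and it is homaloidal.
   Context: Everything is over an algebraically closed field $k$ of characteristic $0$. For a projective variety $X\subset\mathbb{P}^r$, the dual variety $X^*\subset(\mathbb{P}^r)^*$ is the closure of the set of hyperplanes tangent to $X$ at some smooth point. A hypersurface $V(f)\subset\mathbb{P}^r$ of degree at least $2$, $f\in k[x_0,\dots,x_r]$ a form, is homaloidal if its polar map $\phi_f=(\partial f/\partial x_0:\dots:\partial f/\partial x_r):\mathbb{P}^r\dashrightarrow(\mathbb{P}^r)^*$ is birational. Scrolls $S(a,b)$: for integers $0<a\le b$, $S(a,b)\subset\mathbb{P}^{a+b+1}$ is the smooth rational normal scroll surface of degree $a+b$, i.e. the image of $\mathbb{P}(\mathcal{O}_{\mathbb{P}^1}(a)\oplus\mathcal{O}_{\mathbb{P}^1}(b))$ under the complete linear system $|\mathcal{O}(1)|$; its rulings are the images of the fibres over $\mathbb{P}^1$. It contains a section $E$ with $E^2=a-b$ (unique if $a<b$), a rational normal curve of degree $a$ spanning a linear space $\langle E\rangle$ of dimension $a$. Surfaces $X(a,b)$: for $1\le a\le b$, $X(a,b)\subset\mathbb{P}^{b+2}$ is the image of $S(a,b)\subset\mathbb{P}^{a+b+1}$ under projection from a general linear subspace of dimension $a-2$ contained in $\langle E\rangle$ (for $a=1$ the centre is empty and $X(1,b)=S(1,b)$).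 It is a scroll surface of degree $a+b$, and $\Lambda\subset X(a,b)$ denotes the line that is the image of $E$. Surfaces $Y(a,b)$: for $1\le a<b$, let $F_1,\dots,F_{b-a}$ be general rulings of $X(a,b)$. Together with $\Lambda$ they span a linear space $\Phi$ of dimension $b-a+1$. Choose a general linear subspace $\Psi\subset\Phi$ of dimension $b-a-1$; then $Y(a,b)\subset\mathbb{P}^{a+2}$ is the image of $X(a,b)$ under projection from $\Psi$. It is a scroll surface of degree $a+b$. *)

(* Defs.v *)
From mathcomp Require Import all_boot all_order all_algebra.
From mathcomp.multinomials Require Export mpoly.

Set Implicit Arguments.
Unset Strict Implicit.
Unset Printing Implicit Defensive.

Import GRing.Theory.
Local Open Scope ring_scope.

(* A point of P^(N-1) is given by a nonzero row vector of N homogeneous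
   coordinates, a subset of P^(N-1) by the predicate "the point with these
   coordinates lies in the subset" on 'rV_N; such a predicate is to hold only
   of nonzero vectors and to be stable under nonzero rescaling, as is the case
   for every subset constructed below.  A linear subspace of P^(N-1) of
   projective dimension m - 1 is the row space of a matrix with m independent
   rows and N columns. *)
Definition pset (k : closedFieldType) (N : nat) : Type := 'rV[k]_N -> Prop.

Section ProjectiveGeometry.
Variable k : closedFieldType.
Implicit Types N m n d e : nat.

Definition vanishes_on N (f : {mpoly k[N]}) (S : pset k N) : Prop :=
  forall x, S x -> f.@[x 0] = 0.

Definition zariski_closure N (S : pset k N) : pset k N := fun x =>
  x != 0 /\
  forall d (f : {mpoly k[N]}), f \is d.-homog -> vanishes_on f S ->
    f.@[x 0] = 0.

(* No nonzero polynomial relation between the g i in k[x_1..x_N] / I(X). *)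
Definition alg_independent_on N m (X : pset k N) (g : m.-tuple {mpoly k[N]})
    : Prop :=
  forall h : {mpoly k[m]}, vanishes_on (h \mPo g) X -> h = 0.

(* dim X = e, for X irreducible: the homogeneous coordinate ring of X has
   transcendence degree e + 1 over k. *)
Definition has_dim N (X : pset k N) e : Prop :=
  (exists g : (e.+1).-tuple {mpoly k[N]}, alg_independent_on X g) /\
  ~ (exists g : (e.+2).-tuple {mpoly k[N]}, alg_independent_on X g).

(* The vectors of the linear subspace of k^N whose projectivization is the
   embedded projective tangent space T_x X. *)
Definition tangent_at N (X : pset k N) (x v : 'rV[k]_N) : Prop :=
  forall d (f : {mpoly k[N]}), f \is d.-homog -> vanishes_on f X ->
    \sum_(i < N) (f^`M(i)).@[x 0] * v 0 i = 0.

Definition smooth_point N (X : pset k N) (x : 'rV[k]_N) : Prop :=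
  X x /\
  exists e (M : 'M[k]_(e.+1, N)),
    [/\ has_dim X e, row_free M
      & forall v : 'rV[k]_N, tangent_at X x v <-> (v <= M)%MS].

(* The hyperplane with coefficient vector h is tangent to X at the smooth
   point x when it contains T_x X. *)
Definition dual_variety N (X : pset k N) : pset k N :=
  zariski_closure (fun h : 'rV[k]_N =>
    h != 0 /\
    exists2 x, smooth_point X x &
      forall v : 'rV[k]_N, tangent_at X x v -> h *m v^T = 0).

(* Z = V(f) and f generates the ideal of Z, so that d is the degree of Z. *)
Definition hypersurface_eq N d (f : {mpoly k[N]}) (Z : pset k N) : Prop :=
  [/\ (0 < d)%N, f \is d.-homog, f != 0,
      forall x, Z x <-> x != 0 /\ f.@[x 0] = 0
    & forall g : {mpoly k[N]}, vanishes_on g Z -> exists q, g = q * f].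

Definition is_hypersurface N d (Z : pset k N) : Prop :=
  exists f, hypersurface_eq d f Z.

Definition rational_map N (phi : N.-tuple {mpoly k[N]}) : Prop :=
  exists e, (forall i, tnth phi i \is e.-homog) /\
            (exists i, tnth phi i != 0).

(* psi o phi is defined and is the identity as a rational map. *)
Definition comp_is_id N (psi phi : N.-tuple {mpoly k[N]}) : Prop :=
  exists2 p : {mpoly k[N]}, p != 0 &
    forall i, tnth psi i \mPo phi = p * 'X_i.

Definition birational N (phi : N.-tuple {mpoly k[N]}) : Prop :=
  rational_map phi /\
  exists psi, [/\ rational_map psi, comp_is_id psi phi & comp_is_id phi psi].

Definition polar_map N (f : {mpoly k[N]}) : N.-tuple {mpoly k[N]} :=
  [tuple f^`M(i) | i < N].

Definition homaloidal N (Z : pset k N) : Prop :=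
  exists d f, [/\ (1 < d)%N, hypersurface_eq d f Z & birational (polar_map f)].

(* Q is the matrix, acting on row vectors, of a projection P^(m-1) --> P^(n-1)
   with centre the linear subspace L.  It is unique up to a linear change of
   coordinates in the target. *)
Definition projection_from l m n (L : 'M[k]_(l, m)) (Q : 'M[k]_(m, n)) : Prop :=
  row_full Q /\ (kermx Q == L)%MS.

Definition projected m n (X : pset k m) (Q : 'M[k]_(m, n)) : pset k n :=
  zariski_closure (fun y => y != 0 /\ exists2 x, X x & y = x *m Q).

(* P holds for all elements of a nonempty Zariski-open subset of D; it suffices
   to consider principal open subsets.  It is used only for D irreducible:
   D is the set of bases of the m-dimensional subspaces of a given space (a
   nonempty open subset of a Grassmannian corresponds to one of D that is
   stable under change of basis), or of tuples of homogeneous coordinates of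
   points of P^1. *)
Definition for_general m n (D P : 'M[k]_(m, n) -> Prop) : Prop :=
  exists f : {mpoly k[m * n]},
    (exists A, D A /\ f.@[mxvec A 0] != 0) /\
    (forall A, D A -> f.@[mxvec A 0] != 0 -> P A).

Definition basis_of_subspace m p n (V : 'M[k]_(p, n)) (A : 'M[k]_(m, n)) : Prop :=
  row_free A /\ (A <= V)%MS.

Definition points_of_line m (T : 'M[k]_(m, 2)) : Prop :=
  forall i, row i T != 0.

Definition veronese c (s t : k) : 'rV[k]_c.+1 :=
  \row_(i < c.+1) (s ^+ (c - i) * t ^+ i).

(* S(a,b) in P^(a+b+1), with H^0(O(1)) = Sym^a (s,t) u (+) Sym^b (s,t) v. *)
Definition scroll a b : pset k (a.+1 + b.+1) := fun x =>
  exists s t u v : k,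
    [/\ (s, t) != (0, 0), (u, v) != (0, 0)
      & x = row_mx (u *: veronese a s t) (v *: veronese b s t)].

Arguments scroll : clear implicits.

(* The span of the section E : v = 0 of S(a,b). *)
Definition spanE a b : 'M[k]_(a.+1, a.+1 + b.+1) := row_mx 1%:M 0.

(* The ruling of S(a,b) over the point (s : t). *)
Definition ruling a b (s t : k) : 'M[k]_(1 + 1, a.+1 + b.+1) :=
  block_mx (veronese a s t) 0 0 (veronese b s t).

(* P holds for X(a,b) in P^(b+2), seen as the image of S(a,b) under the
   projection Q, for a general choice of the centre. *)
Definition for_general_X a b (P : 'M[k]_(a.+1 + b.+1, b.+3) -> Prop) : Prop :=
  for_general (basis_of_subspace (spanE a b))
    (fun L : 'M[k]_(a - 1, a.+1 + b.+1) =>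
       forall Q, projection_from L Q -> P Q).

Definition surfX a b (Q : 'M[k]_(a.+1 + b.+1, b.+3)) : pset k b.+3 :=
  projected (scroll a b) Q.

(* The span Phi of Lambda and of the rulings of X(a,b) over the b - a points
   given by the rows of T; Lambda, a line, is the image of the span of E. *)
Definition spanPhi a b (Q : 'M[k]_(a.+1 + b.+1, b.+3)) (T : 'M[k]_(b - a, 2))
    : 'M[k]_b.+3 :=
  (spanE a b *m Q + \sum_(i < b - a) <<ruling a b (T i 0) (T i 1) *m Q>>)%MS.

(* P holds for Y(a,b) in P^(a+2), for successive general choices of the centre
   of the first projection, of the rulings and of Psi, whatever the choices of
   coordinates in the targets of the two projections. *)
Definition for_general_Y a b (P : pset k a.+3 -> Prop) : Prop :=
  for_general_X (fun Q : 'M[k]_(a.+1 + b.+1, b.+3) =>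
    for_general (@points_of_line (b - a)) (fun T =>
      for_general (basis_of_subspace (spanPhi Q T))
        (fun Psi : 'M[k]_(b - a, b.+3) =>
           forall R : 'M[k]_(b.+3, a.+3), projection_from Psi R ->
             P (projected (surfX Q) R)))).

End ProjectiveGeometry.

Arguments for_general_Y k a b P : clear implicits.

(* Main.v *)
Require Import Defs.
From mathcomp Require Import all_boot all_order all_fingroup all_algebra all_field.
From mathcomp Require Import ring zify.
From Stdlib Require Import Classical FunctionalExtensionality PropExtensionality.
Set Implicit Arguments.
Unset Strict Implicit.
Unset Printing Implicit Defensive.
Import GRing.Theory.
Local Open Scope ring_scope.

(* In suitable coordinates Y(a,b) is the set of the points
     (u p + v m0 : u q + v m1 : v g : v g x : ... : v g x^a),
   where p, q have degree at most a, m0, m1 degree at most b, and g vanishes at the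
   b - a chosen rulings.  The hyperplane h = (h0 : h1 : C) cuts Y in u A + v B = 0,
   with A = h0 p + h1 q and B = h0 m0 + h1 m1 + g C, and it is tangent to Y where A
   and B have a common root.  So the dual variety is the zero locus of the
   resultant f(h) = Res_(a,b)(A, B), of degree a + b.  A line along which f has
   distinct zeros, at which A moreover has simple roots, shows that f generates the
   ideal of the dual variety.

   For the polar map, f(h) = h0^b prod_i B(x_i), where the x_i are the roots of A, is
   invariant under the translations of h by multiples of (0 : 0 : A).  The gradient
   y of f at h determines A up to a scalar, because its pairings with (0, 0, p) and
   (0, 0, q) are proportional to - h1 and h0, and then h up to such a translation,
   as the solution of a linear system with coefficients polynomial in y.  The
   translation is recovered from the first coordinate of y.  This gives a left
   inverse of the polar map; as the partial derivatives of f are then algebraically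
   independent, it is a two-sided inverse. *)

(** * Polynomials over an infinite field *)

(** That the resultant is reduced cannot be read off its formula, so it is tested on one line, found
    by degeneration. Replacing m0, m1 by c m0, c m1 and setting c = 0 turns B into g C, whose
    resultant with A along a suitable line has explicit zeros. Nonvanishing of two polynomials in c
    carries the test to some c <> 0, and rescaling h0, h1 brings c back to 1. The polynomial K is
    nonzero where A has degree a and simple roots. There a zero of f is tangent at a smooth point:
    on the ruling over a common root t, the point with v = 1 is found by solving u A'(t) + B'(t) =
    0. For the inversion, let theta_i be the roots of A. The last coordinates of y are weighted
    power sums y_n = sum_i w_i theta_i^n, with w_i = f g(theta_i) / B(theta_i). The roots are not
    polynomial in y, but divided differences of A turn these sums into a polynomial W with
    W(theta_i) proportional to w_i A'(theta_i). Hence B W and f g A' agree modulo A up to a scalar.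
    Euler's identity replaces f by (y . h) / d, and the condition becomes linear in h. *)

Section InfiniteField.
Variable k : closedFieldType.
Hypothesis char0 : [pchar k] =i pred0.

Lemma natr_eq0_char0 n : ((n%:R : k) == 0) = (n == 0)%N.
Proof. by move: n; apply/pcharf0P. Qed.

Lemma natr_inj_char0 : injective (fun n : nat => n%:R : k).
Proof.
move=> m n /= /eqP; wlog le_mn: m n / (m <= n)%N => [hw|].
  case: (leqP m n) => [|/ltnW] le_mn; first exact: hw.
  by rewrite eq_sym => /(hw _ _ le_mn).
move=> h; apply/eqP; rewrite eqn_leq le_mn /= -subn_eq0.
by rewrite -natr_eq0_char0 natrB // subr_eq0 eq_sym.
Qed.

Lemma exists_nonroot (p : {poly k}) : p != 0 -> exists x, p.[x] != 0.
Proof.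
move=> nz_p; pose s := [seq (n%:R : k) | n <- iota 0 (size p)].
have [/allP rs|/allPn[x _ px]] := boolP (all (root p) s); last by exists x.
have us : uniq s by rewrite map_inj_uniq ?iota_uniq //; apply: natr_inj_char0.
have rs' : all (root p) s by apply/allP.
by have := max_poly_roots nz_p rs' us; rewrite size_map size_iota ltnn.
Qed.

Lemma poly_fun0 (p : {poly k}) : (forall x, p.[x] = 0) -> p = 0.
Proof.
move=> p0; apply/eqP; apply: contraT => /exists_nonroot[x].
by rewrite p0 eqxx.
Qed.

Lemma poly_funP (p q : {poly k}) : (forall x, p.[x] = q.[x]) -> p = q.
Proof.
move=> h; apply/eqP; rewrite -subr_eq0; apply/eqP/poly_fun0 => x.
by rewrite hornerD hornerN h subrr.
Qed.

(** Induction on the number of variables: [muni F] is [F] as a polynomial in the last variable. Its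
    coefficients vanish at each [v], being those of a univariate polynomial all of whose values are
    zero. *)
Lemma mpoly_fun0 n (F : {mpoly k[n]}) : (forall v, F.@[v] = 0) -> F = 0.
Proof.
elim: n F => [|n IH] F F0.
  by have := F0 (fun=> 0); rewrite [F]nvar0_mpolyC mevalC => ->.
have muni0 j : (muni F)`_j = 0.
  apply: IH => v; pose c := map_poly (meval v) (muni F).
  suff c0 : c = 0 by rewrite -[LHS](coef_map (meval v)) -/c c0 coef0.
  apply: poly_fun0 => t.
  pose w (i : 'I_n.+1) := if unlift ord_max i is Some j then v j else t.
  rewrite -[RHS](F0 w) mevalE /c muniE rmorph_sum /= horner_sum.
  apply: eq_bigr => m _; rewrite -!mul_polyC !rmorphM /= !hornerM.
  rewrite !map_polyC map_polyXn !hornerC hornerXn /=.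
  rewrite -mul_mpolyC mevalM mevalC mevalX big_ord_recr /= -mulrA.
  congr (_ * (_ * _)); last by rewrite /w unlift_none.
  apply: eq_bigr => i _; rewrite mnmE /w; congr (_ ^+ _).
  suff -> : widen_ord (leqnSn n) i = lift ord_max i by rewrite liftK.
  by apply: val_inj; rewrite /= /bump leqNgt ltn_ord.
apply/mpolyP => m0; rewrite mcoeff0.
(* A monomial is determined by its first [n] exponents, [r m], and its last one, so a coefficient of
   [F] is a coefficient of a coefficient of [muni F]. *)
pose r (m : 'X_{1..n.+1}) := [multinom m (widen_ord (leqnSn n) i) | i < n].
have rP m : (r m == r m0) && (m0 ord_max == m ord_max) = (m == m0).
  apply/idP/eqP => [/andP[/eqP/mnmP h1 /eqP h2]|->]; last by rewrite !eqxx.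
  apply/mnmP => i; have [j ->|->] := unliftP ord_max i; last by rewrite h2.
  have -> : lift ord_max j = widen_ord (leqnSn n) j.
    by apply: val_inj; rewrite /= /bump leqNgt ltn_ord.
  by have := h1 j; rewrite !mnmE.
rewrite -[RHS](mcoeff0 k (r m0)) -(muni0 (m0 ord_max)) muniE coef_sum raddf_sum /=.
rewrite [in LHS](mpolyE F) raddf_sum /=; apply: eq_bigr => m _.
rewrite coefZ coefXn mcoeffZ mcoeffX mulr_natr mcoeffMn mcoeffZ mcoeffX -/(r m).
by rewrite -rP; case: (r m == _); case: (m0 ord_max == _); rewrite /= ?mulr0 ?mul0rn.
Qed.

Lemma mpoly_row0 n (F : {mpoly k[n]}) :
  (forall x : 'rV_n, F.@[x 0] = 0) -> F = 0.
Proof.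
move=> h; apply: mpoly_fun0 => v; rewrite -[RHS](h (\row_i v i)).
by apply: meval_eq => i; rewrite mxE.
Qed.

Lemma mpoly_rowP n (F G : {mpoly k[n]}) :
  (forall x : 'rV_n, F.@[x 0] = G.@[x 0]) -> F = G.
Proof.
move=> h; apply/eqP; rewrite -subr_eq0; apply/eqP/mpoly_row0 => v.
by rewrite mevalB h subrr.
Qed.

(** The complement of a hypersurface is dense. This extends identities from points in general
    position to all points. *)
Lemma mpoly_row0_off n (D F : {mpoly k[n]}) :
  D != 0 -> (forall x : 'rV_n, D.@[x 0] != 0 -> F.@[x 0] = 0) -> F = 0.
Proof.
move=> nzD h; have /eqP : F * D = 0.
  apply: mpoly_row0 => x; rewrite mevalM.
  by have [->|/h->] := eqVneq D.@[x 0] 0; rewrite ?mulr0 ?mul0r.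
by rewrite mulf_eq0 (negPf nzD) orbF => /eqP.
Qed.

Lemma exists_mpoly_neq0 n (F : {mpoly k[n]}) :
  F != 0 -> exists x : 'rV[k]_n, F.@[x 0] != 0.
Proof.
move=> nzF; apply: NNPP => nex; case/eqP: nzF; apply: mpoly_row0 => x.
by apply/eqP; apply: contraT => nz; case: nex; exists x.
Qed.

(** For fixed [x] both sides are polynomials in [c]. Comparing coefficients, the part [G] of [F] of
    a degree other than [d] vanishes at every point. *)
Lemma homog_of_scaling n d (F : {mpoly k[n]}) :
  (forall c (x : 'rV_n), F.@[(c *: x) 0] = c ^+ d * F.@[x 0]) -> F \is d.-homog.
Proof.
move=> h; apply/dhomogP => m mF; apply/eqP; apply: contraT => ne_md.
pose G := \sum_(m' <- msupp F | mdeg m' == mdeg m) F@_m' *: 'X_[m'].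
have G0 : G = 0.
  apply: mpoly_row0 => x.
  pose P := \sum_(m' <- msupp F) (F@_m' * \prod_i x 0 i ^+ m' i) *: 'X^(mdeg m')
    - F.@[x 0] *: 'X^d.
  have P0 : P = 0.
    apply: poly_fun0 => c; rewrite /P hornerD hornerN hornerZ hornerXn.
    rewrite [_ * c ^+ d]mulrC -h mevalE horner_sum -sumrB big1 // => m' _.
    rewrite hornerZ hornerXn -mulrA; apply/eqP; rewrite subr_eq0; apply/eqP.
    congr (_ * _); rewrite mdegE -prodrXr -big_split /=; apply: eq_bigr => i _.
    by rewrite mxE exprMn mulrC.
  have := congr1 (fun Q : {poly k} => Q`_(mdeg m)) P0; rewrite /= coef0 => <-.
  rewrite /P coefB coefZ coefXn (negPf ne_md) mulr0 subr0 coef_sum.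
  rewrite /G raddf_sum /= big_mkcond /=; apply: eq_bigr => m' _.
  rewrite coefZ coefXn eq_sym; case: eqP => _; rewrite ?mulr0 // mulr1.
  by rewrite mevalZ mevalX.
have : G@_m != 0; last by rewrite G0 mcoeff0 eqxx.
rewrite /G raddf_sum /= (big_rem m) //= eqxx mcoeffZ mcoeffX eqxx mulr1.
rewrite big1_seq ?addr0 -?mcoeff_msupp // => m' /andP[_ m'r].
rewrite mcoeffZ mcoeffX; case: eqP m'r => [->|]; rewrite ?mulr0 //.
by rewrite mem_rem_uniqF // msupp_uniq.
Qed.

Lemma homog_scaling n d (F : {mpoly k[n]}) c (x : 'rV_n) :
  F \is d.-homog -> F.@[(c *: x) 0] = c ^+ d * F.@[x 0].
Proof.
move=> /dhomogP hF; rewrite !mevalE mulr_sumr; apply: eq_big_seq => m /hF /= <-; rewrite mdegE.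
rewrite mulrCA; congr (_ * _).
rewrite -prodrXr -big_split /=; apply: eq_bigr => i _.
by rewrite mxE exprMn.
Qed.

End InfiniteField.

Lemma mnm_subxx n (m : 'X_{1..n}) : (m - m)%MM = 0%MM.
Proof. by apply/mnmP => i; rewrite mnmBE mnm0E subnn. Qed.

(** * Polynomials along curves and lines, directional derivatives *)

Section Curves.
Variable k : closedFieldType.

Definition pcurve n (F : {mpoly k[n]}) (c : 'I_n -> {poly k}) : {poly k} :=
  mmap (@polyC k) c F.

Lemma horner_pcurve n (F : {mpoly k[n]}) c t :
  (pcurve F c).[t] = F.@[fun i => (c i).[t]].
Proof.
rewrite /pcurve mevalE /mmap horner_sum; apply: eq_bigr => m _.
rewrite hornerM hornerC; congr (_ * _).
by rewrite /mmap1 horner_prod; apply: eq_bigr => i _; rewrite horner_exp.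
Qed.

(** The defect [D] of the chain rule is a derivation along the substitution and kills constants and
    variables, so it kills every polynomial. *)
Lemma deriv_pcurve n (F : {mpoly k[n]}) c :
  (pcurve F c)^`() = \sum_(i < n) pcurve F^`M(i) c * (c i)^`().
Proof.
pose D F := (pcurve F c)^`() - \sum_(i < n) pcurve F^`M(i) c * (c i)^`().
suff DP F' : D F' = 0 by have /eqP := DP F; rewrite subr_eq0 => /eqP.
have DD G H : D (G + H) = D G + D H.
  rewrite /D /pcurve !raddfD /= [RHS]addrACA -opprD -big_split /=.
  congr (_ - _); apply: eq_bigr => i _.
  by rewrite mderivD raddfD mulrDl.
have DM G H : D (G * H) = D G * pcurve H c + pcurve G c * D H.
  rewrite /D /pcurve rmorphM /= derivM mulrBl mulrBr [RHS]addrACA -opprD.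
  congr (_ - _); rewrite mulr_suml mulr_sumr -big_split /=.
  by apply: eq_bigr => i _; rewrite mderivM !rmorphD /= !rmorphM /=; ring.
have DC a : D a%:MP = 0.
  rewrite /D /pcurve mmapC derivC big1 ?subrr // => i _.
  by rewrite mderivC rmorph0 mul0r.
have DX i : D 'X_i = 0.
  rewrite /D /pcurve mmapX mmap1U (bigD1 i) //= mderivX mnm1E eqxx scale1r.
  rewrite mnm_subxx mpolyX0 rmorph1 mul1r big1 ?addr0 ?subrr // => j ne_ji.
  by rewrite mderivX mnm1E eq_sym (negPf ne_ji) scale0r rmorph0 mul0r.
elim/mpolyind: F' => [|a m G _ _ IH]; first by rewrite -mpolyC0 DC.
rewrite DD IH addr0 -mul_mpolyC DM DC mul0r add0r.
suff -> : D 'X_[m] = 0 by rewrite mulr0.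
rewrite mpolyXE_id; elim/big_rec: _ => [|i H _ DH]; first by rewrite -mpolyC1 DC.
rewrite DM DH mulr0 addr0; elim: (m i) => [|e IHe].
  by rewrite expr0 -mpolyC1 DC mul0r.
by rewrite exprS DM DX mul0r add0r -mulrA IHe mulr0.
Qed.

Definition dir_deriv n (F : {mpoly k[n]}) (x v : 'rV[k]_n) : k :=
  \sum_(i < n) (F^`M(i)).@[x 0] * v 0 i.

Lemma dir_deriv_curve n (F : {mpoly k[n]}) c (t : k) (x v : 'rV_n) :
  (forall i, (c i).[t] = x 0 i) -> (forall i, (c i)^`().[t] = v 0 i) ->
  dir_deriv F x v = (pcurve F c)^`().[t].
Proof.
move=> cx cv; rewrite deriv_pcurve horner_sum; apply: eq_bigr => i _.
by rewrite hornerM horner_pcurve cv; congr (_ * _); apply/esym/meval_eq.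
Qed.

Lemma dir_deriv_line n (F : {mpoly k[n]}) (x v : 'rV_n) :
  dir_deriv F x v =
  (pcurve F (fun i => (x 0 i)%:P + (v 0 i) *: 'X))^`().[0].
Proof.
apply: dir_deriv_curve => i.
  by rewrite hornerD hornerC hornerZ hornerX mulr0 addr0.
by rewrite derivD derivC derivZ derivX add0r hornerZ hornerC mulr1.
Qed.

Lemma horner_pcurve_line n (F : {mpoly k[n]}) (x v : 'rV_n) t :
  (pcurve F (fun i => (x 0 i)%:P + (v 0 i) *: 'X)).[t] = F.@[(x + t *: v) 0].
Proof.
rewrite horner_pcurve; apply: meval_eq => i.
by rewrite hornerD hornerC hornerZ hornerX !mxE mulrC.
Qed.

Lemma dir_derivDr n (F : {mpoly k[n]}) (x v w : 'rV_n) :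
  dir_deriv F x (v + w) = dir_deriv F x v + dir_deriv F x w.
Proof.
by rewrite -big_split; apply: eq_bigr => i _; rewrite mxE mulrDr.
Qed.

Lemma dir_derivZr n (F : {mpoly k[n]}) c (x v : 'rV_n) :
  dir_deriv F x (c *: v) = c * dir_deriv F x v.
Proof.
by rewrite /dir_deriv mulr_sumr; apply: eq_bigr => i _; rewrite mxE; ring.
Qed.

Lemma dir_deriv0r n (F : {mpoly k[n]}) (x : 'rV_n) : dir_deriv F x 0 = 0.
Proof. by rewrite /dir_deriv big1 // => i _; rewrite mxE mulr0. Qed.

Lemma dir_derivB n (F G : {mpoly k[n]}) (x v : 'rV_n) :
  dir_deriv (F - G) x v = dir_deriv F x v - dir_deriv G x v.
Proof.
by rewrite -sumrB; apply: eq_bigr => i _; rewrite mderivB mevalB mulrBl.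
Qed.

Lemma dir_derivM n (F G : {mpoly k[n]}) (x v : 'rV_n) :
  dir_deriv (F * G) x v =
  dir_deriv F x v * G.@[x 0] + F.@[x 0] * dir_deriv G x v.
Proof.
rewrite /dir_deriv mulr_suml mulr_sumr -big_split; apply: eq_bigr => i _ /=.
by rewrite mderivM mevalD !mevalM; ring.
Qed.

Lemma dir_deriv_const n a (x v : 'rV[k]_n) : dir_deriv a%:MP x v = 0.
Proof. by rewrite /dir_deriv big1 // => i _; rewrite mderivC meval0 mul0r. Qed.

Lemma dir_deriv_coord n i (x v : 'rV[k]_n) : dir_deriv 'X_i x v = v 0 i.
Proof.
rewrite /dir_deriv (bigD1 i) //= mderivX mnm1E eqxx scale1r mnm_subxx mpolyX0.
rewrite meval1 mul1r big1 ?addr0 // => j ne_ji.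
by rewrite mderivX mnm1E eq_sym (negPf ne_ji) scale0r meval0 mul0r.
Qed.

End Curves.

(** * Resultants of binary forms *)

Section Sylvester.

(* The resultant of [A] and [B] seen as binary forms of degrees [a] and [b];
   unlike [resultant], it does not depend on the actual degrees. *)
Definition sylv (R : nzRingType) a b (A B : {poly R}) : 'M[R]_(a + b) :=
  col_mx (\matrix_(j < a, l < a + b) ('X^j * B)`_l)
         (\matrix_(i < b, l < a + b) ('X^i * A)`_l).

Lemma map_sylv (R S : nzRingType) (f : {rmorphism R -> S}) a b A B :
  map_mx f (sylv a b A B) = sylv a b (map_poly f A) (map_poly f B).
Proof.
rewrite /sylv map_col_mx; congr col_mx; apply/matrixP => i j; rewrite !mxE.
  by rewrite -coef_map rmorphM /= map_polyXn.
by rewrite -coef_map rmorphM /= map_polyXn.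
Qed.

Definition row_poly (R : nzRingType) n (v : 'rV[R]_n) : {poly R} :=
  \sum_j v 0 j *: 'X^j.

Lemma coef_row_poly (R : nzRingType) n (v : 'rV[R]_n) (j : 'I_n) :
  (row_poly v)`_j = v 0 j.
Proof.
rewrite coef_sum (bigD1 j) //= coefZ coefXn eqxx mulr1 big1 ?addr0 // => i ne_ij.
by rewrite coefZ coefXn eq_sym (inj_eq val_inj) (negPf ne_ij) mulr0.
Qed.

Lemma size_row_poly (R : nzRingType) n (v : 'rV[R]_n) : (size (row_poly v) <= n)%N.
Proof.
apply/(leq_trans (size_sum _ _ _))/bigmax_leqP => i _.
by rewrite (leq_trans (size_scale_leq _ _)) // size_polyXn.
Qed.

Lemma row_poly_eq0 (R : nzRingType) n (v : 'rV[R]_n) : row_poly v = 0 -> v = 0.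
Proof.
by move=> v0; apply/rowP => j; rewrite -coef_row_poly v0 coef0 mxE.
Qed.

Lemma row_polyD (R : nzRingType) n (v w : 'rV[R]_n) :
  row_poly (v + w) = row_poly v + row_poly w.
Proof. by rewrite -big_split; apply: eq_bigr => i _; rewrite mxE scalerDl. Qed.

Lemma row_polyZ (R : nzRingType) n c (v : 'rV[R]_n) :
  row_poly (c *: v) = c *: row_poly v.
Proof. by rewrite scaler_sumr; apply: eq_bigr => i _; rewrite mxE scalerA. Qed.

Lemma row_polyK (R : nzRingType) n (p : {poly R}) :
  (size p <= n)%N -> row_poly (\row_(i < n) p`_i) = p.
Proof.
move=> sp; apply/polyP => i; have [lt_in|le_ni] := ltnP i n.
  by rewrite (coef_row_poly _ (Ordinal lt_in)) mxE.
rewrite !nth_default ?(leq_trans sp) //.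
exact: leq_trans (size_row_poly _) le_ni.
Qed.

Lemma horner_row_poly (R : comNzRingType) n (v : 'rV[R]_n) x :
  (row_poly v).[x] = \sum_j v 0 j * x ^+ j.
Proof. by rewrite horner_sum; apply: eq_bigr => i _; rewrite hornerZ hornerXn. Qed.

Lemma mul_row_sylv (R : comNzRingType) a b (A B : {poly R}) (V : 'rV_a) (U : 'rV_b) l :
  (row_mx V U *m sylv a b A B) 0 l = (row_poly V * B + row_poly U * A)`_l.
Proof.
rewrite mul_row_col !mxE coefD !mulr_suml !coef_sum.
by congr (_ + _); apply: eq_bigr => j _; rewrite mxE -scalerAl coefZ.
Qed.

Lemma size_mulS (R : nzRingType) m n (p q : {poly R}) :
  (size p <= m -> size q <= n.+1 -> size (p * q)%R <= m + n)%N.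
Proof. by move=> sp sq; apply: leq_trans (size_polyMleq _ _) _; lia. Qed.

Variable k : closedFieldType.

(** The last alternative is a common zero at infinity. A left kernel vector is a relation V B + U A
    = 0 with deg V < a and deg U < b; if [A] and [B] are coprime and one of them has full degree,
    divisibility forces V = U = 0. *)
Lemma sylv_det_eq0 a b (A B : {poly k}) : (0 < a + b)%N ->
  (size A <= a.+1)%N -> (size B <= b.+1)%N ->
  \det (sylv a b A B) = 0 <->
  (exists x, root A x && root B x) \/ (A`_a = 0 /\ B`_b = 0).
Proof.
move=> ab_gt0 sA sB; split=> [/eqP/det0P[v nz_v]|h].
  rewrite -[v]hsubmxK; set V := lsubmx v; set U := rsubmx v => /rowP vS.
  have VU0 : row_poly V * B + row_poly U * A = 0.
    apply/polyP => l; rewrite coef0; have [lt_l|le_l] := ltnP l (a + b).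
      by have := vS (Ordinal lt_l); rewrite mul_row_sylv mxE.
    apply/nth_default/leq_trans/le_l; apply: leq_trans (size_polyD _ _) _.
    rewrite geq_max (size_mulS (size_row_poly _) sB) /=.
    by rewrite addnC (size_mulS (size_row_poly _) sA).
  apply: NNPP => /not_or_and[nr /not_and_or ntop].
  have coAB : coprimep A B.
    apply: Pdiv.ClosedField.root_coprimep => x rA; apply/negP => rB.
    by case: nr; exists x; rewrite rA.
  have dA : A %| row_poly V * B.
    by rewrite -(addrK (row_poly U * A) (_ * B)) VU0 sub0r dvdpNr dvdp_mull.
  have dB : B %| row_poly U * A.
    by rewrite -(addKr (row_poly V * B) (_ * A)) VU0 addr0 dvdpNr dvdp_mull.
  rewrite Gauss_dvdpl // in dA; rewrite Gauss_dvdpl 1?coprimep_sym // in dB.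
  have VU : row_poly V = 0 /\ row_poly U = 0.
    have low (P Q : {poly k}) n : P`_n <> 0 -> (size Q <= n)%N -> P %| Q -> Q = 0.
      move=> Pn sQ dPQ; apply/eqP; apply: contraT => nzQ; case: Pn.
      by apply/nth_default/leq_trans/sQ/dvdp_leq.
    have nz (P : {poly k}) n : P`_n <> 0 -> P != 0.
      by move=> Pn; apply: contra_notN Pn => /eqP->; rewrite coef0.
    case: ntop => [An|Bn].
      have V0 := low _ _ _ An (size_row_poly _) dA; split=> //.
      move/eqP: VU0; rewrite V0 mul0r add0r mulf_eq0 (negPf (nz _ _ An)) orbF.
      by move/eqP.
    have U0 := low _ _ _ Bn (size_row_poly _) dB; split=> //.
    move/eqP: VU0; rewrite U0 mul0r addr0 mulf_eq0 (negPf (nz _ _ Bn)) orbF.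
    by move/eqP.
  case/negP: nz_v; case: VU => /row_poly_eq0 V0 /row_poly_eq0 U0.
  by rewrite -[v]hsubmxK -/V -/U V0 U0 row_mx0.
(* Conversely a common zero yields a right kernel vector: the powers of the root, or the last unit
   vector for the zero at infinity. *)
have [w [nzw wS]] : exists w : 'cV_(a + b), w != 0 /\ sylv a b A B *m w = 0.
  case: h => [[x /andP[/rootP rA /rootP rB]]|[A0 B0]].
    exists (\col_l x ^+ l); split.
      apply/negP => /eqP/colP/(_ (Ordinal ab_gt0)); rewrite !mxE expr0.
      by move/eqP; rewrite oner_eq0.
    have ev (P : {poly k}) n (m : 'I_n) e : (n + e = a + b)%N -> (size P <= e.+1)%N ->
        P.[x] = 0 -> \sum_(l < a + b) ('X^m * P)`_l * x ^+ l = 0.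
      move=> <- sP Px; rewrite -horner_coef_wide ?hornerM ?Px ?mulr0 //.
      by apply: size_mulS sP; rewrite size_polyXn.
    rewrite mul_col_mx -[0 in RHS]vsubmxK !linear0; congr col_mx.
      apply/colP => i; rewrite !mxE -[RHS](ev B _ i b) //.
      by apply: eq_bigr => l _; rewrite !mxE.
    apply/colP => i; rewrite !mxE -[RHS](ev A _ i a) // 1?addnC //.
    by apply: eq_bigr => l _; rewrite !mxE.
  have lt_m : ((a + b).-1 < a + b)%N by rewrite prednK.
  exists (delta_mx (Ordinal lt_m) 0); split.
    apply/negP => /eqP/colP/(_ (Ordinal lt_m)); rewrite !mxE !eqxx.
    by move/eqP; rewrite oner_eq0.
  rewrite -colE.
  have ev (P : {poly k}) n (m : 'I_n) e : (n + e = a + b)%N -> (size P <= e.+1)%N ->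
      P`_e = 0 -> ('X^m * P)`_(a + b).-1 = 0.
    move=> ne sP Pe; rewrite coefXnM ifN; last by have := ltn_ord m; lia.
    have [->//|ne_e] := eqVneq ((a + b).-1 - m)%N e.
    by apply/nth_default/(leq_trans sP); have := ltn_ord m; lia.
  rewrite /sylv; apply/colP => i; rewrite !mxE; case: split_ordP => j _.
    by rewrite mxE (ev _ _ _ b).
  by rewrite mxE (ev _ _ _ a) // addnC.
apply/eqP; rewrite -det_tr; apply/det0P; exists w^T.
  by rewrite -(inj_eq trmx_inj) trmxK trmx0.
by rewrite -trmx_mul wS trmx0.
Qed.

(** Right multiplication by [E], whose first columns are the powers of the roots of [A], evaluates
    the rows at these roots: the rows of [A] become zero there and those of [B] a Vandermonde matrix
    scaled by the values of [B]. *)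
Lemma sylv_det_prod a b (A B : {poly k}) (th : 'I_a -> k) : injective th ->
  (size A <= a.+1)%N -> (size B <= b.+1)%N -> (forall i, A.[th i] = 0) ->
  \det (sylv a b A B) = A`_a ^+ b * \prod_i B.[th i].
Proof.
move=> inj_th sA sB rA.
pose V1 := Vandermonde a (\row_i th i).
pose V2 := \matrix_(l < b, i < a) th i ^+ (a + l).
pose E := block_mx V1 0 V2 1%:M.
have dV1 : \det V1 != 0.
  rewrite det_Vandermonde; apply/prodf_neq0 => i _; apply/prodf_neq0 => j lt_ij.
  rewrite !mxE subr_eq0; apply/eqP => /inj_th ji.
  by rewrite ji ltnn in lt_ij.
have dE : \det E = \det V1 by rewrite det_lblock det1 mulr1.
have hE : col_mx V1 V2 = \matrix_(l < a + b, i < a) th i ^+ l.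
  by apply/matrixP => l i; rewrite !mxE; case: split_ordP => j ->; rewrite !mxE.
have ev (P : {poly k}) m e (i : 'I_a) : (m < a + b - e)%N -> (size P <= e.+1)%N ->
  \sum_(l < a + b) ('X^m * P)`_l * th i ^+ l = th i ^+ m * P.[th i].
  move=> lt_m sP; rewrite -horner_coef_wide ?hornerM ?hornerXn //.
  apply: leq_trans (size_polyMleq _ _) _; rewrite size_polyXn; lia.
apply: (mulIf dV1); rewrite -{1}dE -det_mulmx.
have -> : sylv a b A B *m E =
  block_mx (V1 *m diag_mx (\row_i B.[th i]))
           (\matrix_(j < a, l < b) ('X^j * B)`_(a + l))
           0 (\matrix_(i < b, l < b) ('X^i * A)`_(a + l)).
  rewrite /E block_mxEh hE /sylv mul_col_row; congr block_mx.
  - apply/matrixP => j i; rewrite mul_mx_diag !mxE -(ev B j b i) //.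
      by apply: eq_bigr => l _; rewrite !mxE.
    by have := ltn_ord j; lia.
  - apply/matrixP => j l; rewrite !mxE big_split_ord /= big1 ?add0r => [|i _].
      rewrite (bigD1 l) //= big1 ?addr0 => [|i ne_il].
        by rewrite !mxE (unsplitK (inr l)) !mxE eqxx mulr1.
      by rewrite !mxE (unsplitK (inr i)) !mxE (negPf ne_il) mulr0.
    by rewrite !mxE (unsplitK (inl i)) !mxE mulr0.
  - apply/matrixP => j i; have := ev A j a i; rewrite rA mulr0 => evA.
    rewrite [RHS]mxE -[RHS]evA ?mxE //; last by have := ltn_ord j; lia.
    by apply: eq_bigr => l _; rewrite !mxE.
  - apply/matrixP => j l; rewrite !mxE big_split_ord /= big1 ?add0r => [|i _].
      rewrite (bigD1 l) //= big1 ?addr0 => [|i ne_il].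
        by rewrite !mxE (unsplitK (inr l)) !mxE eqxx mulr1.
      by rewrite !mxE (unsplitK (inr i)) !mxE (negPf ne_il) mulr0.
    by rewrite !mxE (unsplitK (inl i)) !mxE mulr0.
rewrite det_ublock det_mulmx det_diag mulrC mulrA [RHS]mulrAC; congr (_ * _ * _).
  (* The remaining block has entries the coefficients of [A] of index a + l - i; it is lower
     triangular with the coefficient of X^a on its diagonal. *)
  rewrite det_trig; last first.
    apply/is_trig_mxP => i l lt_il; rewrite mxE coefXnM ifN; last by lia.
    by apply/nth_default/(leq_trans sA); lia.
  rewrite -[in RHS](card_ord b) -prodr_const; apply: eq_bigr => i _.
  by rewrite mxE coefXnM ifN ?addnK //; lia.
by apply: eq_bigr => i _; rewrite mxE.
Qed.

End Sylvester.

(** * Top coefficients relative to a formal degree *)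

Section TopCoefficient.
Variable R : comNzRingType.
Implicit Types P Q : {poly R}.

(** The coefficient [c] may be zero: the degree is only bounded by [n], which makes the notion
    stable under sums and determinants. *)
Definition has_top n P (c : R) := (size P <= n.+1)%N /\ P`_n = c.

Lemma has_topM m n P Q c d :
  has_top m P c -> has_top n Q d -> has_top (m + n) (P * Q) (c * d).
Proof.
move=> [sP <-] [sQ <-]; split; first by rewrite -addSn size_mulS.
rewrite coefM (bigD1 (Ordinal (leq_addr n m : m < (m + n).+1)%N)) //= addKn.
rewrite big1 ?addr0 // => i ne_im; have [lt_im|lt_mi|eq_im] := ltngtP i m.
- by rewrite [Q`__]nth_default ?mulr0 //; apply: leq_trans sQ _; lia.
- by rewrite [P`__]nth_default ?mul0r //; apply: leq_trans sP _.
- by case/eqP: ne_im; apply: val_inj.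
Qed.

Lemma has_top_prod (I : finType) (e : I -> nat) (P : I -> {poly R}) c :
  (forall i, has_top (e i) (P i) (c i)) ->
  has_top (\sum_i e i) (\prod_i P i) (\prod_i c i).
Proof.
move=> h; elim/big_rec3: _ => [|i n Q p _]; last exact: has_topM.
by split; rewrite ?size_poly1 // coef1.
Qed.

Lemma has_topX m P c e : has_top m P c -> has_top (m * e) (P ^+ e) (c ^+ e).
Proof.
move=> h; elim: e => [|e IH]; last by rewrite mulnS !exprS; apply: has_topM.
by rewrite muln0 !expr0; split; rewrite ?size_poly1 // coef1.
Qed.

Lemma has_top_sum n (I : eqType) (r : seq I) (P : I -> {poly R}) c :
  (forall i, i \in r -> has_top n (P i) (c i)) ->
  has_top n (\sum_(i <- r) P i) (\sum_(i <- r) c i).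
Proof.
move=> h; rewrite !big_seq; elim/big_rec2: _ => [|i y1 y2 /h[sP cP] [s2 c2]].
  by split; rewrite ?size_poly0 ?coef0.
split; last by rewrite coefD cP c2.
by apply: leq_trans (size_polyD _ _) _; rewrite geq_max sP.
Qed.

Lemma has_topZ n P c (a : R) : has_top n P c -> has_top n (a *: P) (a * c).
Proof.
move=> [sP cP]; split; last by rewrite coefZ cP.
exact: leq_trans (size_scale_leq _ _) sP.
Qed.

Lemma has_top_det n (M : 'M[{poly R}]_n) (B : 'M[R]_n) :
  (forall i j, has_top 1 (M i j) (B i j)) -> has_top n (\det M) (\det B).
Proof.
move=> h; apply: has_top_sum => s _; rewrite -signr_odd -[(-1) ^+ _ in X in has_top _ _ X]signr_odd.
have hs : has_top n (\prod_i M i (s i)) (\prod_i B i (s i)).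
  have := has_top_prod (fun i => h i (s i)).
  by rewrite sum_nat_const card_ord muln1.
case: odd; rewrite ?expr1 ?expr0 ?mul1r // !mulN1r.
by case: hs => [sP cP]; split; rewrite ?size_polyN // coefN cP.
Qed.

Lemma has_top_size n P c : has_top n P c -> c != 0 -> size P = n.+1.
Proof.
move=> [sP <-] nz; apply/eqP; rewrite eqn_leq sP ltnNge.
by apply: contra nz => /(nth_default 0)->.
Qed.

Lemma has_top_line (a b : R) : has_top 1 (a%:P + b *: 'X) b.
Proof.
split; last by rewrite coefD coefC coefZ coefX mulr1 add0r.
apply: leq_trans (size_polyD _ _) _; rewrite geq_max size_polyC.
by rewrite (leq_trans (size_scale_leq _ _)) ?size_polyX //; case: (a != 0).
Qed.

End TopCoefficient.

(** * Generators of the ideal of a hypersurface *)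

Section Specialization.
Variables (k : closedFieldType) (R : comNzRingType).

(** Let [D] be the resultant of [P] and P' K; it is nonzero at [w]. Wherever it is nonzero, the
    specialization of [P] has [d] distinct roots and [K] vanishes at none of them, so the remainder
    of [G] modulo [P], of degree less than [d], specializes to zero. *)
Lemma divides_of_specializations (I : Type) (ev : I -> {rmorphism R -> k}) d
    (P K G : {poly R}) w :
  has_top d P 1 ->
  coprimep (map_poly (ev w) P) ((map_poly (ev w) P)^`() * map_poly (ev w) K) ->
  (forall D r, ev w D != 0 -> (forall o, ev o D != 0 -> ev o r = 0) -> r = 0) ->
  (forall o x, root (map_poly (ev o) P) x -> (map_poly (ev o) K).[x] != 0 ->
     (map_poly (ev o) G).[x] = 0) ->
  exists Q, G = Q * P.
Proof.
move=> [sP cP] co sep vG.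
pose PK := P^`() * K; pose m := (size PK).+1.
pose D := \det (sylv d m P PK).
pose Po o := map_poly (ev o) P; pose Ko o := map_poly (ev o) K.
have De o : ev o D = \det (sylv d m (Po o) ((Po o)^`() * Ko o)).
  by rewrite -det_map_mx map_sylv rmorphM /= -deriv_map.
have sPo o : (size (Po o) <= d.+1)%N by rewrite (leq_trans (size_poly _ _)).
have cPo o : (Po o)`_d = 1 by rewrite coef_map cP /= rmorph1.
have sPK o : (size ((Po o)^`() * Ko o)%R <= m.+1)%N.
  rewrite deriv_map -rmorphM /= (leq_trans (size_poly _ _)) //.
  exact: leqW (leqnSn _).
have dm_gt0 : (0 < d + m)%N by rewrite addnS.
have nzD : ev w D != 0.
  apply/negP; rewrite De => /eqP /(sylv_det_eq0 dm_gt0 (sPo w) (sPK w)).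
  case=> [[x /andP[r1 r2]]|[]]; last by rewrite cPo => /eqP; rewrite oner_eq0.
  by have := coprimep_root co r1; rewrite (rootP r2) eqxx.
have P_mon : P \is monic.
  by rewrite monicE lead_coefE (has_top_size (conj sP cP)) ?oner_eq0 ?cP.
have eqG := Pdiv.RingMonic.rdivp_eq P_mon G.
set q := Pdiv.Ring.rdivp _ _ in eqG; set r := Pdiv.Ring.rmodp _ _ in eqG.
have sr : (size r <= d)%N.
  rewrite -ltnS; apply: leq_trans sP.
  by rewrite Pdiv.Ring.ltn_rmodpN0 // monic_neq0.
suff r0 : r = 0 by exists q; rewrite [LHS]eqG r0 addr0.
apply/polyP => j; rewrite coef0; apply: (sep D) => // o.
rewrite De => /eqP; rewrite (sylv_det_eq0 dm_gt0 (sPo o) (sPK o)).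
move=> /not_or_and[nr _].
have co_o : coprimep (Po o) ((Po o)^`() * Ko o).
  apply: Pdiv.ClosedField.root_coprimep => x rA; apply/negP => rB.
  by case: nr; exists x; rewrite rA.
pose ro := map_poly (ev o) r.
suff ro0 : ro = 0 by rewrite -[LHS](coef_map (ev o)) -/ro ro0 coef0.
have [rs lrs] := closed_field_poly_normal (Po o).
have szPo := has_top_size (conj (sPo o) (cPo o)) (oner_neq0 k).
have llf : lead_coef (Po o) = 1 by rewrite lead_coefE szPo cPo.
have szrs : size rs = d.
  by move: szPo; rewrite lrs llf scale1r size_prod_XsubC => -[].
have urs : uniq rs.
  rewrite -separable_prod_XsubC -[\prod_(_ <- _) _]scale1r -{1}llf -lrs.
  by rewrite unlock; move: co_o; rewrite coprimepMr => /andP[].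
have eqGo := congr1 (map_poly (ev o)) eqG.
rewrite rmorphD rmorphM /= -/(Po o) -/ro in eqGo.
apply/eqP; apply: contraT => nz_ro.
suff rro : all (root ro) rs.
  have := max_poly_roots nz_ro rro urs.
  by rewrite szrs ltnNge (leq_trans (size_poly _ _)).
apply/allP => x xrs.
have rx : root (Po o) x by rewrite lrs llf scale1r root_prod_XsubC.
have Gx : (map_poly (ev o) G).[x] = 0.
  apply: vG => //; have := coprimep_root co_o rx.
  by rewrite hornerM mulf_eq0 negb_or => /andP[].
apply/rootP; have := congr1 (horner^~ x) eqGo.
by rewrite /= Gx hornerD hornerM (rootP rx) mulr0 add0r.
Qed.

End Specialization.

Section GeneratorOfVanishingIdeal.
Variable k : closedFieldType.
Hypothesis char0 : [pchar k] =i pred0.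

Definition line n (F : {mpoly k[n]}) (x v : 'rV[k]_n) : {poly k} :=
  pcurve F (fun i => (x 0 i)%:P + (v 0 i) *: 'X).

Lemma horner_line n (F : {mpoly k[n]}) x v t :
  (line F x v).[t] = F.@[(x + t *: v) 0].
Proof. exact: horner_pcurve_line. Qed.

Variable n : nat.
Let R : comNzRingType := {mpoly k[n]}.

(* [F (X + T v)], with [X] the generic point. *)
Definition generic_line (v : 'rV[k]_n) : {mpoly k[n]} -> {poly {mpoly k[n]}} :=
  mmap (@polyC _ \o @mpolyC n k) (fun i => ('X_i)%:P + (v 0 i)%:MP *: 'X).

Lemma map_generic_line F (o v : 'rV[k]_n) :
  map_poly (meval (o 0)) (generic_line v F) = line F o v.
Proof.
rewrite /generic_line /line /pcurve /mmap rmorph_sum /=; apply: eq_bigr => m _.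
rewrite rmorphM /= map_polyC /= mevalC; congr (_ * _).
rewrite rmorph_prod /=; apply: eq_bigr => i _.
by rewrite rmorphXn rmorphD /= map_polyC map_polyZ /= map_polyX mevalC mevalXU.
Qed.

Lemma generic_line_at0 F (v : 'rV[k]_n) : (generic_line v F).[0] = F.
Proof.
rewrite [RHS]mpolyE /generic_line /mmap horner_sum; apply: eq_bigr => m _.
rewrite hornerM hornerC mul_mpolyC mpolyXE_id horner_prod; congr (_ *: _).
apply: eq_bigr => i _.
by rewrite horner_exp hornerD hornerC hornerZ hornerX mulr0 addr0.
Qed.

Lemma has_top_generic_line F d (v : 'rV[k]_n) : F \is d.-homog ->
  has_top d (generic_line v F) (F.@[v 0])%:MP.
Proof.
move=> /dhomogP hF; rewrite mevalE raddf_sum; apply: has_top_sum => m mF.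
rewrite /= -(hF m mF) mul_polyC mpolyCM; apply: has_topZ.
rewrite rmorph_prod /= mdegE; apply: has_top_prod => i.
have := has_topX (m i) (has_top_line ('X_i : {mpoly k[n]}) (v 0 i)%:MP).
by rewrite mul1n rmorphXn.
Qed.

(** On the generic line in direction [v], [f] becomes monic in the parameter T over the polynomial
    ring, because [f] takes the value 1 at [v]; division with remainder is then possible, and T = 0
    recovers [f] and [G]. *)
Lemma generated_of_monic d (f K G : {mpoly k[n]}) (v w : 'rV[k]_n) :
  f \is d.-homog -> f.@[v 0] = 1 ->
  coprimep (line f w v) ((line f w v)^`() * line K w v) ->
  (forall x : 'rV_n, f.@[x 0] = 0 -> K.@[x 0] != 0 -> G.@[x 0] = 0) ->
  exists Q, G = Q * f.
Proof.
move=> hf fv co vG.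
suff gen gf gK gG : has_top d gf 1 ->
    (forall o : 'rV_n, map_poly (meval (o 0)) gf = line f o v) ->
    (forall o : 'rV_n, map_poly (meval (o 0)) gK = line K o v) ->
    (forall o : 'rV_n, map_poly (meval (o 0)) gG = line G o v) ->
    gf.[0] = f -> gG.[0] = G -> exists Q, G = Q * f.
  apply: (gen (generic_line v f) (generic_line v K) (generic_line v G)).
  - by rewrite -mpolyC1 -fv; apply: has_top_generic_line.
  - by move=> o; apply: map_generic_line.
  - by move=> o; apply: map_generic_line.
  - by move=> o; apply: map_generic_line.
  - exact: generic_line_at0.
  - exact: generic_line_at0.
move=> top_gf ef eK eG f0 G0.
have [||||Q eqG] := @divides_of_specializations _ _ 'rV[k]_n
    (fun o => meval (o 0)) d gf gK gG w; last first.
- by exists Q.[0]; rewrite -[LHS]G0 eqG hornerM f0.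
- move=> o x /=; rewrite ef eK eG.
  by move=> /rootP; rewrite !horner_line; apply: vG.
- move=> D r Dw Dr; apply: (@mpoly_row0_off k char0 n D) => //.
  by apply: contra Dw => /eqP ->; rewrite rmorph0.
- by rewrite ef eK.
- exact: top_gf.
Qed.

Lemma generated_of_line d (f K G : {mpoly k[n]}) (v w : 'rV[k]_n) :
  f \is d.-homog -> f.@[v 0] != 0 ->
  coprimep (line f w v) ((line f w v)^`() * line K w v) ->
  (forall x : 'rV_n, f.@[x 0] = 0 -> K.@[x 0] != 0 -> G.@[x 0] = 0) ->
  exists Q, G = Q * f.
Proof.
move=> hf nzfv co vG; pose c := (f.@[v 0])^-1.
have nzc : c != 0 by rewrite invr_eq0.
have lf : line (c *: f) w v = c *: line f w v.
  by rewrite /line /pcurve mmapZ mul_polyC.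
have [||||Q ->] := @generated_of_monic d (c *: f) K G v w.
- exact: dhomogZ.
- by rewrite mevalZ mulVf.
- by rewrite lf derivZ -scalerAl coprimepZl // coprimepZr.
- by move=> x /eqP; rewrite mevalZ mulf_eq0 (negPf nzc) /= => /eqP; apply: vG.
by exists (c *: Q); rewrite -scalerAr scalerAl.
Qed.

End GeneratorOfVanishingIdeal.

(** * Birational maps *)

Section LeftInverse.
Variable k : closedFieldType.
Hypothesis char0 : [pchar k] =i pred0.

Definition apply_tuple n m (phi : m.-tuple {mpoly k[n]}) (x : 'rV[k]_n) : 'rV[k]_m :=
  \row_i (tnth phi i).@[x 0].

Lemma meval_comp n m (F : {mpoly k[m]}) (phi : m.-tuple {mpoly k[n]}) (x : 'rV_n) :
  (F \mPo phi).@[x 0] = F.@[(apply_tuple phi x) 0].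
Proof. by rewrite comp_mpoly_meval; apply: meval_eq => i; rewrite mxE. Qed.

Lemma dir_deriv_comp n m (F : {mpoly k[m]}) (phi : m.-tuple {mpoly k[n]}) (x v : 'rV_n) :
  dir_deriv (F \mPo phi) x v =
  dir_deriv F (apply_tuple phi x) (\row_i dir_deriv (tnth phi i) x v).
Proof.
rewrite dir_deriv_line; set c := fun i => _.
rewrite (_ : pcurve (F \mPo phi) c = pcurve F (fun i => pcurve (tnth phi i) c)).
  apply/esym/dir_deriv_curve => i.
    rewrite horner_pcurve_line mxE; apply: meval_eq => j.
    by rewrite scale0r addr0.
  by rewrite mxE dir_deriv_line.
apply: (poly_funP char0) => t; rewrite !horner_pcurve comp_mpoly_meval.
by apply: meval_eq => i; rewrite horner_pcurve.
Qed.

Lemma euler n d (F : {mpoly k[n]}) (x : 'rV_n) : F \is d.-homog ->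
  dir_deriv F x x = d%:R * F.@[x 0].
Proof.
move=> hF; rewrite (@dir_deriv_curve _ _ _ (fun i => (x 0 i) *: 'X) 1).
- rewrite (_ : pcurve _ _ = F.@[x 0] *: 'X^d).
    by rewrite derivZ derivXn hornerZ hornerMn hornerXn expr1n mulrC.
  apply: (poly_funP char0) => t; rewrite horner_pcurve hornerZ hornerXn mulrC.
  rewrite -(homog_scaling _ _ hF); apply: meval_eq => i.
  by rewrite hornerZ hornerX !mxE mulrC.
- by move=> i; rewrite hornerZ hornerX mulr1.
- by move=> i; rewrite derivZ derivX hornerZ hornerC mulr1.
Qed.

Lemma mulX_coef0 n (p : {mpoly k[n]}) i (m : 'X_{1..n}) : m i = 0%N -> (p * 'X_i)@_m = 0.
Proof.
move=> mi; rewrite [p]mpolyE mulr_suml raddf_sum /= big1 // => m' _.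
rewrite -scalerAl -mpolyXD mcoeffZ mcoeffX; case: eqP => [h|]; rewrite ?mulr0 //.
by move: mi; rewrite -h mnmDE mnm1E eqxx addn1.
Qed.

(** The relation between the indices [ord0] and [i1] shows that every monomial of [P ord0] contains
    the variable ['X_ord0]; the quotient serves for all [i]. *)
Lemma common_factor n (P : 'I_n.+2 -> {mpoly k[n.+2]}) :
  (forall i j, P i * 'X_j = P j * 'X_i) -> exists p, forall i, P i = p * 'X_i.
Proof.
move=> h; pose i1 : 'I_n.+2 := Ordinal (isT : 1 < n.+2)%N.
have m0 (m : 'X_{1..n.+2}) : m ord0 = 0%N -> (P ord0)@_m = 0.
  move=> m0; rewrite -(mcoeffMX _ U_(i1)) h mulX_coef0 //.
  by rewrite mnmDE m0 mnm1E.
pose p := \sum_(m <- msupp (P ord0)) (P ord0)@_m *: 'X_[m - U_(ord0)].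
have P0 : P ord0 = p * 'X_ord0.
  rewrite /p mulr_suml [LHS]mpolyE; apply: eq_big_seq => m mP.
  rewrite -scalerAl -mpolyXD submK // lep1mP.
  by apply/negP => /eqP /m0 h0; move: mP; rewrite mcoeff_msupp h0 eqxx.
exists p => i; have X0 : 'X_ord0 != 0 :> {mpoly k[n.+2]}.
  apply/negP => /eqP /(congr1 (mcoeff U_(ord0))); rewrite mcoeffX eqxx mcoeff0.
  by move/eqP; rewrite oner_eq0.
by apply: (mulIf X0); rewrite h P0; ring.
Qed.

(* At a point where [psi o phi = p] does not vanish, a vector killed by the
   differential of [phi] is a multiple of the point itself, hence is 0 by Euler's
   identity; a polynomial relation of least degree between the components of
   [phi] would make this differential singular everywhere. *)
Lemma components_independent n (phi psi : n.-tuple {mpoly k[n]}) p e F :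
  (0 < e)%N -> (forall i, tnth phi i \is e.-homog) -> p != 0 ->
  (forall i, tnth psi i \mPo phi = p * 'X_i) -> (0 < n)%N ->
  F \mPo phi = 0 -> F = 0.
Proof.
move=> e_gt0 hphi nzp hpsi n_gt0; have [s] := ubnP (msize F).
elim: s F => // s IH F /ltnSE leF F0; apply/eqP; apply: contraT => nzF.
have nzphi : exists i, tnth phi i != 0.
  apply: NNPP => nphi; pose i0 := Ordinal n_gt0.
  have pX : p * 'X_i0 = (tnth psi i0).@[(0 : 'rV_n) 0]%:MP.
    rewrite -hpsi; apply: (mpoly_rowP char0) => x.
    rewrite mevalC meval_comp; apply: meval_eq => i; rewrite !mxE.
    suff -> : tnth phi i = 0 by rewrite meval0.
    by apply/eqP; apply: contraT => nz; case: nphi; exists i.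
  have c0 : (tnth psi i0).@[(0 : 'rV_n) 0] = 0.
    have := congr1 (meval ((0 : 'rV[k]_n) 0)) pX.
    by rewrite mevalM mevalXU mxE mulr0 mevalC.
  have := mcoeff_eq0 p; move/eqP: pX; rewrite c0 mpolyC0 mulf_eq0 (negPf nzp) /=.
  by move/eqP/(congr1 (mcoeff U_(i0)%MM))/eqP; rewrite mcoeffX eqxx mcoeff0 oner_eq0.
case: nzphi => i1 nzphi.
have [j nzj] : exists j, F^`M(j) != 0.
  apply: NNPP => nj.
  have [cF|] := leqP (msize F) 1.
    have := msize1_polyC cF => Fc; move: F0 nzF; rewrite Fc comp_mpolyC => ->.
    by rewrite eqxx.
  move=> sF; have Fm := mlead_supp nzF; have [i Fi] : exists i, mlead F i != 0%N.
    apply: NNPP => ni; suff m0 : mlead F = 0%MM by rewrite -mlead_deg // m0 mdeg0 in sF.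
    apply/mnmP => i; rewrite mnm0E.
    by apply/eqP; apply: contraT => nz; case: ni; exists i.
  case: nj; exists i; apply/negP => /eqP /(congr1 (mcoeff (mlead F - U_(i))%MM)).
  rewrite mcoeff_deriv mcoeff0 submK ?lep1mP // => /eqP.
  by rewrite -mulr_natr mulf_eq0 (natr_eq0_char0 char0) orbF mleadc_eq0 (negPf nzF).
have nzFj : F^`M(j) \mPo phi != 0.
  apply: contra nzj => /eqP Fj0; apply/eqP/IH => //.
  apply: leq_trans leF; rewrite -(prednK (n := msize F)); last first.
    by rewrite lt0n msize_poly_eq0.
  rewrite ltnS msizeE; apply/bigmax_leqP_seq => m; rewrite mcoeff_msupp mcoeff_deriv.
  move=> nz _; have mF : (m + U_(j))%MM \in msupp F.
    by rewrite mcoeff_msupp; apply: contra nz => /eqP ->; rewrite mul0rn.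
  by have := msize_mdeg_lt mF; rewrite mdegD mdeg1; lia.
have [x nzx] : exists x : 'rV_n,
    (p * (F^`M(j) \mPo phi) * tnth phi i1).@[x 0] != 0.
  by apply: (exists_mpoly_neq0 char0); rewrite !mulf_neq0.
move: nzx; rewrite !mevalM !mulf_eq0 !negb_or meval_comp.
move=> /andP[/andP[px Fx] phix].
pose J : 'M_n := \matrix_(i, l) dir_deriv (tnth phi l) x (delta_mx 0 i).
have JE (v : 'rV_n) : v *m J = \row_l dir_deriv (tnth phi l) x v.
  apply/rowP => l; rewrite !mxE /dir_deriv; apply: eq_bigr => i _; rewrite mxE.
  rewrite mulrC; congr (_ * _); rewrite /dir_deriv (bigD1 i) //= mxE !eqxx mulr1.
  by rewrite big1 ?addr0 // => i' ne; rewrite mxE (negPf ne) andbF mulr0.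
have /det0P[v nzv vJ] : \det J == 0.
  rewrite -det_tr; apply/det0P; pose g := \row_l (F^`M(l)).@[(apply_tuple phi x) 0].
  exists g.
    by apply: contra Fx => /eqP /rowP/(_ j); rewrite !mxE => ->.
  apply/trmx_inj; rewrite trmx_mul trmxK trmx0; apply/colP => i; rewrite !mxE.
  have hz := dir_deriv_comp F phi x (delta_mx 0 i).
  rewrite F0 -mpolyC0 dir_deriv_const in hz; rewrite [RHS]hz.
  apply: eq_bigr => l _.
  by rewrite !mxE mulrC.
have vx i : p.@[x 0] * v 0 i = - dir_deriv p x v * x 0 i.
  have := dir_deriv_comp (tnth psi i) phi x v.
  rewrite hpsi -JE vJ dir_deriv0r dir_derivM dir_deriv_coord mevalXU addrC.
  by move/eqP; rewrite addr_eq0 mulNr => /eqP.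
pose a := - dir_deriv p x v / p.@[x 0].
have va : v = a *: x.
  by apply/rowP => i; rewrite mxE /a -(mulKf px (v 0 i)) vx; ring.
have nza : a != 0 by apply: contra nzv => /eqP a0; rewrite va a0 scale0r.
have /rowP/(_ i1) := vJ; rewrite va JE !mxE dir_derivZr (euler _ (hphi i1)).
apply: contra_eqT => _; apply: mulf_neq0 => //; apply: mulf_neq0 => //.
by rewrite natr_eq0_char0 // -lt0n.
Qed.

(** Since [phi] is homogeneous of positive degree [e], replacing [x] by [c *: x] multiplies the part
    of degree [m] by c^(e m). Comparing powers of [c] separates the homogeneous parts of [psi]. *)
Lemma left_inverse_homog n (phi psi : n.-tuple {mpoly k[n]}) e :
  (0 < e)%N -> (forall i, tnth phi i \is e.-homog) ->
  (forall (x : 'rV_n) i j, (tnth psi i \mPo phi).@[x 0] * x 0 j =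
     (tnth psi j \mPo phi).@[x 0] * x 0 i) ->
  forall m (x : 'rV_n) i j,
    (pihomog mdeg m (tnth psi i) \mPo phi).@[x 0] * x 0 j =
    (pihomog mdeg m (tnth psi j) \mPo phi).@[x 0] * x 0 i.
Proof.
move=> e_gt0 hphi h m x i j.
pose M := maxn m.+1 (maxn (msize (tnth psi i)) (msize (tnth psi j))).
pose Q l m' := (pihomog mdeg m' (tnth psi l) \mPo phi).@[x 0].
have hQ l c : (msize (tnth psi l) <= M)%N -> (tnth psi l \mPo phi).@[(c *: x) 0] =
    \sum_(m' < M) c ^+ (e * m') * Q l m'.
  move=> sl; rewrite [tnth psi l](@pihomog_partitionE _ _ mdeg M) //.
  rewrite meval_comp raddf_sum /=; apply: eq_bigr => m' _.
  rewrite /Q meval_comp exprM -(homog_scaling _ _ (pihomogP mdeg m' (tnth psi l))).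
  by apply: meval_eq => l'; rewrite !mxE (homog_scaling _ _ (hphi l')).
pose P := \sum_(m' < M) (Q i m' * x 0 j - Q j m' * x 0 i) *: 'X^((e * m').+1).
have P0 : P = 0.
  apply: (poly_fun0 char0) => c; rewrite horner_sum.
  have := h (c *: x) i j; rewrite !hQ ?leq_max ?leqnn ?orbT // !mxE.
  move/eqP; rewrite -subr_eq0 !mulr_suml -sumrB => /eqP hc.
  rewrite -[RHS]hc; apply: eq_bigr => m' _.
  by rewrite hornerZ hornerXn exprS; ring.
have ltmM : (m < M)%N by rewrite leq_max leqnn.
have := congr1 (fun R : {poly k} => R`_(e * m).+1) P0; rewrite /= coef0 coef_sum.
rewrite (bigD1 (Ordinal ltmM)) //= coefZ coefXn eqxx mulr1 big1 ?addr0.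
  by move/eqP; rewrite subr_eq0 => /eqP.
move=> m' ne; rewrite coefZ coefXn eqSS eqn_pmul2l // eq_sym.
by rewrite -(inj_eq val_inj) in ne; rewrite (negPf ne) mulr0.
Qed.

(** The given [psi] may be inhomogeneous; a homogeneous part that does not vanish on [phi] is still
    a left inverse. On the other side, phi(psi'(phi(x))) = p(x)^e phi(x), so the relations
    expressing that phi o psi' is the identity hold on the image of [phi], hence identically by
    independence of its components. *)
Lemma birational_of_left_inverse n (phi psi : n.+2.-tuple {mpoly k[n.+2]}) e D :
  (0 < e)%N -> (forall i, tnth phi i \is e.-homog) -> D != 0 ->
  (forall x : 'rV_n.+2, D.@[x 0] != 0 ->
     exists2 s, s != 0 & apply_tuple psi (apply_tuple phi x) = s *: x) ->
  birational phi.
Proof.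
move=> e_gt0 hphi nzD hinv.
have key (x : 'rV_n.+2) i j : (tnth psi i \mPo phi).@[x 0] * x 0 j =
     (tnth psi j \mPo phi).@[x 0] * x 0 i.
  pose L i j := (tnth psi i \mPo phi) * 'X_j.
  suff /(congr1 (meval (x 0))) : L i j = L j i by rewrite !mevalM !mevalXU.
  apply/eqP; rewrite -subr_eq0; apply/eqP.
  apply: (mpoly_row0_off char0 nzD) => y /hinv[s _ /rowP hy].
  rewrite mevalB !mevalM !mevalXU !meval_comp.
  have := hy i; have := hy j; rewrite !mxE => -> ->; ring.
have [m nzm] : exists m, pihomog mdeg m (tnth psi ord0) \mPo phi != 0.
  apply: NNPP => nm.
  have psi0 : tnth psi ord0 \mPo phi = 0.
    rewrite [tnth psi ord0](@pihomog_partitionE _ _ mdeg _ _ (leqnn _)) raddf_sum /=.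
    rewrite big1 // => m _; apply/eqP; apply: contraT => nz; case: nm.
    by exists m.
  have : 'X_ord0 = 0 :> {mpoly k[n.+2]}.
    apply: (mpoly_row0_off char0 nzD) => y /hinv[s nzs /rowP/(_ ord0)].
    rewrite !mxE -meval_comp psi0 meval0 mevalXU => /esym/eqP.
    by rewrite mulf_eq0 (negPf nzs) => /eqP.
  by move/(congr1 (mcoeff U_(ord0)))/eqP; rewrite mcoeffX eqxx mcoeff0 oner_eq0.
pose psi' := [tuple pihomog mdeg m (tnth psi i) | i < n.+2].
have psiE i : tnth psi' i = pihomog mdeg m (tnth psi i) by rewrite tnth_mktuple.
have [p hp] : exists p, forall i, tnth psi' i \mPo phi = p * 'X_i.
  apply: common_factor => i j; apply: (mpoly_rowP char0) => x.
  by rewrite !mevalM !mevalXU !psiE; apply: (left_inverse_homog e_gt0).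
have nzp : p != 0.
  by apply: contra nzm => /eqP p0; rewrite -psiE hp p0 mul0r.
have X0 i : 'X_i != 0 :> {mpoly k[n.+2]}.
  apply/negP => /eqP /(congr1 (mcoeff U_(i))); rewrite mcoeffX eqxx mcoeff0.
  by move/eqP; rewrite oner_eq0.
have indep F : F \mPo phi = 0 -> F = 0.
  exact: (components_independent e_gt0 hphi nzp hp).
have compX i : 'X_i \mPo phi = tnth phi i.
  by rewrite comp_mpolyXU -tnth_nth.
have [i0 nzphi] : exists i, tnth phi i != 0.
  apply: NNPP => nphi; case/eqP: (X0 ord0); apply: indep; rewrite compX.
  by apply/eqP; apply: contraT => nz; case: nphi; exists ord0.
have phi_psi_phi i (x : 'rV_n.+2) :
    (tnth phi i \mPo psi').@[(apply_tuple phi x) 0] = p.@[x 0] ^+ e * (tnth phi i).@[x 0].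
  rewrite meval_comp -(homog_scaling _ _ (hphi i)); apply: meval_eq => j.
  by rewrite !mxE -meval_comp hp mevalM mevalXU.
have [q hq] : exists q, forall i, tnth phi i \mPo psi' = q * 'X_i.
  apply: common_factor => i j; apply/eqP; rewrite -subr_eq0; apply/eqP/indep.
  apply: (mpoly_rowP char0) => x; rewrite meval_comp mevalB !mevalM !mevalXU meval0.
  by rewrite !phi_psi_phi !mxE; ring.
split; first by exists e; split=> //; exists i0.
exists psi'; split.
- exists m; split; first by move=> i; rewrite psiE; apply: pihomogP.
  exists ord0; apply: contra nzm => /eqP h0; rewrite -psiE h0.
  by rewrite comp_mpoly0.
- by exists p.
exists q => //; apply/negP => /eqP q0.
have : p ^+ e * tnth phi i0 = 0.
  apply: (mpoly_rowP char0) => x; rewrite mevalM rmorphXn /= -phi_psi_phi hq q0.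
  by rewrite mul0r !meval0.
by apply/eqP; rewrite mulf_neq0 // expf_neq0.
Qed.

Definition lin_comp n m (F : {mpoly k[m]}) (G : 'M[k]_(n, m)) : {mpoly k[n]} :=
  F \mPo [tuple \sum_(i < n) G i j *: 'X_i | j < m].

Lemma meval_lin_comp n m (F : {mpoly k[m]}) (G : 'M[k]_(n, m)) (x : 'rV_n) :
  (lin_comp F G).@[x 0] = F.@[(x *m G) 0].
Proof.
rewrite meval_comp; apply: meval_eq => j; rewrite !mxE tnth_mktuple raddf_sum.
by apply: eq_bigr => i _ /=; rewrite mevalZ mevalXU mulrC.
Qed.

Lemma lin_comp_homog n m d (F : {mpoly k[m]}) (G : 'M[k]_(n, m)) :
  F \is d.-homog -> lin_comp F G \is d.-homog.
Proof.
move=> hF; apply: (homog_of_scaling char0) => c x; rewrite !meval_lin_comp.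
by rewrite -(homog_scaling _ _ hF) -scalemxAl.
Qed.

Lemma dir_deriv_lin_comp n m (F : {mpoly k[m]}) (G : 'M[k]_(n, m)) (x v : 'rV_n) :
  dir_deriv (lin_comp F G) x v = dir_deriv F (x *m G) (v *m G).
Proof.
rewrite !dir_deriv_line; congr (_^`().[0]); apply: (poly_funP char0) => t.
by rewrite !horner_pcurve_line meval_lin_comp mulmxDl -scalemxAl.
Qed.

Lemma lin_compK n (F : {mpoly k[n]}) (G : 'M[k]_n) :
  G \in unitmx -> lin_comp (lin_comp F G) (invmx G) = F.
Proof.
move=> uG; apply: (mpoly_rowP char0) => x.
by rewrite !meval_lin_comp mulmxKV.
Qed.

Lemma lin_compKV n (F : {mpoly k[n]}) (G : 'M[k]_n) :
  G \in unitmx -> lin_comp (lin_comp F (invmx G)) G = F.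
Proof.
move=> uG; apply: (mpoly_rowP char0) => x.
by rewrite !meval_lin_comp mulmxK.
Qed.

Lemma lin_comp_neq0 n (F : {mpoly k[n]}) (G : 'M[k]_n) :
  G \in unitmx -> F != 0 -> lin_comp F G != 0.
Proof.
move=> uG; apply: contra => /eqP F0; rewrite -(lin_compK F uG) F0.
by rewrite /lin_comp comp_mpoly0.
Qed.

End LeftInverse.

(** * Linear changes of coordinates *)

Section LinearChange.
Variable k : closedFieldType.
Hypothesis char0 : [pchar k] =i pred0.
Variables (n : nat) (G : 'M[k]_n).
Hypothesis uG : G \in unitmx.
Implicit Type X Z : pset k n.

Lemma pset_ext X Z : (forall x, X x <-> Z x) -> X = Z.
Proof.
move=> h; apply: functional_extensionality => x.
exact: propositional_extensionality.
Qed.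

Definition linpre (H : 'M[k]_n) X : pset k n := fun x => X (x *m H).

Lemma vanishes_linpre X F :
  vanishes_on F (linpre G X) <-> vanishes_on (lin_comp F (invmx G)) X.
Proof.
split=> h x Xx; last by rewrite -(lin_compKV char0 F uG) meval_lin_comp h.
by rewrite meval_lin_comp h // /linpre mulmxKV.
Qed.

Lemma zariski_closure_linpre X :
  zariski_closure (linpre G X) = linpre G (zariski_closure X).
Proof.
apply: pset_ext => x; split=> -[nzx cl].
  split; first by apply: contra nzx => /eqP h0; rewrite -(mulmxK uG x) h0 mul0mx.
  move=> d F hF vF; rewrite -meval_lin_comp; apply: (cl d).
    exact: lin_comp_homog.
  by apply/vanishes_linpre; rewrite lin_compK.
split; first by apply: contra nzx => /eqP ->; rewrite mul0mx.
move=> d F hF vF; rewrite -(lin_compKV char0 F uG) meval_lin_comp; apply: (cl d).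
  exact: lin_comp_homog.
by apply/vanishes_linpre.
Qed.

Lemma tangent_linpre X x v :
  tangent_at (linpre G X) x v <-> tangent_at X (x *m G) (v *m G).
Proof.
split=> h d F hF vF.
  have := h d (lin_comp F G) (lin_comp_homog char0 G hF).
  rewrite -/(dir_deriv _ _ _) dir_deriv_lin_comp //; apply.
  by apply/vanishes_linpre; rewrite lin_compK.
rewrite -/(dir_deriv _ _ _) -(lin_compKV char0 F uG) dir_deriv_lin_comp //.
apply: (h d); first exact: lin_comp_homog.
by apply/vanishes_linpre.
Qed.

Lemma alg_independent_linpre X m (g : m.-tuple {mpoly k[n]}) :
  alg_independent_on X g ->
  alg_independent_on (linpre G X) [tuple lin_comp (tnth g i) G | i < m].
Proof.
move=> ind h vh; apply: ind => x Xx.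
have := vh (x *m invmx G); rewrite /linpre mulmxKV // => /(_ Xx) hx.
rewrite -[RHS]hx !meval_comp; apply: meval_eq => i; rewrite !mxE tnth_mktuple.
by rewrite meval_lin_comp mulmxKV.
Qed.

End LinearChange.

Section LinearInvariance.
Variable k : closedFieldType.
Hypothesis char0 : [pchar k] =i pred0.
Variable n : nat.
Implicit Types (X Z : pset k n) (G : 'M[k]_n).

Lemma linpreK G X : G \in unitmx -> linpre (invmx G) (linpre G X) = X.
Proof.
move=> uG; apply: functional_extensionality => x.
by rewrite /linpre mulmxKV.
Qed.

Lemma has_dim_linpre G X e : G \in unitmx -> has_dim X e -> has_dim (linpre G X) e.
Proof.
move=> uG [[g ind] nind]; split; first by eexists; apply: alg_independent_linpre ind.
move=> [g' ind']; apply: nind.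
have uG' : invmx G \in unitmx by rewrite unitmx_inv.
have := alg_independent_linpre uG' ind'; rewrite linpreK // => indX.
by eexists; apply: indX.
Qed.

Lemma smooth_point_linpre G X x : G \in unitmx ->
  smooth_point X (x *m G) -> smooth_point (linpre G X) x.
Proof.
move=> uG [Xx [e [M [dimX fM tgt]]]]; split=> //.
exists e, (M *m invmx G); split; first exact: has_dim_linpre.
  by rewrite /row_free mxrankMfree ?row_free_unit ?unitmx_inv.
move=> v; rewrite tangent_linpre // tgt; split=> h.
  by rewrite -(mulmxK uG v) submxMr.
by rewrite -[M](mulmxKV uG) submxMr.
Qed.

(** Hyperplanes transform by the contragredient matrix, as the pairing [h *m v^T] has to be
    preserved. *)
Lemma dual_variety_linpre G X : G \in unitmx ->
  dual_variety (linpre G X) = linpre (invmx G)^T (dual_variety X).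
Proof.
move=> uG; have uG' : (invmx G)^T \in unitmx by rewrite unitmx_tr unitmx_inv.
rewrite /dual_variety -zariski_closure_linpre //; congr zariski_closure.
apply: pset_ext => h; rewrite /linpre; split=> -[nzh [x sx tx]].
  split; first by apply: contra nzh => /eqP h0; rewrite -(mulmxK uG' h) h0 mul0mx.
  exists (x *m G).
    have := @smooth_point_linpre (invmx G) (linpre G X) (x *m G).
    by rewrite linpreK // mulmxK // unitmx_inv; apply.
  move=> v tv; rewrite -mulmxA -trmx_mul; apply: tx.
  by apply/tangent_linpre; rewrite // mulmxKV.
split; first by apply: contra nzh => /eqP ->; rewrite mul0mx.
exists (x *m invmx G).
  by apply: smooth_point_linpre => //; rewrite mulmxKV.
move=> v /tangent_linpre; rewrite mulmxKV // => /(_ char0 uG) /tx.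
by rewrite -mulmxA -trmx_mul mulmxK.
Qed.

Lemma hypersurface_eq_linpre G d f Z : G \in unitmx ->
  hypersurface_eq d f Z -> hypersurface_eq d (lin_comp f G) (linpre G Z).
Proof.
move=> uG [d_gt0 hf nzf Zf gen]; split=> //.
- exact: lin_comp_homog.
- exact: lin_comp_neq0.
- move=> x; rewrite /linpre Zf meval_lin_comp; split=> -[nzx fx]; split=> //.
    by apply: contra nzx => /eqP ->; rewrite mul0mx.
  by apply: contra nzx => /eqP h0; rewrite -(mulmxK uG x) h0 mul0mx.
move=> g /(vanishes_linpre char0 uG) /gen[q gq]; exists (lin_comp q G).
by rewrite -(lin_compKV char0 g uG) gq /lin_comp rmorphM.
Qed.

Definition lin_conj (phi : n.-tuple {mpoly k[n]}) (G H : 'M[k]_n) :=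
  [tuple \sum_j H j i *: lin_comp (tnth phi j) G | i < n].

Lemma apply_lin_conj phi G H (x : 'rV_n) :
  apply_tuple (lin_conj phi G H) x = apply_tuple phi (x *m G) *m H.
Proof.
apply/rowP => i; rewrite !mxE tnth_mktuple raddf_sum; apply: eq_bigr => j _ /=.
by rewrite mevalZ meval_lin_comp mxE mulrC.
Qed.

Lemma rational_map_lin_conj phi G H : G \in unitmx -> H \in unitmx ->
  rational_map phi -> rational_map (lin_conj phi G H).
Proof.
move=> uG uH [e [hphi [i nzi]]]; exists e; split.
  move=> j; rewrite tnth_mktuple; apply: rpred_sum => l _.
  by apply/dhomogZ/lin_comp_homog.
apply: NNPP => nz; have [x nzx] := exists_mpoly_neq0 char0 (lin_comp_neq0 char0 uG nzi).
case/negP: nzx; rewrite meval_lin_comp.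
have c0 : apply_tuple (lin_conj phi G H) x = 0.
  apply/rowP => j; rewrite !mxE.
  suff -> : tnth (lin_conj phi G H) j = 0 by rewrite meval0.
  by apply/eqP; apply: contraT => nzj; case: nz; exists j.
have := congr1 (mulmx^~ (invmx H)) c0; rewrite apply_lin_conj mulmxK // mul0mx.
by move/rowP/(_ i); rewrite !mxE => ->.
Qed.

Lemma comp_is_id_lin_conj phi psi G H : G \in unitmx -> H \in unitmx ->
  comp_is_id psi phi ->
  comp_is_id (lin_conj psi (invmx H) (invmx G)) (lin_conj phi G H).
Proof.
move=> uG uH [p nzp hp]; exists (lin_comp p G); first exact: lin_comp_neq0.
move=> i; apply: (mpoly_rowP char0) => x; rewrite meval_comp mevalM mevalXU.
have -> : (tnth (lin_conj psi (invmx H) (invmx G)) i).@[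
    (apply_tuple (lin_conj phi G H) x) 0] =
  (apply_tuple (lin_conj psi (invmx H) (invmx G))
    (apply_tuple (lin_conj phi G H) x)) 0 i by rewrite [RHS]mxE.
rewrite !apply_lin_conj mulmxK // meval_lin_comp.
have -> : apply_tuple psi (apply_tuple phi (x *m G)) = p.@[(x *m G) 0] *: (x *m G).
  by apply/rowP => j; rewrite [LHS]mxE -meval_comp hp mevalM mevalXU [RHS]mxE.
by rewrite -scalemxAl mulmxK // mxE.
Qed.

Lemma birational_lin_conj phi G H : G \in unitmx -> H \in unitmx ->
  birational phi -> birational (lin_conj phi G H).
Proof.
move=> uG uH [rphi [psi [rpsi id1 id2]]]; split; first exact: rational_map_lin_conj.
exists (lin_conj psi (invmx H) (invmx G)); split.
- by apply: rational_map_lin_conj; rewrite ?unitmx_inv.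
- exact: comp_is_id_lin_conj.
have := @comp_is_id_lin_conj psi phi (invmx H) (invmx G).
by rewrite !invmxK !unitmx_inv; apply.
Qed.

Lemma polar_map_lin_comp G f : polar_map (lin_comp f G) = lin_conj (polar_map f) G G^T.
Proof.
apply: eq_from_tnth => i; rewrite !tnth_mktuple; apply: (mpoly_rowP char0) => x.
have dE (F : {mpoly k[n]}) (y : 'rV_n) j : (F^`M(j)).@[y 0] = dir_deriv F y (delta_mx 0 j).
  rewrite /dir_deriv (bigD1 j) //= mxE !eqxx mulr1 big1 ?addr0 // => l ne.
  by rewrite mxE (negPf ne) andbF mulr0.
rewrite dE dir_deriv_lin_comp // /dir_deriv raddf_sum; apply: eq_bigr => j _ /=.
rewrite mevalZ meval_lin_comp tnth_mktuple mulrC; congr (_ * _).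
by rewrite -rowE !mxE.
Qed.

Lemma homaloidal_linpre G Z : G \in unitmx -> homaloidal Z -> homaloidal (linpre G Z).
Proof.
move=> uG [d [f [d_gt1 hf bf]]]; exists d, (lin_comp f G); split=> //.
  exact: hypersurface_eq_linpre.
by rewrite polar_map_lin_comp; apply: birational_lin_conj; rewrite ?unitmx_tr.
Qed.

Lemma is_hypersurface_linpre G d Z :
  G \in unitmx -> is_hypersurface d Z -> is_hypersurface d (linpre G Z).
Proof. by move=> uG [f hf]; exists (lin_comp f G); apply: hypersurface_eq_linpre. Qed.

End LinearInvariance.

(** * Polynomial functions of a vector *)

Section PolynomialFunctions.
Variables (k : closedFieldType) (n : nat).
Implicit Types F G : 'rV[k]_n -> k.

(** Resultants, adjugates and gradients are handled through their values; a polynomial representing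
    them is extracted only where an open condition or a rational map is required. *)
Definition polyfun F := exists P : {mpoly k[n]}, forall x : 'rV_n, P.@[x 0] = F x.

Lemma polyfun_const c : polyfun (fun=> c).
Proof. by exists c%:MP => x; rewrite mevalC. Qed.

Lemma polyfun_coord i : polyfun (fun x : 'rV_n => x 0 i).
Proof. by exists 'X_i => x; rewrite mevalXU. Qed.

Lemma polyfunD F G : polyfun F -> polyfun G -> polyfun (fun x => F x + G x).
Proof. by move=> [P hP] [Q hQ]; exists (P + Q) => x; rewrite mevalD hP hQ. Qed.

Lemma polyfunM F G : polyfun F -> polyfun G -> polyfun (fun x => F x * G x).
Proof. by move=> [P hP] [Q hQ]; exists (P * Q) => x; rewrite mevalM hP hQ. Qed.

Lemma polyfunN F : polyfun F -> polyfun (fun x => - F x).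
Proof. by move=> [P hP]; exists (- P) => x; rewrite mevalN hP. Qed.

Lemma polyfunB F G : polyfun F -> polyfun G -> polyfun (fun x => F x - G x).
Proof. by move=> hF hG; apply/polyfunD/polyfunN. Qed.

Lemma polyfunMn F m : polyfun F -> polyfun (fun x => F x *+ m).
Proof. by move=> [P hP]; exists (P *+ m) => x; rewrite mevalMn hP. Qed.

Lemma polyfunX F m : polyfun F -> polyfun (fun x => F x ^+ m).
Proof. by move=> [P hP]; exists (P ^+ m) => x; rewrite rmorphXn /= hP. Qed.

Lemma polyfun_sum (I : Type) (r : seq I) (Q : pred I) (F : I -> 'rV_n -> k) :
  (forall i, polyfun (F i)) -> polyfun (fun x => \sum_(i <- r | Q i) F i x).
Proof.
move=> hF; elim: r => [|i r [P hP]].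
  by exists 0 => x; rewrite big_nil meval0.
have [R hR] := hF i; exists (if Q i then R + P else P) => x.
by rewrite big_cons; case: (Q i); rewrite ?mevalD hP ?hR.
Qed.

Lemma polyfun_prod (I : Type) (r : seq I) (Q : pred I) (F : I -> 'rV_n -> k) :
  (forall i, polyfun (F i)) -> polyfun (fun x => \prod_(i <- r | Q i) F i x).
Proof.
move=> hF; elim: r => [|i r [P hP]].
  by exists 1 => x; rewrite big_nil meval1.
have [R hR] := hF i; exists (if Q i then R * P else P) => x.
by rewrite big_cons; case: (Q i); rewrite ?mevalM hP ?hR.
Qed.

Lemma polyfun_det m (M : 'rV_n -> 'M[k]_m) :
  (forall i j, polyfun (fun x => M x i j)) -> polyfun (fun x => \det (M x)).
Proof.
move=> hM; apply: polyfun_sum => s; apply: polyfunM; first exact: polyfun_const.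
by apply: polyfun_prod.
Qed.

Lemma polyfun_adj m (M : 'rV_n -> 'M[k]_m) i j :
  (forall i j, polyfun (fun x => M x i j)) -> polyfun (fun x => (\adj (M x)) i j).
Proof.
move=> hM; have [P hP] : polyfun (fun x => cofactor (M x) j i).
  apply: polyfunM; first exact: polyfun_const.
  apply: polyfun_det => i' j'.
  have [P hP] := hM (lift j i') (lift i j'); exists P => x; rewrite hP.
  by rewrite !mxE.
by exists P => x; rewrite hP mxE.
Qed.

Lemma polyfun_meval m (F : {mpoly k[m]}) (c : 'rV_n -> 'rV[k]_m) :
  (forall i, polyfun (fun x => c x 0 i)) -> polyfun (fun x => F.@[(c x) 0]).
Proof.
move=> hc; have [P hP] : polyfun (fun x => \sum_(m <- msupp F) F@_m * \prod_i c x 0 i ^+ m i).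
  apply: polyfun_sum => e; apply: polyfunM; first exact: polyfun_const.
  by apply: polyfun_prod => i; apply: polyfunX.
by exists P => x; rewrite hP mevalE.
Qed.

Lemma polyfun_eq F G : (forall x, F x = G x) -> polyfun F -> polyfun G.
Proof. by move=> e [P hP]; exists P => x; rewrite hP. Qed.

Lemma polyfun_mulmx p q r (A : 'rV_n -> 'M[k]_(p, q)) (B : 'rV_n -> 'M[k]_(q, r)) i j :
  (forall i j, polyfun (fun x => A x i j)) -> (forall i j, polyfun (fun x => B x i j)) ->
  polyfun (fun x => (A x *m B x) i j).
Proof.
move=> hA hB; apply: (@polyfun_eq (fun x => \sum_l A x i l * B x l j)).
  by move=> x; rewrite mxE.
by apply: polyfun_sum => l; apply: polyfunM.
Qed.

Definition polyfun_poly (A : 'rV[k]_n -> {poly k}) :=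
  forall i, polyfun (fun x => (A x)`_i).

Lemma polyfun_polyC p : polyfun_poly (fun=> p).
Proof. by move=> i; apply: polyfun_const. Qed.

Lemma polyfun_polyD A B :
  polyfun_poly A -> polyfun_poly B -> polyfun_poly (fun x => A x + B x).
Proof.
move=> hA hB i; apply: (@polyfun_eq (fun x => (A x)`_i + (B x)`_i)).
  by move=> x; rewrite coefD.
exact: polyfunD.
Qed.

Lemma polyfun_polyM A B :
  polyfun_poly A -> polyfun_poly B -> polyfun_poly (fun x => A x * B x).
Proof.
move=> hA hB i; apply: (@polyfun_eq (fun x => \sum_(j < i.+1) (A x)`_j * (B x)`_(i - j))).
  by move=> x; rewrite coefM.
by apply: polyfun_sum => j; apply: polyfunM.
Qed.

Lemma polyfun_polyZ F A :
  polyfun F -> polyfun_poly A -> polyfun_poly (fun x => F x *: A x).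
Proof.
move=> hF hA i; apply: (@polyfun_eq (fun x => F x * (A x)`_i)).
  by move=> x; rewrite coefZ.
exact: polyfunM.
Qed.

Lemma polyfun_polyN A : polyfun_poly A -> polyfun_poly (fun x => - A x).
Proof.
move=> hA i; apply: (@polyfun_eq (fun x => - (A x)`_i)).
  by move=> x; rewrite coefN.
exact: polyfunN.
Qed.

Lemma polyfun_poly_sum (I : Type) (r : seq I) (A : I -> 'rV_n -> {poly k}) :
  (forall i, polyfun_poly (A i)) -> polyfun_poly (fun x => \sum_(i <- r) A i x).
Proof.
move=> hA i; apply: (@polyfun_eq (fun x => \sum_(j <- r) (A j x)`_i)).
  by move=> x; rewrite coef_sum.
by apply: polyfun_sum => j; apply: hA.
Qed.

Lemma polyfun_deriv A : polyfun_poly A -> polyfun_poly (fun x => (A x)^`()).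
Proof.
move=> hA i; apply: (@polyfun_eq (fun x => (A x)`_i.+1 *+ i.+1)).
  by move=> x; rewrite coef_deriv.
exact: polyfunMn.
Qed.

Lemma polyfun_horner (A : 'rV[k]_n -> {poly k}) m y :
  (forall x, size (A x) <= m)%N -> polyfun_poly A -> polyfun (fun x => (A x).[y]).
Proof.
move=> sA hA; apply: (@polyfun_eq (fun x => \sum_(i < m) (A x)`_i * y ^+ i)).
  by move=> x; rewrite -horner_coef_wide.
by apply: polyfun_sum => i; apply: polyfunM => //; apply: polyfun_const.
Qed.

Lemma polyfun_sylv a b A B i j :
  polyfun_poly A -> polyfun_poly B -> polyfun (fun x => sylv a b (A x) (B x) i j).
Proof.
move=> hA hB; rewrite /sylv -(splitK i); case: (split i) => l /=.
  apply: (@polyfun_eq (fun x => ('X^l * B x)`_j)).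
    by move=> x; rewrite col_mxEu mxE.
  by apply: polyfun_polyM => //; apply: polyfun_polyC.
apply: (@polyfun_eq (fun x => ('X^l * A x)`_j)).
  by move=> x; rewrite col_mxEd mxE.
by apply: polyfun_polyM => //; apply: polyfun_polyC.
Qed.

End PolynomialFunctions.

(** * Algebraic dependence *)

Section AlgebraicDependence.
Variable k : closedFieldType.

Lemma msizeM_leS n (p q : {mpoly k[n]}) d e :
  (msize p <= d.+1 -> msize q <= e.+1 -> msize (p * q) <= (d + e).+1)%N.
Proof.
have [->|nzp] := eqVneq p 0; first by rewrite mul0r msize0.
have [->|nzq] := eqVneq q 0; first by rewrite mulr0 msize0.
by rewrite msizeM //; move: (msize p) (msize q) => x y; lia.
Qed.

(* There are more monomials of bounded degree in n + 1 variables than in n. *)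
Lemma alg_dependent n (G : n.+1.-tuple {mpoly k[n]}) :
  exists2 h : {mpoly k[n.+1]}, h != 0 & h \mPo G = 0.
Proof.
pose e := (\max_(i < n.+1) msize (tnth G i))%N.
(* The source has D^(n+1) monomials, with exponents below [D]. Their images have degree at most
   (n+1)(D-1)e, below c D, so at most (c D)^n monomials occur in them; D = c^n + 1 makes the first
   number larger. *)
pose c := (n.+1 * e).+1; pose D := (c ^ n).+1.
pose I := {ffun 'I_n.+1 -> 'I_D}; pose J := {ffun 'I_n -> 'I_(c * D)}.
pose mI (f : I) := [multinom (f i : nat) | i < n.+1].
pose mJ (f : J) := [multinom (f i : nat) | i < n].
have mI_inj : injective mI.
  by move=> f g /mnmP h; apply/ffunP => i; apply: val_inj; have := h i; rewrite !mnmE.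
pose M := \matrix_(r < #|I|, s < #|J|) ('X_[mI (enum_val r)] \mPo G)@_(mJ (enum_val s)).
have lt_JI : (#|J| < #|I|)%N.
  rewrite !card_ffun !card_ord expnS expnMn ltn_mul2r expn_gt0 /=.
  exact: ltnSn.
have /rowV0Pn[v /sub_kermxP vM nzv] : kermx M != 0.
  rewrite -mxrank_eq0 mxrank_ker subn_eq0 -ltnNge.
  exact: leq_ltn_trans (rank_leq_col _) lt_JI.
exists (\sum_r v 0 r *: 'X_[mI (enum_val r)]).
  have [r nzr] : exists r, v 0 r != 0.
    apply/existsP; rewrite -negb_forall; apply: contra nzv => /forallP h.
    by apply/eqP/rowP => r; rewrite mxE; apply/eqP/h.
  apply: contra nzr => /eqP/(congr1 (mcoeff (mI (enum_val r)))).
  rewrite raddf_sum mcoeff0 (bigD1 r) //= mcoeffZ mcoeffX eqxx mulr1 big1 ?addr0 => [->//|i ne].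
  by rewrite mcoeffZ mcoeffX (inj_eq mI_inj) (inj_eq enum_val_inj) (negPf ne) mulr0.
rewrite raddf_sum /=; apply/mpolyP => m; rewrite mcoeff0 raddf_sum /=.
have [/forallP hm|] := boolP [forall i, m i < c * D]%N.
  pose f : J := [ffun i => Ordinal (hm i)].
  have <- : mJ f = m by apply/mnmP => i; rewrite mnmE ffunE.
  move/rowP/(_ (enum_rank f)): vM; rewrite !mxE => vM; rewrite -[RHS]vM.
  by apply: eq_bigr => r _; rewrite comp_mpolyZ mcoeffZ mxE enum_rankK.
rewrite negb_forall => /existsP[i]; rewrite -leqNgt => le_m.
apply: big1 => r _; rewrite comp_mpolyZ mcoeffZ.
suff -> : ('X_[mI (enum_val r)] \mPo G)@_m = 0 by rewrite mulr0.
apply/memN_msupp_eq0/msize_mdeg_ge.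
have le_mi : (m i <= mdeg m)%N by rewrite mdegE (bigD1 i) //= leq_addr.
apply: leq_trans (leq_trans le_m le_mi); rewrite comp_mpolyX.
have le_e j : (msize (tnth G j) <= e.+1)%N by rewrite ltnW // ltnS; apply: leq_bigmax.
have hX (p : {mpoly k[n]}) d j : (msize p <= d.+1 -> msize (p ^+ j) <= (j * d).+1)%N.
  move=> hp; elim: j => [|j IH]; first by rewrite expr0 msize1.
  by rewrite exprS mulSn; apply: msizeM_leS.
have : (msize (\prod_(j < n.+1) tnth G j ^+ mI (enum_val r) j) <=
    (\sum_(j < n.+1) D.-1 * e).+1)%N.
  elim/big_rec2: _ => [|j a b _ IH]; first by rewrite msize1.
  rewrite addnC -addnC; apply: msizeM_leS => //; apply: leq_trans (hX _ _ _ (le_e j)) _.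
  by rewrite ltnS leq_mul2r mnmE -ltnS ltn_ord orbT.
rewrite sum_nat_const card_ord /c /=; move/leq_trans; apply.
by rewrite /D /=; nia.
Qed.

End AlgebraicDependence.

Section SylvesterLinearity.
Variable R : comNzRingType.

Lemma sylv_pencil a b (A A' B B' : {poly R}) t :
  sylv a b (A + t *: A') (B + t *: B') = sylv a b A B + t *: sylv a b A' B'.
Proof.
rewrite /sylv scale_col_mx add_col_mx; congr col_mx; apply/matrixP => i j.
  by rewrite !mxE mulrDr -scalerAr coefD coefZ.
by rewrite !mxE mulrDr -scalerAr coefD coefZ.
Qed.

Lemma sylv_scale a b (A B : {poly R}) t :
  sylv a b (t *: A) (t *: B) = t *: sylv a b A B.
Proof. 
rewrite /sylv scale_col_mx; congr col_mx; apply/matrixP => i j.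
  by rewrite !mxE -scalerAr coefZ.
by rewrite !mxE -scalerAr coefZ.
Qed.

Lemma det_sylvZl a b (A B : {poly R}) t :
  \det (sylv a b (t *: A) B) = t ^+ b * \det (sylv a b A B).
Proof.
have -> : sylv a b (t *: A) B = block_mx 1%:M 0 0 t%:M *m sylv a b A B.
  rewrite /sylv mul_block_col mul1mx !mul0mx addr0 add0r mul_scalar_mx.
  congr col_mx; apply/matrixP => i j.
  by rewrite !mxE -scalerAr coefZ.
by rewrite det_mulmx det_ublock det1 mul1r det_scalar.
Qed.

End SylvesterLinearity.

Lemma polyfun_poly_det (k : closedFieldType) n m (M : 'rV[k]_n -> 'M[{poly k}]_m) :
  (forall i j, polyfun_poly (fun x => M x i j)) -> polyfun_poly (fun x => \det (M x)).
Proof.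
move=> hM; apply: polyfun_poly_sum => s; apply: polyfun_polyM; first exact: polyfun_polyC.
elim: (index_enum _) => [|i r IH] j.
  by apply: (@polyfun_eq _ _ (fun=> 1%:P`_j)) (polyfun_const _ _) => x; rewrite big_nil.
have [P hP] := polyfun_polyM (hM i (s i)) IH j.
by exists P => x; rewrite hP big_cons.
Qed.

(** * The pencil spanned by p and q *)

Section Pencil.
Variable k : closedFieldType.
Hypothesis char0 : [pchar k] =i pred0.

Lemma exists_generic_points n (R : k -> {poly k}) (l : seq k) (Q : {poly k}) :
  (forall y, R y != 0) -> Q != 0 -> pairwise (fun x y => (R y).[x] != 0) l ->
  exists s, [/\ size s = n, all (fun x => Q.[x] != 0) s
    & pairwise (fun x y => (R y).[x] != 0) (s ++ l)].
Proof.
move=> nzR nzQ hl; elim: n => [|n [s [sz hQ hs]]]; first by exists [::].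
have [|x] := exists_nonroot char0 (p := Q * \prod_(y <- s ++ l) R y).
  by rewrite mulf_neq0 // prodf_seq_neq0; apply/allP => y _; apply: nzR.
rewrite hornerM mulf_eq0 negb_or horner_prod prodf_seq_neq0 => /andP[Qx hx].
by exists (x :: s); split; rewrite /= ?sz ?Qx // hs andbT.
Qed.

Variables (a : nat) (p q : {poly k}).
Hypotheses (a_gt0 : (0 < a)%N) (top_p : has_top a p 1) (sq : (size q <= a)%N).
Hypothesis co_pq : coprimep p q.

Lemma pencil_right_neq0 : q != 0.
Proof.
apply: contraL co_pq => /eqP ->; rewrite coprimep0.
apply/negP => /eqp_size; rewrite (has_top_size top_p) ?oner_neq0 // size_poly1.
by case: (a) a_gt0.
Qed.

(** The roots are the points with the same image as [y] under (p : q). If q(y) <> 0 the coefficient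
    of X^a is - q(y); otherwise p(y) <> 0 by coprimality and [q] remains. *)
Lemma pencil_neq0 y : p.[y] *: q - q.[y] *: p != 0.
Proof.
have [qy|nzqy] := eqVneq q.[y] 0.
  rewrite qy scale0r subr0 scaler_eq0 negb_or pencil_right_neq0 andbT.
  apply/negP => /eqP py; have := coprimep_root co_pq (introT rootP py).
  by rewrite qy eqxx.
apply/negP => /eqP/(congr1 (fun P : {poly k} => P`_a)).
rewrite coefB !coefZ (proj2 top_p) [q`_a]nth_default // mulr0 sub0r mulr1 coef0.
by move/eqP; rewrite oppr_eq0 (negPf nzqy).
Qed.

End Pencil.

(* [Y(a,b)] is, in suitable coordinates, the set of the points
   (u p + v m0, u q + v m1, v g, v g x, ..., v g x^a).  The pencil spanned by [p]
   and [q] is that of the projection of [E] to the line Lambda, the roots [tau] of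
   [g] are the chosen rulings, [m0] and [m1] describe the centre [Psi].  The list
   [rw] contains the ramification points of (p : q). *)
Record normal_form (k : closedFieldType) (a b : nat) := NormalForm {
  nf_p : {poly k}; nf_q : {poly k}; nf_m0 : {poly k}; nf_m1 : {poly k};
  nf_tau : 'I_(b - a) -> k; nf_rw : seq k;
  nf_a_gt0 : (0 < a)%N; nf_lt_ab : (a < b)%N;
  nf_top_p : has_top a nf_p 1; nf_size_q : (size nf_q <= a)%N;
  nf_size_m0 : (size nf_m0 <= b.+1)%N; nf_size_m1 : (size nf_m1 <= b.+1)%N;
  nf_coprime : coprimep nf_p nf_q;
  nf_ramification : forall x,
    nf_p.[x] * nf_q^`().[x] - nf_p^`().[x] * nf_q.[x] = 0 -> x \in nf_rw;
  nf_e_tau : forall j,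
    nf_q.[nf_tau j] * nf_m0.[nf_tau j] - nf_p.[nf_tau j] * nf_m1.[nf_tau j] != 0;
  nf_q_tau : forall j, nf_q.[nf_tau j] != 0;
  nf_tau_tau : forall i j, i != j ->
    nf_q.[nf_tau i] * nf_p.[nf_tau j] - nf_p.[nf_tau i] * nf_q.[nf_tau j] != 0;
  nf_tau_rw : forall j x, x \in nf_rw ->
    nf_q.[nf_tau j] * nf_p.[x] - nf_p.[nf_tau j] * nf_q.[x] != 0
}.

Definition i0 {a : nat} : 'I_(2 + a.+1) := lshift a.+1 ord0.
Definition i1 {a : nat} : 'I_(2 + a.+1) := lshift a.+1 ord_max.

(** * The forms A and B and their resultant *)

Section NormalForm.
Variable k : closedFieldType.
Hypothesis char0 : [pchar k] =i pred0.
Variables (a b : nat) (D : normal_form k a b).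

Local Notation p := (nf_p D).
Local Notation q := (nf_q D).
Local Notation m0 := (nf_m0 D).
Local Notation m1 := (nf_m1 D).
Local Notation tau := (nf_tau D).
Local Notation rw := (nf_rw D).

Let a_gt0 : (0 < a)%N := nf_a_gt0 D.
Let lt_ab : (a < b)%N := nf_lt_ab D.
Let top_p := nf_top_p D.
Let sq := nf_size_q D.
Let co_pq := nf_coprime D.

Definition nf_g := \prod_j ('X - (tau j)%:P).
Definition wedge x y := q.[x] * p.[y] - p.[x] * q.[y].
Local Notation g := nf_g.

Implicit Type h : 'rV[k]_(2 + a.+1).

Definition vec (x0 x1 : k) (C : {poly k}) : 'rV[k]_(2 + a.+1) :=
  row_mx (\row_j (if j == 0 then x0 else x1)) (\row_j C`_j).
Definition partC h : {poly k} := row_poly (rsubmx h).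
Definition formA h : {poly k} := h 0 i0 *: p + h 0 i1 *: q.
(** The parameter [c] scales the contribution of the centre [Psi]. At c = 1 this is [formB], and at
    c = 0 it factors as [g * partC h]. *)
Definition formBc (c : k) h : {poly k} :=
  c *: (h 0 i0 *: m0 + h 0 i1 *: m1) + g * partC h.
Definition formB h : {poly k} := h 0 i0 *: m0 + h 0 i1 *: m1 + g * partC h.
Definition fres h := \det (sylv a b (formA h) (formB h)).
(** Where this is nonzero, [formA h] has degree exactly [a] and avoids the ramification points,
    hence has [a] simple roots. *)
Definition fK h := h 0 i0 * \prod_(x <- rw) (formA h).[x].

Lemma vec0 x0 x1 C : (vec x0 x1 C) 0 i0 = x0.
Proof. by rewrite /vec /i0 row_mxEl mxE. Qed.

Lemma vec1 x0 x1 C : (vec x0 x1 C) 0 i1 = x1.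
Proof. by rewrite /vec /i1 row_mxEl mxE. Qed.

Lemma vecC x0 x1 (C : {poly k}) : (size C <= a.+1)%N -> partC (vec x0 x1 C) = C.
Proof. by move=> sC; rewrite /partC row_mxKr row_polyK. Qed.

Lemma size_partC h : (size (partC h) <= a.+1)%N.
Proof. exact: size_row_poly. Qed.

Lemma partCD h h' : partC (h + h') = partC h + partC h'.
Proof. by rewrite /partC linearD row_polyD. Qed.

Lemma partCZ c h : partC (c *: h) = c *: partC h.
Proof. by rewrite /partC linearZ row_polyZ. Qed.

Lemma top_g : has_top (b - a) g 1.
Proof.
have hj (j : 'I_(b - a)) : has_top 1 ('X - (tau j)%:P) 1.
  by split; [rewrite size_XsubC | rewrite coefB coefX coefC subr0].
by have := has_top_prod hj; rewrite sum_nat_const card_ord muln1 [X in has_top _ _ X]big1.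
Qed.

Lemma g_tau j : g.[tau j] = 0.
Proof. by rewrite horner_prod (bigD1 j) //= hornerXsubC subrr mul0r. Qed.

Lemma g_root x : g.[x] = 0 -> exists j, x = tau j.
Proof.
move/eqP; rewrite horner_prod prodf_seq_eq0 => /hasP[j _ /=].
by rewrite hornerXsubC subr_eq0 => /eqP->; exists j.
Qed.

Lemma size_formA h : (size (formA h) <= a.+1)%N.
Proof.
apply: leq_trans (size_polyD _ _) _; rewrite geq_max.
rewrite (leq_trans (size_scale_leq _ _) (proj1 top_p)).
by rewrite (leq_trans (size_scale_leq _ _)) // leqW.
Qed.

Lemma formA_top h : (formA h)`_a = h 0 i0.
Proof.
by rewrite coefD !coefZ (proj2 top_p) [q`_a]nth_default // mulr0 mulr1 addr0.
Qed.

Lemma size_gC (C : {poly k}) : (size C <= a.+1)%N -> (size (g * C)%R <= b.+1)%N.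
Proof.
move=> sC; have := size_mulS (proj1 top_g) sC.
by rewrite addSn subnK // ltnW.
Qed.

Lemma gC_top (C : {poly k}) : (size C <= a.+1)%N -> (g * C)`_b = C`_a.
Proof.
move=> sC; have := has_topM top_g (conj sC (erefl C`_a)).
by rewrite subnK ?(ltnW lt_ab) // mul1r => -[].
Qed.

Lemma size_formBc c h : (size (formBc c h) <= b.+1)%N.
Proof.
apply: leq_trans (size_polyD _ _) _; rewrite geq_max size_gC ?size_partC // andbT.
apply: leq_trans (size_scale_leq _ _) _; apply: leq_trans (size_polyD _ _) _.
by rewrite geq_max !(leq_trans (size_scale_leq _ _)) ?nf_size_m0 ?nf_size_m1.
Qed.

Lemma formBc1 h : formBc 1 h = formB h.
Proof. by rewrite /formBc scale1r. Qed.

Lemma size_formB h : (size (formB h) <= b.+1)%N.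
Proof. by rewrite -formBc1 size_formBc. Qed.

Lemma formAD h h' t : formA (h + t *: h') = formA h + t *: formA h'.
Proof. by rewrite /formA !mxE !scalerDl !scalerDr !scalerA addrACA. Qed.

Lemma formBcD c h h' t : formBc c (h + t *: h') = formBc c h + t *: formBc c h'.
Proof.
rewrite /formBc partCD partCZ !mxE -!mul_polyC !polyCD !polyCM; ring.
Qed.

Lemma formAZ c h : formA (c *: h) = c *: formA h.
Proof. by rewrite /formA !mxE scalerDr !scalerA. Qed.

Lemma formBZ c h : formB (c *: h) = c *: formB h.
Proof. by rewrite /formB partCZ !mxE !scalerDr !scalerA scalerAr. Qed.

Lemma ab_gt0 : (0 < a + b)%N.
Proof. by rewrite addn_gt0 a_gt0. Qed.

Lemma fres_eq0 h : fres h = 0 <->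
  (exists x, root (formA h) x && root (formB h) x) \/
  (h 0 i0 = 0 /\ (formB h)`_b = 0).
Proof.
by rewrite -formA_top; apply: sylv_det_eq0 ab_gt0 (size_formA h) (size_formB h).
Qed.

Lemma fresZ c h : fres (c *: h) = c ^+ (a + b) * fres h.
Proof. by rewrite /fres formAZ formBZ sylv_scale detZ. Qed.

Lemma polyfun_formA : polyfun_poly formA.
Proof.
apply: polyfun_polyD; apply: polyfun_polyZ; try exact: polyfun_coord;
  exact: polyfun_polyC.
Qed.

Lemma polyfun_partC : polyfun_poly partC.
Proof.
apply: polyfun_poly_sum => i; apply: polyfun_polyZ; last exact: polyfun_polyC.
apply: (@polyfun_eq _ _ (fun h => h 0 (rshift 2 i))); last exact: polyfun_coord.
by move=> h; rewrite mxE.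
Qed.

Lemma polyfun_formB : polyfun_poly formB.
Proof.
apply: polyfun_polyD; last first.
  by apply: polyfun_polyM polyfun_partC; apply: polyfun_polyC.
apply: polyfun_polyD; apply: polyfun_polyZ; try exact: polyfun_coord;
  exact: polyfun_polyC.
Qed.

Lemma polyfun_fres : polyfun fres.
Proof.
apply: polyfun_det => i j.
exact: polyfun_sylv polyfun_formA polyfun_formB.
Qed.

Lemma polyfun_fK : polyfun fK.
Proof.
apply: polyfunM; first exact: polyfun_coord.
apply: polyfun_prod => x; apply: polyfun_horner size_formA polyfun_formA.
Qed.

(** A double root of h0 p + h1 q with h0 <> 0 is a zero of the Wronskian p q' - p' q, hence belongs
    to [rw]. *)
Lemma fK_simple h x : fK h != 0 -> root (formA h) x -> (formA h)^`().[x] != 0.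
Proof.
rewrite mulf_eq0 negb_or => /andP[nz0 nzp] /rootP Ax; apply/negP => /eqP A'x.
have xrw : x \in rw.
  apply: nf_ramification; apply: (mulfI nz0); rewrite mulr0.
  move: Ax A'x; rewrite /formA derivD !derivZ !hornerD !hornerZ => Ax A'x.
  have -> : h 0 i0 * (p.[x] * q^`().[x] - p^`().[x] * q.[x]) =
    (h 0 i0 * p.[x] + h 0 i1 * q.[x]) * q^`().[x] -
    (h 0 i0 * p^`().[x] + h 0 i1 * q^`().[x]) * q.[x] by ring.
  by rewrite Ax A'x; ring.
by move: nzp; rewrite (big_rem x) //= Ax mul0r eqxx.
Qed.

Lemma nf_q_neq0 : q != 0.
Proof. exact: pencil_right_neq0 a_gt0 top_p co_pq. Qed.

Lemma wedge_poly_neq0 y : p.[y] *: q - q.[y] *: p != 0.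
Proof. exact: pencil_neq0 a_gt0 top_p sq co_pq y. Qed.

Lemma exists_points n (l : seq k) (Q : {poly k}) : Q != 0 ->
  pairwise (fun x y => wedge x y != 0) l ->
  exists s, [/\ size s = n, all (fun x => Q.[x] != 0) s
    & pairwise (fun x y => wedge x y != 0) (s ++ l)].
Proof.
have wE x y : wedge x y = (p.[y] *: q - q.[y] *: p).[x].
  by rewrite hornerD hornerN !hornerZ /wedge mulrC [q.[y] * _]mulrC.
move=> nzQ hl; have [|s [sz hQ hs]] :=
    exists_generic_points char0 (l := l) n wedge_poly_neq0 nzQ.
  by apply: sub_pairwise hl => x y; rewrite wE.
by exists s; split=> //; apply: sub_pairwise hs => x y; rewrite wE.
Qed.

Lemma pairwise_tau : pairwise (fun x y => wedge x y != 0) [seq tau j | j <- enum 'I_(b - a)].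
Proof.
rewrite pairwise_map; apply: (sub_pairwise (r := fun i j => i != j)).
  exact: nf_tau_tau.
by rewrite -uniq_pairwise enum_uniq.
Qed.

End NormalForm.

Arguments vec {k a}.

(** * A line on which the resultant has distinct zeros *)

Section GoodLine.
Variable k : closedFieldType.
Hypothesis char0 : [pchar k] =i pred0.
Variables (a b : nat) (D : normal_form k a b).

Local Notation p := (nf_p D).
Local Notation q := (nf_q D).
Local Notation rw := (nf_rw D).
Local Notation g := (nf_g D).
Local Notation wedge := (wedge D).
Local Notation formA := (formA D).
Local Notation formB := (formB D).
Local Notation formBc := (formBc D).
Local Notation fres := (fres D).
Local Notation fK := (fK D).
Implicit Type h : 'rV[k]_(2 + a.+1).

Let lt_ab : (a < b)%N := nf_lt_ab D.

(** The resultant along the line h + t h'. Written as a determinant with entries linear in t, it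
    shows its formal degree a + b and its top coefficient, the resultant at h'. *)
Definition pencil_res c h h' : {poly k} :=
  \det (\matrix_(i, j) ((sylv a b (formA h) (formBc c h) i j)%:P +
     sylv a b (formA h') (formBc c h') i j *: 'X)).

Lemma horner_pencil_res c h h' t :
  (pencil_res c h h').[t] = \det (sylv a b (formA (h + t *: h')) (formBc c (h + t *: h'))).
Proof.
rewrite /pencil_res -[LHS]/(horner_eval t _) -det_map_mx formAD formBcD sylv_pencil.
congr (\det _); apply/matrixP => i j; rewrite !mxE /= /horner_eval.
by rewrite hornerD hornerC hornerZ hornerX mulrC.
Qed.

Lemma top_pencil_res c h h' :
  has_top (a + b) (pencil_res c h h') (\det (sylv a b (formA h') (formBc c h'))).
Proof. by apply: has_top_det => i j; rewrite mxE; apply: has_top_line. Qed.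

(** Reducing one Bezout cofactor modulo [p] bounds C0; the bound on C1 then follows from deg E1 <= 2
    a, because [p] has degree exactly [a]. *)
Lemma bezout_E1 (E1 : {poly k}) : (size E1 <= (2 * a).+1)%N ->
  exists C0 C1 : {poly k}, [/\ (size C0 <= a.+1)%N, (size C1 <= a.+1)%N
    & p * C1 - q * C0 = E1].
Proof.
move=> sE; have [[u v] /= uv] := Bezout_eq1_coprimepP _ _ (nf_coprime D).
have szp : size p = a.+1 by rewrite (has_top_size (nf_top_p D)) ?oner_neq0.
have nzp : p != 0 by rewrite -size_poly_gt0 szp.
pose V := (E1 * v) %% p.
have sV : (size V <= a)%N by rewrite -ltnS -szp ltn_modp.
have /dvdpP[C1 hC1] : p %| E1 - V * q.
  rewrite -[E1 in E1 - _]mulr1 -uv /V.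
  have -> : (E1 * v) %% p = E1 * v - (E1 * v) %/ p * p.
    by rewrite {2}[E1 * v](divp_eq _ p); ring.
  apply/dvdpP; exists (E1 * u + (E1 * v) %/ p * q); ring.
exists (- V), C1; split; first by rewrite size_polyN leqW.
  have [->|nzC1] := eqVneq C1 0; first by rewrite size_poly0.
  have : (size (C1 * p)%R <= (2 * a).+1)%N.
    rewrite -hC1; apply: leq_trans (size_polyD _ _) _; rewrite geq_max sE size_polyN.
    by apply: leq_trans (size_mulS sV (leqW (nf_size_q D))) _; lia.
  by rewrite size_mul // szp; move: (size C1) => n; lia.
by rewrite mulrN opprK mulrC -hC1; ring.
Qed.

(** This change of coordinates multiplies [formA] by [c] and turns [formB] into [formBc c], so a
    good line for [c] gives one for the actual resultant. *)
Definition rescale (c : k) h : 'rV[k]_(2 + a.+1) := vec (c * h 0 i0) (c * h 0 i1) (partC h).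

Lemma formA_rescale c h : formA (rescale c h) = c *: formA h.
Proof. by rewrite /formA /rescale vec0 vec1 scalerDr !scalerA. Qed.

Lemma formB_rescale c h : formB (rescale c h) = formBc c h.
Proof.
rewrite /formB /formBc /rescale vec0 vec1 vecC ?size_partC //.
by rewrite scalerDr !scalerA.
Qed.

Lemma fres_rescale c h :
  fres (rescale c h) = c ^+ b * \det (sylv a b (formA h) (formBc c h)).
Proof. by rewrite /fres formA_rescale formB_rescale det_sylvZl. Qed.

Lemma fK_rescale c h : fK (rescale c h) = c ^+ (size rw).+1 * fK h.
Proof.
rewrite /fK formA_rescale {1}/rescale vec0 exprS.
suff -> : \prod_(x <- rw) (c *: formA h).[x] =
    c ^+ size rw * \prod_(x <- rw) (formA h).[x] by ring.
elim: (rw) => [|x s IH]; first by rewrite !big_nil mulr1.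
by rewrite !big_cons hornerZ IH exprS; ring.
Qed.

Lemma rescaleD c h h' t : rescale c (h + t *: h') = rescale c h + t *: rescale c h'.
Proof.
apply/rowP => j; rewrite /rescale /vec !mxE; case: split_ordP => l _; rewrite !mxE.
  by case: (l == 0); ring.
by rewrite partCD partCZ coefD coefZ.
Qed.

(* For [c = 0] and the line through (1, 0; C0) and (0, 1; C1), the resultant
   vanishes at the [b - a] values of [- p / q] at the roots of [g] and at its
   values at the [2 a] roots of [p C1 - q C0]. *)
Lemma exists_degenerate_line : exists C0 C1 : {poly k},
  let w := vec 1 0 C0 in let v := vec 0 1 C1 in
  \det (sylv a b (formA v) (formBc 0 v)) != 0 /\
  forall t, (pencil_res 0 w v).[t] = 0 ->
    (pencil_res 0 w v)^`().[t] != 0 /\ fK (w + t *: v) != 0.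
Proof.
(* Off the roots of [Q] the value - p / q is finite and differs from its values at ramification
   points, which keeps [fK] nonzero at the zeros found below. *)
pose Q := q * \prod_(x <- rw) (p.[x] *: q - q.[x] *: p).
have nzQ : Q != 0.
  apply: mulf_neq0; first exact: nf_q_neq0.
  by rewrite prodf_seq_neq0; apply/allP => x _; apply: wedge_poly_neq0.
have [s [szs /allP hQ hs]] := exists_points char0 (2 * a) nzQ (pairwise_tau D).
set L := s ++ _ in hs.
have qL y : y \in L -> q.[y] != 0.
  rewrite mem_cat => /orP[/hQ|/mapP[j _ ->]]; last exact: nf_q_tau.
  by rewrite hornerM mulf_eq0 negb_or => /andP[].
have wL y x : y \in L -> x \in rw -> wedge y x != 0.
  rewrite mem_cat => /orP[/hQ|/mapP[j _ ->]]; last exact: nf_tau_rw.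
  rewrite hornerM mulf_eq0 negb_or horner_prod prodf_seq_neq0.
  move=> /andP[_ /allP h] /h /=; rewrite hornerD hornerN !hornerZ /wedge.
  by rewrite [p.[x] * _]mulrC [q.[x] * _]mulrC.
(* With p C1 - q C0 = E1, the polynomial C0 + t C1 vanishes at a root y of E1 for t = - p(y) / q(y),
   the parameter for which p + t q vanishes at y too. *)
pose E1 := \prod_(y <- s) ('X - y%:P).
have sE1 : size E1 = (2 * a).+1 by rewrite size_prod_XsubC szs.
have [|C0 [C1 [sC0 sC1 eqE]]] := @bezout_E1 E1; first by rewrite sE1.
exists C0, C1 => w v.
have Aw t : formA (w + t *: v) = p + t *: q.
  by rewrite formAD /formA !vec0 !vec1 !scale1r !scale0r add0r addr0.
have Bw t : formBc 0 (w + t *: v) = g * (C0 + t *: C1).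
  by rewrite /formBc scale0r add0r partCD partCZ !vecC.
have Bv : formBc 0 v = g * C1 by rewrite /formBc scale0r add0r vecC.
have Av : formA v = q by rewrite /formA vec0 vec1 scale0r scale1r add0r.
have lead_nz : \det (sylv a b (formA v) (formBc 0 v)) != 0.
  apply/negP => /eqP.
  case/(sylv_det_eq0 (ab_gt0 D) (size_formA D v) (size_formBc D 0 v)); rewrite Av Bv.
    move=> [x /andP[/rootP qx]]; rewrite rootM => /orP[/rootP/g_root[j xj]|/rootP C1x].
      by have := nf_q_tau D j; rewrite -xj qx eqxx.
    have : root E1 x.
      by apply/rootP; rewrite -eqE hornerD hornerN !hornerM qx C1x mulr0 mul0r subrr.
    rewrite root_prod_XsubC => xs; have := qL x; rewrite mem_cat xs qx eqxx.
    by move/(_ isT).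
  rewrite gC_top // => -[_ C1a].
  have := congr1 (fun P : {poly k} => P`_(a + a)) eqE.
  have [_] := has_topM (nf_top_p D) (conj sC1 C1a); rewrite coefB => ->.
  rewrite [(q * C0)`_(a + a)]nth_default; last exact: size_mulS (nf_size_q D) sC0.
  rewrite mulr0 subr0; have := monic_prod_XsubC s xpredT id; rewrite -/E1 monicE lead_coefE.
  by rewrite sE1 /= addnn -mul2n => /eqP -> /esym/eqP; rewrite oner_eq0.
split=> // t Ft.
have [sF topF] := top_pencil_res 0 w v; set F := pencil_res 0 w v in Ft sF topF *.
(* These (b - a) + 2 a = a + b values are distinct, the points having distinct images under (p : q).
   As many as the degree of the resultant, they are all its zeros, and simple. *)
pose rs := [seq - p.[y] / q.[y] | y <- L].
have urs : uniq rs.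
  rewrite uniq_pairwise pairwise_map; apply: (sub_in_pairwise _ (allss L) hs) => y z yL zL /=.
  apply: contra => /eqP h; rewrite /wedge subr_eq0; apply/eqP.
  have := congr1 (fun c => - c * q.[y] * q.[z]) h.
  rewrite !mulNr !opprK divfK ?qL // => ->.
  by rewrite mulrAC divfK ?qL // mulrC.
have szL : size rs = (a + b)%N.
  rewrite size_map size_cat szs size_map size_enum_ord; move: lt_ab; lia.
have szF : size F = (size rs).+1.
  by rewrite szL (has_top_size (conj sF topF)).
have rF : all (root F) rs.
  apply/allP => _ /mapP[y yL ->]; apply/rootP; rewrite horner_pencil_res.
  apply/(sylv_det_eq0 (ab_gt0 D) (size_formA D _) (size_formBc D 0 _)); left.
  exists y; rewrite Aw Bw /root hornerD hornerZ divfK ?qL // subrr eqxx /=.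
  move: yL; rewrite mem_cat => /orP[ys|/mapP[j _ ->]]; last first.
    by rewrite hornerM g_tau mul0r.
  rewrite hornerM mulf_eq0; apply/orP; right.
  rewrite -(inj_eq (mulfI (qL y _))) ?mem_cat ?ys // mulr0 hornerD hornerZ.
  have -> : q.[y] * (C0.[y] + - p.[y] / q.[y] * C1.[y]) = - E1.[y].
    rewrite -eqE hornerD hornerN !hornerM; field.
    by rewrite qL // mem_cat ys.
  by rewrite oppr_eq0 -/(root _ _) root_prod_XsubC.
have Fprod := all_roots_prod_XsubC szF rF; rewrite uniq_rootsE in Fprod.
have {}Fprod := Fprod urs.
have trs : t \in rs.
  move/rootP: Ft; rewrite Fprod rootZ ?root_prod_XsubC //.
  by rewrite lead_coef_eq0 -size_poly_gt0 szF.
split.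
  have nzl : lead_coef F != 0 by rewrite lead_coef_eq0 -size_poly_gt0 szF.
  have coF : coprimep F F^`().
    rewrite Fprod derivZ coprimepZl // coprimepZr //.
    by have := separable_prod_XsubC rs; rewrite urs unlock.
  by apply: (coprimep_root coF); apply/rootP.
move: trs => /mapP[y yL ->]; rewrite /fK Aw.
have -> : (w + (- p.[y] / q.[y]) *: v) 0 i0 = 1.
  by rewrite mxE [X in _ + X]mxE !vec0 mulr0 addr0.
rewrite mul1r prodf_seq_neq0; apply/allP => x xrw /=; rewrite hornerD hornerZ.
have := wL y x yL xrw; apply: contra => /eqP h.
have -> : wedge y x = q.[y] * (p.[x] + - p.[y] / q.[y] * q.[x]).
  by rewrite /wedge; field; rewrite qL.
by rewrite h mulr0.
Qed.

(** The two conditions are the nonvanishing of [S], the top coefficient, and of [E], a resultant in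
    the parameter of the line. Both are polynomial in [c] and nonzero at c = 0. Along the line [K]
    stays fixed as [c] varies, since it involves only [formA] and h0. *)
Lemma exists_good_line (f K : {mpoly k[2 + a.+1]}) :
  (forall h, f.@[h 0] = fres h) -> (forall h, K.@[h 0] = fK h) ->
  exists v w : 'rV_(2 + a.+1),
    f.@[v 0] != 0 /\ coprimep (line f w v) ((line f w v)^`() * line K w v).
Proof.
move=> fE KE; have [C0 [C1 /= [nz0 sep0]]] := exists_degenerate_line.
set w := vec 1 0 C0 in sep0; set v := vec 0 1 C1 in nz0 sep0.
pose F (c : 'rV[k]_1) := pencil_res (c 0 0) w v.
pose Kl := line K w v; pose m := (a + b + size Kl)%N.
pose S (c : 'rV[k]_1) := \det (sylv a b (formA v) (formBc (c 0 0) v)).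
pose E (c : 'rV[k]_1) := \det (sylv (a + b) m (F c) ((F c)^`() * Kl)).
have pBc h : polyfun_poly (fun c : 'rV[k]_1 => formBc (c 0 0) h).
  apply: polyfun_polyD; last exact: polyfun_polyC.
  by apply: polyfun_polyZ; [apply: polyfun_coord | apply: polyfun_polyC].
have pS : polyfun S.
  by apply: polyfun_det => i j; apply: polyfun_sylv => //; apply: polyfun_polyC.
have pF : polyfun_poly F.
  apply: polyfun_poly_det => i j.
  have pl h l : polyfun (fun c : 'rV[k]_1 => sylv a b (formA h) (formBc (c 0 0) h) i j *+ l).
    apply: polyfunMn.
    by apply: polyfun_sylv => //; apply: polyfun_polyC.
  move=> l; apply: polyfun_eq (polyfunD (pl w (l == 0)%N) (pl v (l == 1)%N)) => c.
  rewrite [X in polyseq X]mxE coefD coefC coefZ coefX.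
  by case: l => [|[|l]]; rewrite /= ?mulr1 ?mulr0 ?mulr0n ?mulr1n.
have pE : polyfun E.
  apply: polyfun_det => i j; apply: polyfun_sylv => //.
  by apply: polyfun_polyM; [apply: polyfun_deriv | apply: polyfun_polyC].
have sFK c : (size ((F c)^`() * Kl)%R <= m.+1)%N.
  have [sF _] := top_pencil_res (c 0 0) w v.
  have sF' : (size (F c)^`() <= a + b)%N.
    by apply: leq_trans (size_poly _ _) _; move: sF; case: (size _).
  exact: leq_trans (size_mulS sF' (leqnSn _)) (leqnSn _).
have ab := ab_gt0 D.
have gt0 : (0 < a + b + m)%N by rewrite addn_gt0 ab.
have sF c : (size (F c) <= (a + b).+1)%N by have [] := top_pencil_res (c 0 0) w v.
have tF c : (F c)`_(a + b) = S c by have [] := top_pencil_res (c 0 0) w v.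
have e00 : (0 : 'rV[k]_1) 0 0 = 0 by rewrite mxE.
have S0 : S 0 != 0 by rewrite /S e00.
have E0 : E 0 != 0.
  apply/negP => /eqP /(sylv_det_eq0 gt0 (sF 0) (sFK 0)) [[t]|[]]; last first.
    by rewrite tF => h; case/eqP: S0.
  rewrite /F e00 rootM => /andP[/rootP /sep0[d1 k1]] /orP[|].
    by rewrite /root (negPf d1).
  by rewrite /root horner_line KE (negPf k1).
have [PS hS] := pS; have [PE hE] := pE.
(* The factor ['X_ord0] ensures c <> 0, so that [rescale] can be applied. *)
have [|c] := exists_mpoly_neq0 char0 (F := PS * PE * 'X_ord0).
  rewrite !mulf_neq0 //.
  - by apply: contra S0 => /eqP h; rewrite -hS h meval0.
  - by apply: contra E0 => /eqP h; rewrite -hE h meval0.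
  apply/negP => /eqP /(congr1 (mcoeff U_(ord0))); rewrite mcoeffX eqxx mcoeff0.
  by move/eqP; rewrite oner_eq0.
rewrite !mevalM mevalXU hS hE !mulf_eq0 !negb_or => /andP[/andP[Sc Ec] nzc].
exists (rescale (c 0 0) v), (rescale (c 0 0) w); split.
  by rewrite fE fres_rescale mulf_neq0 // expf_neq0.
have lf : line f (rescale (c 0 0) w) (rescale (c 0 0) v) = (c 0 0) ^+ b *: F c.
  apply: (poly_funP char0) => t.
  by rewrite horner_line fE -rescaleD fres_rescale hornerZ horner_pencil_res.
have lK : line K (rescale (c 0 0) w) (rescale (c 0 0) v) = (c 0 0) ^+ (size rw).+1 *: Kl.
  apply: (poly_funP char0) => t.
  by rewrite horner_line KE -rescaleD fK_rescale hornerZ horner_line KE.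
rewrite lf lK derivZ -scalerAl -scalerAr scalerA coprimepZl ?expf_neq0 //.
rewrite coprimepZr ?mulf_neq0 ?expf_neq0 //.
apply: Pdiv.ClosedField.root_coprimep => t rt; apply/negP => rt'.
case/negP: Ec; apply/eqP/(sylv_det_eq0 gt0 (sF c) (sFK c)); left; exists t.
by rewrite rt.
Qed.

End GoodLine.

(** * The surface in normal form *)

Section BinaryForms.
Variable k : closedFieldType.
Implicit Types (P Q : {poly k}) (s t : k).

(* The value at (s, t) of [P] seen as a binary form of degree [n]. *)
Definition hform n P s t := \sum_(i < n.+1) P`_i * (s ^+ (n - i) * t ^+ i).

Lemma hform_scale n P c s t : hform n P (c * s) (c * t) = c ^+ n * hform n P s t.
Proof.
rewrite /hform mulr_sumr; apply: eq_bigr => i _; rewrite !exprMn.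
have -> : c ^+ n = c ^+ (n - i) * c ^+ i by rewrite -exprD subnK // -ltnS.
ring.
Qed.

Lemma hform1 n P t : (size P <= n.+1)%N -> hform n P 1 t = P.[t].
Proof.
move=> sP; rewrite (horner_coef_wide _ sP); apply: eq_bigr => i _.
by rewrite expr1n mul1r.
Qed.

Lemma hform_affine n P s t : s != 0 -> (size P <= n.+1)%N ->
  hform n P s t = s ^+ n * P.[t / s].
Proof.
move=> nzs sP; rewrite -(hform1 _ sP) -hform_scale mulr1.
by congr hform; rewrite mulrC divfK.
Qed.

Lemma hform0 n P t : hform n P 0 t = P`_n * t ^+ n.
Proof.
rewrite /hform big_ord_recr /= subnn expr0 mul1r big1 ?add0r // => i _.
by rewrite expr0n subn_eq0 leqNgt ltn_ord mul0r mulr0.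
Qed.

Lemma hformM m n P Q s t : (size P <= m.+1)%N -> (size Q <= n.+1)%N ->
  hform (m + n) (P * Q) s t = hform m P s t * hform n Q s t.
Proof.
move=> sP sQ; have [->|nzs] := eqVneq s 0.
  have [_] := has_topM (conj sP (erefl P`_m)) (conj sQ (erefl Q`_n)).
  by rewrite !hform0 => ->; rewrite exprD; ring.
have sPQ := size_mulS sP sQ; rewrite addSn in sPQ.
by rewrite !hform_affine // hornerM exprD; ring.
Qed.

Lemma hformD n P Q s t : hform n (P + Q) s t = hform n P s t + hform n Q s t.
Proof. by rewrite -big_split; apply: eq_bigr => i _; rewrite coefD mulrDl. Qed.

Lemma hformZ n c P s t : hform n (c *: P) s t = c * hform n P s t.
Proof. by rewrite /hform mulr_sumr; apply: eq_bigr => i _; rewrite coefZ mulrA. Qed.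

Lemma hformB n P Q s t : hform n (P - Q) s t = hform n P s t - hform n Q s t.
Proof. by rewrite hformD -scaleN1r hformZ mulN1r. Qed.

Lemma hformXn n j s t : (j <= n)%N -> hform n 'X^j s t = s ^+ (n - j) * t ^+ j.
Proof.
move=> le_jn; have lt_j : (j < n.+1)%N by [].
rewrite /hform (bigD1 (Ordinal lt_j)) //= coefXn eqxx mul1r big1 ?addr0 // => i ne.
by rewrite coefXn -[j]/(val (Ordinal lt_j)) (inj_eq val_inj) (negPf ne) mul0r.
Qed.

Lemma hform_eq0_root n P s t : (s, t) != (0, 0) -> (size P <= n.+1)%N ->
  hform n P s t = 0 -> (s != 0 /\ P.[t / s] = 0) \/ (s = 0 /\ P`_n = 0).
Proof.
have [->|nzs] := eqVneq s 0 => nz sP.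
  have nzt : t != 0 by apply: contra nz => /eqP->.
  rewrite hform0 => /eqP; rewrite mulf_eq0 expf_eq0 (negPf nzt) andbF orbF => /eqP.
  by right.
rewrite hform_affine // => /eqP; rewrite mulf_eq0 expf_eq0 (negPf nzs) andbF => /eqP.
by left.
Qed.

Lemma hform_veronese n P s t :
  hform n P s t = (veronese n s t *m \col_i P`_i) 0 0.
Proof. by rewrite mxE; apply: eq_bigr => i _; rewrite !mxE mulrC. Qed.

(** If z_0 <> 0 the parameter is z_1 / z_0. Otherwise the minors z_i z_(i+2) = z_(i+1)^2 kill
    successively all coordinates but the last. *)
Lemma rational_normal_curve n (z : nat -> k) :
  (forall i j, (i < n)%N -> (j < n)%N -> z i * z j.+1 = z i.+1 * z j) ->
  (exists2 i, (i <= n)%N & z i != 0) ->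
  exists c s t, [/\ c != 0, (s, t) = (1, t) \/ (s, t) = (0, 1)
    & forall i, (i <= n)%N -> z i = c * (s ^+ (n - i) * t ^+ i)].
Proof.
move=> minors [i0 le_i0 nzi0]; have [z0|nz0] := eqVneq (z 0%N) 0; last first.
  exists (z 0%N), 1, (z 1%N / z 0%N); split; [by []|by left|].
  elim=> [|i IH] lt_in; first by rewrite expr1n expr0 !mulr1.
  apply: (mulfI nz0); have := minors 0%N i; rewrite (leq_trans _ lt_in) // lt_in.
  move=> -> //; rewrite IH ?(ltnW lt_in) // !expr1n !mul1r exprS; field.
  by [].
have small i : (i < n)%N -> z i = 0.
  elim: i => // i IH lt_in; have := minors i i.+1 (ltnW lt_in) lt_in.
  by rewrite IH ?(ltnW lt_in) // mul0r => /esym/eqP; rewrite mulf_eq0 orbb => /eqP.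
have eq_i0 : i0 = n.
  by apply/eqP; rewrite eqn_leq le_i0 leqNgt; apply: contra nzi0 => /small ->.
exists (z n), 0, 1; split; [by rewrite -eq_i0|by right|] => i.
rewrite leq_eqVlt => /orP[/eqP->|lt_in]; first by rewrite subnn !expr0 expr1n !mulr1.
by rewrite small // expr0n subn_eq0 leqNgt lt_in mul0r mulr0.
Qed.

End BinaryForms.

Section Surface.
Variable k : closedFieldType.
Hypothesis char0 : [pchar k] =i pred0.
Variables (a b : nat) (D : normal_form k a b).

Local Notation p := (nf_p D).
Local Notation q := (nf_q D).
Local Notation m0 := (nf_m0 D).
Local Notation m1 := (nf_m1 D).
Local Notation g := (nf_g D).
Implicit Type h : 'rV[k]_(2 + a.+1).

Let a_gt0 : (0 < a)%N := nf_a_gt0 D.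
Let lt_ab : (a < b)%N := nf_lt_ab D.

Local Notation P := (hform a p).
Local Notation Q := (hform a q).
Local Notation M0 := (hform b m0).
Local Notation M1 := (hform b m1).
Local Notation Gf := (hform (b - a) g).
Let sp : (size p <= a.+1)%N := proj1 (nf_top_p D).
Let sq : (size q <= a.+1)%N := leqW (nf_size_q D).
Let sg : (size g <= (b - a).+1)%N := proj1 (top_g D).

(** The determinant, up to sign, of (p, q) and (m0, m1). At the roots of [g], where the other
    coordinates vanish, it is nonzero, so the chosen rulings are mapped isomorphically onto the line
    Lambda. *)
Definition nf_e : {poly k} := q * m0 - p * m1.
Local Notation e := nf_e.

Lemma size_e : (size e <= (a + b).+1)%N.
Proof.
rewrite (leq_trans (size_polyD _ _)) // geq_max size_polyN.
by rewrite -addSn !size_mulS // ?nf_size_m0 ?nf_size_m1.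
Qed.

Lemma hform_e s t : hform (a + b) e s t = Q s t * M0 s t - P s t * M1 s t.
Proof. by rewrite /nf_e hformB !hformM // ?nf_size_m0 ?nf_size_m1. Qed.

Lemma PQ_neq0 s t : (s, t) != (0, 0) -> P s t = 0 -> Q s t != 0.
Proof.
move=> nz /(hform_eq0_root nz sp)[[nzs Pt]|[s0]]; last first.
  by rewrite (proj2 (nf_top_p D)) => /eqP; rewrite oner_eq0.
rewrite hform_affine // mulf_neq0 ?expf_neq0 //.
exact: (coprimep_root (nf_coprime D)) (introT rootP Pt).
Qed.

Lemma Gf_e_neq0 s t : (s, t) != (0, 0) -> Gf s t = 0 -> hform (a + b) e s t != 0.
Proof.
move=> nz /(hform_eq0_root nz sg)[[nzs /g_root[j tj]]|[s0]]; last first.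
  by rewrite (proj2 (top_g D)) => /eqP; rewrite oner_eq0.
rewrite hform_affine ?size_e // mulf_neq0 ?expf_neq0 // tj.
by rewrite hornerD hornerN !hornerM; apply: nf_e_tau.
Qed.

Definition Zi (i : nat) : 'I_(2 + a.+1) := rshift 2 (inord i : 'I_a.+1).

Lemma vecZ x0 x1 (C : {poly k}) i : (i <= a)%N -> vec x0 x1 C 0 (Zi i) = C`_i.
Proof. by move=> le_i; rewrite /vec row_mxEr mxE inordK. Qed.

Lemma vec_ext (x y : 'rV[k]_(2 + a.+1)) : x 0 i0 = y 0 i0 -> x 0 i1 = y 0 i1 ->
  (forall i, (i <= a)%N -> x 0 (Zi i) = y 0 (Zi i)) -> x = y.
Proof.
move=> e0 e1 eZ; apply/rowP => j; rewrite -(splitK j); case: (split j) => l /=.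
  case: (unliftP 0 l) => [l' ->|->].
    by rewrite ord1 /= (_ : lshift _ _ = i1) //; apply: val_inj.
  by rewrite (_ : lshift _ _ = i0) //; apply: val_inj.
by have := eZ l; rewrite -ltnS ltn_ord /Zi inord_val; apply.
Qed.

Definition nf_matrix : 'M[k]_(a.+1 + b.+1, 2 + a.+1) :=
  block_mx (\matrix_(i, j) (if j == 0 then p else q)`_i) 0
           (\matrix_(i, j) (if j == 0 then m0 else m1)`_i) (\matrix_(i, j) (g * 'X^j)`_i).

Definition point s t u v : 'rV[k]_(2 + a.+1) :=
  row_mx (u *: veronese a s t) (v *: veronese b s t) *m nf_matrix.

Lemma point0 s t u v : point s t u v 0 i0 = u * P s t + v * M0 s t.
Proof.
rewrite /point mul_row_block /i0 row_mxEl mxE !hform_veronese -!scalemxAl.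
by congr (_ + _); rewrite mxE; congr (_ * _); rewrite !mxE;
  apply: eq_bigr => i _; rewrite !mxE.
Qed.

Lemma point1 s t u v : point s t u v 0 i1 = u * Q s t + v * M1 s t.
Proof.
rewrite /point mul_row_block /i1 row_mxEl mxE !hform_veronese -!scalemxAl.
by congr (_ + _); rewrite mxE; congr (_ * _); rewrite !mxE;
  apply: eq_bigr => i _; rewrite !mxE.
Qed.

Lemma pointZ s t u v i : (i <= a)%N ->
  point s t u v 0 (Zi i) = v * Gf s t * (s ^+ (a - i) * t ^+ i).
Proof.
move=> le_ia; rewrite /point mul_row_block /Zi row_mxEr mulmx0 add0r -scalemxAl mxE.
rewrite -mulrA; congr (_ * _); rewrite -hformXn // -hformM //; last first.
  by rewrite size_polyXn ltnS.
rewrite subnK ?(ltnW lt_ab) // hform_veronese !mxE; apply: eq_bigr => j _.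
by rewrite !mxE inordK.
Qed.

(** The projection has no base point on the scroll. Vanishing of the last coordinates gives v Gf =
    0; then either v = 0 and coprimality of [p], [q] applies, or [g] vanishes and [nf_e] does
    not. *)
Lemma point_neq0 s t u v : (s, t) != (0, 0) -> (u, v) != (0, 0) -> point s t u v != 0.
Proof.
move=> nz nzuv; apply/negP => /eqP pt0.
have e0 := point0 s t u v; have e1 := point1 s t u v; rewrite pt0 !mxE in e0 e1.
have vG : v * Gf s t = 0.
  have := pointZ s t u v (leqnn a); have := pointZ s t u v (leq0n a).
  rewrite pt0 !mxE subnn subn0 !expr0 mulr1 mul1r => /esym/eqP h1 /esym/eqP h2.
  apply/eqP; apply: contraT => nzvG; move: h1 h2 nz.
  rewrite ![v * _ * _ == 0]mulf_eq0 (negPf nzvG) /= !expf_eq0 a_gt0 /=.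
  by move=> /eqP-> /eqP->; rewrite eqxx.
have [v0|nzv] := eqVneq v 0.
  have nzu : u != 0 by apply: contra nzuv => /eqP ->; rewrite v0.
  move: e0 e1; rewrite v0 !mul0r !addr0 => /esym/eqP + /esym/eqP.
  rewrite !mulf_eq0 (negPf nzu) /= => /eqP /(PQ_neq0 nz) nzQ.
  by rewrite (negPf nzQ).
move/eqP: vG; rewrite mulf_eq0 (negPf nzv) /= => /eqP /(Gf_e_neq0 nz).
rewrite hform_e; apply/negP; rewrite negbK; apply/eqP/(mulfI nzv).
have -> : v * (Q s t * M0 s t - P s t * M1 s t) =
  Q s t * (u * P s t + v * M0 s t) - P s t * (u * Q s t + v * M1 s t) by ring.
by rewrite -e0 -e1; ring.
Qed.

Definition surfY : pset k (2 + a.+1) := projected (@scroll k a b) nf_matrix.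

Lemma point_surfY s t u v :
  (s, t) != (0, 0) -> (u, v) != (0, 0) -> surfY (point s t u v).
Proof.
move=> nz nzuv; have nzp := point_neq0 nz nzuv; split=> // d F hF vF.
by apply: vF; split=> //; eexists; [exists s, t, u, v | ].
Qed.

Lemma vanishes_surfY F d s t u v : F \is d.-homog -> vanishes_on F surfY ->
  (s, t) != (0, 0) -> F.@[(point s t u v) 0] = 0.
Proof.
move=> hF vF nz; have [[-> ->]|nzuv] := eqVneq (u, v) (0, 0); last first.
  exact/vF/point_surfY.
have -> : point s t 0 0 = 0 *: point s t 1 0.
  by rewrite scale0r /point !scale0r row_mx0 mul0mx.
rewrite (homog_scaling _ _ hF) vF ?mulr0 //; apply: point_surfY => //.
by rewrite xpair_eqE oner_eq0.
Qed.

Lemma surfY_vanishes F d : F \is d.-homog ->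
  (forall s t u v, F.@[(point s t u v) 0] = 0) -> vanishes_on F surfY.
Proof.
move=> hF vF x [_ cl]; apply: (cl d) => // y [_ [_ [s [t [u [v [_ _ ->]]]]] ->]].
exact: vF.
Qed.

Definition minor_eq i j : {mpoly k[2 + a.+1]} :=
  'X_(Zi i) * 'X_(Zi j.+1) - 'X_(Zi i.+1) * 'X_(Zi j).

Lemma minor_homog i j : minor_eq i j \is 2.-homog.
Proof.
apply: (homog_of_scaling char0) => c x.
by rewrite !mevalB !mevalM !mevalXU !mxE; ring.
Qed.

Lemma minor_surfY i j : (i < a)%N -> (j < a)%N -> vanishes_on (minor_eq i j) surfY.
Proof.
move=> lt_i lt_j; apply: surfY_vanishes (minor_homog i j) _ => s t u v.
rewrite !mevalB !mevalM !mevalXU !pointZ ?(ltnW lt_i) ?(ltnW lt_j) //.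
have -> : (a - i = (a - i.+1).+1)%N by rewrite subnSK.
have -> : (a - j = (a - j.+1).+1)%N by rewrite subnSK.
rewrite !exprS; ring.
Qed.

Definition mform n (R : {poly k}) i j : {mpoly k[2 + a.+1]} :=
  \sum_(l < n.+1) R`_l *: ('X_(Zi i) ^+ (n - l) * 'X_(Zi j) ^+ l).

Lemma meval_mform n R i j (x : 'rV_(2 + a.+1)) :
  (mform n R i j).@[x 0] = hform n R (x 0 (Zi i)) (x 0 (Zi j)).
Proof.
rewrite raddf_sum; apply: eq_bigr => l _ /=.
by rewrite mevalZ mevalM !rmorphXn /= !mevalXU.
Qed.

(* The remaining equation of [Y], where (s : t) is read off as
   ([Zi i] : [Zi i.+1]); [i = 0] is used where s <> 0, [i = a.-1] where t <> 0. *)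
Definition ruling_eq i : {mpoly k[2 + a.+1]} :=
  'X_(Zi 0) ^+ (a.-1 - i) * 'X_(Zi a) ^+ i *
    (mform b (g * q) i i.+1 * 'X_i0 - mform b (g * p) i i.+1 * 'X_i1) -
  mform (a + b) e i i.+1.

Lemma meval_ruling_eq i (x : 'rV_(2 + a.+1)) : (ruling_eq i).@[x 0] =
  x 0 (Zi 0) ^+ (a.-1 - i) * x 0 (Zi a) ^+ i *
    (hform b (g * q) (x 0 (Zi i)) (x 0 (Zi i.+1)) * x 0 i0 -
     hform b (g * p) (x 0 (Zi i)) (x 0 (Zi i.+1)) * x 0 i1) -
  hform (a + b) e (x 0 (Zi i)) (x 0 (Zi i.+1)).
Proof.
by rewrite mevalB !mevalM mevalB !mevalM !rmorphXn /= !mevalXU !meval_mform.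
Qed.

Lemma hform_gq s t : hform b (g * q) s t = Gf s t * Q s t.
Proof. by rewrite -hformM // subnK // ltnW. Qed.

Lemma hform_gp s t : hform b (g * p) s t = Gf s t * P s t.
Proof. by rewrite -hformM // subnK // ltnW. Qed.

(** On the surface c = v Gf, and the first two coordinates satisfy Gf (Q x0 - P x1) = c e, which
    eliminates u. Up to the factor [c], the equation is this relation times a power of c s^(a-1-i)
    t^i. *)
Lemma ruling_eq_param i c s t (x : 'rV_(2 + a.+1)) : (i < a)%N ->
  (forall j, (j <= a)%N -> x 0 (Zi j) = c * (s ^+ (a - j) * t ^+ j)) ->
  (ruling_eq i).@[x 0] * c = (c * (s ^+ (a.-1 - i) * t ^+ i)) ^+ (a + b) *
    (Gf s t * (Q s t * x 0 i0 - P s t * x 0 i1) - c * hform (a + b) e s t).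
Proof.
move=> lt_ia xZ; rewrite meval_ruling_eq !xZ ?(ltnW lt_ia) //.
have -> : (a - i = (a.-1 - i).+1)%N by lia.
have -> : (a - i.+1 = a.-1 - i)%N by lia.
set w := c * (s ^+ (a.-1 - i) * t ^+ i); rewrite subnn subn0 !expr0 mulr1 mul1r.
have e1 : c * (s ^+ (a.-1 - i).+1 * t ^+ i) = w * s.
  by rewrite exprS /w; ring.
have e2 : c * (s ^+ (a.-1 - i) * t ^+ i.+1) = w * t by rewrite exprS /w; ring.
rewrite e1 e2 !hform_scale hform_gq hform_gp.
have e3 : (c * s ^+ a) ^+ (a.-1 - i) * (c * t ^+ a) ^+ i * c = w ^+ a.
  rewrite /w !exprMn -!exprM ![(a * _)%N]mulnC.
  have -> : c ^+ a = c ^+ (a.-1 - i) * c ^+ i * c.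
    by rewrite -exprD -exprSr; congr (_ ^+ _); lia.
  ring.
rewrite mulrBl [RHS]mulrBr; congr (_ - _); last by ring.
rewrite exprD -e3; ring.
Qed.

Lemma ruling_eq_homog i : (i < a)%N -> ruling_eq i \is (a + b).-homog.
Proof.
move=> lt_ia; apply: (homog_of_scaling char0) => c x.
rewrite !meval_ruling_eq !mxE !hform_scale !exprMn exprD.
have -> : c ^+ a = c ^+ (a.-1 - i) * c ^+ i * c.
  by rewrite -exprD -exprSr; congr (_ ^+ _); lia.
ring.
Qed.

Lemma ruling_eq_surfY i : (i < a)%N -> vanishes_on (ruling_eq i) surfY.
Proof.
move=> lt_ia; apply: surfY_vanishes (ruling_eq_homog lt_ia) _ => s t u v.
have key : (ruling_eq i).@[(point s t u v) 0] * (v * Gf s t) = 0.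
  rewrite (ruling_eq_param lt_ia (pointZ s t u v)) point0 point1 hform_e.
  ring.
have [vG0|nz] := eqVneq (v * Gf s t) 0; last first.
  by move/eqP: key; rewrite mulf_eq0 (negPf nz) orbF => /eqP.
rewrite meval_ruling_eq !pointZ ?(ltnW lt_ia) // vG0 !mul0r.
have hf0 n R : (0 < n)%N -> hform n R 0 0 = 0.
  by move=> n_gt0; rewrite hform0 expr0n gtn_eqF // mulr0.
by rewrite !hf0 ?addn_gt0 ?a_gt0 ?(ltn_trans a_gt0) // !mul0r subrr mulr0 subr0.
Qed.

Lemma proportional_PQ s t x0 x1 : (s, t) != (0, 0) ->
  Q s t * x0 - P s t * x1 = 0 -> exists u, x0 = u * P s t /\ x1 = u * Q s t.
Proof.
move=> nz h; have [P0|nzP] := eqVneq (P s t) 0.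
  have nzQ := PQ_neq0 nz P0; exists (x1 / Q s t).
  move/eqP: h; rewrite P0 mul0r subr0 mulf_eq0 (negPf nzQ) /= => /eqP ->.
  by rewrite mulr0 divfK.
exists (x0 / P s t); rewrite divfK //; split=> //.
apply: (mulfI nzP); move/eqP: h; rewrite subr_eq0 => /eqP <-.
by rewrite [RHS]mulrA [P s t * _]mulrC divfK // mulrC.
Qed.

(** The image of the scroll is already closed. The minors recover (s : t) and [c] from the last
    coordinates, v is c / Gf, and the equation [ruling_eq] makes the rest of (x0, x1) proportional
    to (P, Q), which gives u. *)
Lemma surfY_point x : surfY x -> exists s t u v,
  [/\ (s, t) != (0, 0), (u, v) != (0, 0) & x = point s t u v].
Proof.
move=> Yx; have nzx := proj1 Yx.
suff [s [t [u [v [nz xE]]]]] : exists s t u v, (s, t) != (0, 0) /\ x = point s t u v.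
  exists s, t, u, v; split=> //; apply: contra nzx => /eqP[u0 v0].
  by rewrite xE u0 v0 /point !scale0r row_mx0 mul0mx.
have [zero|/existsP[l nzl]] := boolP [forall l : 'I_a.+1, x 0 (Zi l) == 0].
  have z0 i : (i <= a)%N -> x 0 (Zi i) = 0.
    move=> le_i; have lt_i : (i < a.+1)%N by [].
    exact/eqP/(forallP zero (Ordinal lt_i)).
  (* The point lies on Lambda, the image of the section v = 0; a preimage under (p : q) is a root of
     x0 q - x1 p, or infinity when x1 = 0. *)
  have [s [t [nz h]]] : exists s t, (s, t) != (0, 0) /\ Q s t * x 0 i0 - P s t * x 0 i1 = 0.
    have [x1|nz1] := eqVneq (x 0 i1) 0.
      exists 0, 1; rewrite xpair_eqE oner_eq0 andbF; split=> //.
      by rewrite x1 mulr0 subr0 hform0 nth_default ?mul0r // nf_size_q.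
    pose R := x 0 i0 *: q - x 0 i1 *: p.
    have topR : R`_a != 0.
      rewrite coefB !coefZ (proj2 (nf_top_p D)) [q`_a]nth_default ?nf_size_q //.
      by rewrite mulr0 sub0r mulr1 oppr_eq0.
    have /closed_rootP[y /rootP Ry] : size R != 1%N.
      apply: contra topR => /eqP sR; apply/eqP/nth_default.
      by rewrite sR.
    exists 1, y; rewrite xpair_eqE oner_eq0; split=> //.
    by rewrite !hform1 // -[RHS]Ry hornerD hornerN !hornerZ; ring.
  have [u [e0 e1]] := proportional_PQ nz h.
  exists s, t, u, 0; split=> //; apply: vec_ext.
  - by rewrite point0 mul0r addr0.
  - by rewrite point1 mul0r addr0.
  - by move=> i le_i; rewrite pointZ // !mul0r z0.
have [||c [s [t [nzc st xZ]]]] := @rational_normal_curve k a (fun i => x 0 (Zi i)).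
- move=> i j lt_i lt_j; have := minor_surfY lt_i lt_j Yx.
  by rewrite mevalB !mevalM !mevalXU => /eqP; rewrite subr_eq0 => /eqP.
- by exists l => //; rewrite -ltnS.
have nz : (s, t) != (0, 0).
  by case: st => [[->]|[-> ->]]; rewrite xpair_eqE oner_eq0 ?andbF.
have [i [lt_ia nzw]] : exists i, (i < a)%N /\ s ^+ (a.-1 - i) * t ^+ i != 0.
  case: st => [[->]|[-> ->]].
    by exists 0%N; rewrite expr1n expr0 mulr1 oner_eq0.
  by exists a.-1; rewrite prednK // subnn expr0 expr1n mulr1 oner_eq0.
have rel : Gf s t * (Q s t * x 0 i0 - P s t * x 0 i1) = c * hform (a + b) e s t.
  have := ruling_eq_param lt_ia xZ; rewrite (ruling_eq_surfY lt_ia Yx) mul0r.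
  move/esym/eqP; rewrite mulf_eq0 expf_eq0 mulf_eq0 (negPf nzc) (negPf nzw) andbF /=.
  by rewrite subr_eq0 => /eqP.
have nzG : Gf s t != 0.
  apply/negP => /eqP G0; have := Gf_e_neq0 nz G0.
  move/esym/eqP: rel; rewrite G0 mul0r mulf_eq0 (negPf nzc) /= => /eqP ->.
  by rewrite eqxx.
pose v := c / Gf s t.
have [|u [e0 e1]] := @proportional_PQ s t (x 0 i0 - v * M0 s t) (x 0 i1 - v * M1 s t) nz.
  apply: (mulfI nzG); rewrite mulr0.
  have -> : Gf s t * (Q s t * (x 0 i0 - v * M0 s t) - P s t * (x 0 i1 - v * M1 s t)) =
    Gf s t * (Q s t * x 0 i0 - P s t * x 0 i1) -
    v * Gf s t * (Q s t * M0 s t - P s t * M1 s t) by ring.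
  by rewrite rel hform_e divfK // subrr.
exists s, t, u, v; split=> //; apply: vec_ext.
- by rewrite point0 -e0 subrK.
- by rewrite point1 -e1 subrK.
- by move=> j le_j; rewrite pointZ // xZ // divfK.
Qed.

End Surface.

(** * The dual variety *)

Section DualSurface.
Variable k : closedFieldType.
Hypothesis char0 : [pchar k] =i pred0.
Variables (a b : nat) (D : normal_form k a b).

Local Notation p := (nf_p D).
Local Notation q := (nf_q D).
Local Notation m0 := (nf_m0 D).
Local Notation m1 := (nf_m1 D).
Local Notation g := (nf_g D).
Local Notation formA := (formA D).
Local Notation formB := (formB D).
Local Notation fres := (fres D).
Local Notation fK := (fK D).
Implicit Type h : 'rV[k]_(2 + a.+1).

Let a_gt0 : (0 < a)%N := nf_a_gt0 D.
Let lt_ab : (a < b)%N := nf_lt_ab D.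
Local Notation P := (hform a p).
Local Notation Gf := (hform (b - a) g).
Local Notation point := (point D).
Local Notation surfY := (surfY D).
Local Notation Zi := (@Zi a).
Let sp : (size p <= a.+1)%N := proj1 (nf_top_p D).
Let sq : (size q <= a.+1)%N := leqW (nf_size_q D).
Let sg : (size g <= (b - a).+1)%N := proj1 (top_g D).
Let nz1 t : (1, t) != (0, 0) :> k * k.
Proof. by rewrite xpair_eqE oner_eq0. Qed.

Lemma polyfun_point n (s t u v : 'rV[k]_n -> k) j :
  polyfun s -> polyfun t -> polyfun u -> polyfun v ->
  polyfun (fun y => point (s y) (t y) (u y) (v y) 0 j).
Proof.
move=> hs ht hu hv; apply: polyfun_mulmx; last by move=> *; apply: polyfun_const.
move=> i l; rewrite -(splitK l); case: (split l) => l' /=.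
  apply: (@polyfun_eq _ _ (fun y => u y * (s y ^+ (a - l') * t y ^+ l'))).
    by move=> y; rewrite row_mxEl !mxE.
  by apply: polyfunM => //; apply: polyfunM; apply: polyfunX.
apply: (@polyfun_eq _ _ (fun y => v y * (s y ^+ (b - l') * t y ^+ l'))).
  by move=> y; rewrite row_mxEr !mxE.
by apply: polyfunM => //; apply: polyfunM; apply: polyfunX.
Qed.

Lemma point_tuple n (s t u v : 'rV[k]_n -> k) :
  polyfun s -> polyfun t -> polyfun u -> polyfun v ->
  exists c : (2 + a.+1).-tuple {mpoly k[n]},
    forall y, apply_tuple c y = point (s y) (t y) (u y) (v y).
Proof.
move=> hs ht hu hv.
have [c hc] := fin_all_exists (fun j => polyfun_point j hs ht hu hv).
exists [tuple c j | j < 2 + a.+1] => y.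
by apply/rowP => j; rewrite mxE tnth_mktuple hc.
Qed.

Lemma point_affine s t u v : s != 0 ->
  point s t u v = point 1 (t / s) (u * s ^+ a) (v * s ^+ b).
Proof.
move=> nzs; have e n i : (i < n.+1)%N ->
    s ^+ (n - i) * t ^+ i = s ^+ n * (1 ^+ (n - i) * (t / s) ^+ i).
  move=> lt_i; have -> : s ^+ n = s ^+ (n - i) * s ^+ i by rewrite -exprD subnK.
  by rewrite expr1n mul1r expr_div_n; field; rewrite expf_neq0.
congr (_ *m _); congr row_mx; apply/rowP => i; rewrite !mxE -mulrA;
  by congr (_ * _); apply: e.
Qed.

(** The coordinates x0, Z0, Z1 are independent since t = Z1 / Z0, then v, then u can be solved for
    generically. Four polynomials are dependent since, pulled back to the affine parameters (t, u,
    v), they involve three variables. *)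
Lemma has_dim_surfY : has_dim surfY 2.
Proof.
split.
  pose o j : 'I_3 := inord j.
  exists [tuple 'X_i0; 'X_(Zi 0); 'X_(Zi 1)] => h vh.
  have pZ n (R : {poly k}) : polyfun (fun y : 'rV[k]_3 => hform n R (y 0 (o 1)) (y 0 (o 2))).
    apply: polyfun_sum => i; apply: polyfunM; first exact: polyfun_const.
    by apply: polyfunM; apply: polyfunX; apply: polyfun_coord.
  have [E hE] := polyfunM (polyfun_coord k (o 1)) (polyfunM (pZ (b - a)%N g) (pZ a p)).
  have nzE : E != 0.
    have [|x] := exists_nonroot char0 (p := g * p).
      have := has_topM (top_g D) (nf_top_p D); rewrite mulr1 => [[_ h1]].
      by apply: contraPneq h1 => ->; rewrite coef0 => /esym/eqP; rewrite oner_eq0.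
    rewrite hornerM => nzx; apply: contraTneq nzx => E0.
    have := hE (\row_(j < 3) x ^+ j.-1); rewrite E0 meval0 !mxE !inordK //= expr0.
    by rewrite expr1 mul1r !hform1 // => <-; rewrite eqxx.
  apply: (mpoly_row0_off char0 nzE) => y; rewrite hE !mulf_eq0 !negb_or.
  move=> /and3P[nz0]; rewrite !hform_affine // !mulf_eq0 !expf_eq0 (negPf nz0) !andbF /=.
  set x := _ / _ => nzg nzp.
  pose v := y 0 (o 1) / g.[x]; pose u := (y 0 (o 0) - v * m0.[x]) / p.[x].
  have nzuv : (u, v) != (0, 0).
    by rewrite xpair_eqE [v == 0]mulf_eq0 (negPf nz0) invr_eq0 (negPf nzg) andbF.
  have := vh _ (point_surfY D (nz1 x) nzuv); rewrite meval_comp => <-.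
  have oE j (lt_j : (j < 3)%N) : Ordinal lt_j = o j by apply: val_inj; rewrite /= inordK.
  apply: meval_eq => -[[|[|[|j]]] lt_j] //; rewrite mxE (tnth_nth 0) /= mevalXU oE.
  - by rewrite point0 !hform1 ?nf_size_m0 // divfK // subrK.
  - by rewrite pointZ // !hform1 // divfK // expr1n !mulr1.
  - rewrite pointZ // !hform1 // divfK // expr1n mul1r expr1 /x mulrC divfK //.
move=> [g' ind].
have pc n (i : 'I_n) := polyfun_coord k i.
have [c3 hc3] :=
    point_tuple (polyfun_const 3 (1 : k)) (pc 3 ord0) (pc 3 (inord 1)) (pc 3 (inord 2)).
have [c4 hc4] := point_tuple (pc 4 ord0) (pc 4 (inord 1)) (pc 4 (inord 2)) (pc 4 (inord 3)).
have [h nzh h0] := alg_dependent [tuple tnth g' l \mPo c3 | l < 4].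
have van x u v : (h \mPo g').@[(point 1 x u v) 0] = 0.
  have := congr1 (meval ((\row_(j < 3) [:: x; u; v]`_j) 0)) h0.
  rewrite meval0 !meval_comp => <-; apply: meval_eq => l; rewrite !mxE tnth_mktuple.
  by rewrite meval_comp hc3 !mxE /= !inordK.
suff : h = 0 by apply/eqP.
apply: ind => x /(surfY_point char0)[s [t [u [v [_ _ ->]]]]].
pose F := (h \mPo g') \mPo c4.
(* The relation is known for s = 1, hence for s <> 0 by rescaling; density extends it to the ruling
   at infinity. *)
have F0 : F = 0.
  have nzX : 'X_ord0 != 0 :> {mpoly k[4]}.
    apply/negP => /eqP /(congr1 (mcoeff U_(ord0))); rewrite mcoeffX eqxx mcoeff0.
    by move/eqP; rewrite oner_eq0.
  apply: (mpoly_row0_off char0 nzX) => y; rewrite mevalXU => nzy.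
  by rewrite /F meval_comp hc4 point_affine // van.
have := congr1 (meval ((\row_(j < 4) [:: s; t; u; v]`_j) 0)) F0.
by rewrite meval0 /F meval_comp hc4 !mxE /= !inordK.
Qed.

(* The derivative of [point 1 t u v] with respect to [t]. *)
Definition dpoint t u v : 'rV[k]_(2 + a.+1) :=
  vec (u * p^`().[t] + v * m0^`().[t]) (u * q^`().[t] + v * m1^`().[t])
      (\poly_(i < a.+1) (v * (g * 'X^i)^`().[t])).

Lemma dpointZ t u v i : (i <= a)%N ->
  dpoint t u v 0 (Zi i) = v * (g^`().[t] * t ^+ i + g.[t] * (t ^+ i.-1 *+ i)).
Proof.
move=> le_i; rewrite vecZ // coef_poly ltnS le_i derivM derivXn.
by rewrite hornerD !hornerM hornerMn !hornerXn.
Qed.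

Lemma tangentP X (x w : 'rV[k]_(2 + a.+1)) : tangent_at X x w <->
  forall d F, F \is d.-homog -> vanishes_on F X -> dir_deriv F x w = 0.
Proof. by []. Qed.

Lemma tangentD X (x w w' : 'rV[k]_(2 + a.+1)) c :
  tangent_at X x w -> tangent_at X x w' -> tangent_at X x (w + c *: w').
Proof.
move=> tw tw'; apply/tangentP => d F hF vF.
have e1 : dir_deriv F x w = 0 := tw d F hF vF.
have e2 : dir_deriv F x w' = 0 := tw' d F hF vF.
by rewrite dir_derivDr dir_derivZr e1 e2 mulr0 addr0.
Qed.

Lemma pointD s t u v u' v' c :
  point s t u v + c *: point s t u' v' = point s t (u + c * u') (v + c * v').
Proof.
by rewrite /point scalemxAl -mulmxDl scale_row_mx add_row_mx !scalerA !scalerDl.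
Qed.

Lemma tangent_ruling s t u v u' v' : (s, t) != (0, 0) ->
  tangent_at surfY (point s t u v) (point s t u' v').
Proof.
move=> nz; apply/tangentP => d F hF vF; rewrite dir_deriv_line.
set c := pcurve _ _; suff -> : c = 0 by rewrite deriv0 horner0.
apply: (poly_fun0 char0) => y; rewrite horner_pcurve_line pointD.
exact: vanishes_surfY hF vF nz.
Qed.

Lemma tangent_dpoint t u v : tangent_at surfY (point 1 t u v) (dpoint t u v).
Proof.
apply/tangentP => d F hF vF.
pose c (j : 'I_(2 + a.+1)) : {poly k} :=
  match split j with
  | inl l => if l == 0 then u *: p + v *: m0 else u *: q + v *: m1
  | inr l => v *: (g * 'X^l)
  end.
have c0 : c i0 = u *: p + v *: m0 by rewrite /c /i0 (unsplitK (inl _)).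
have c1 : c i1 = u *: q + v *: m1 by rewrite /c /i1 (unsplitK (inl _)).
have cZ i : (i <= a)%N -> c (Zi i) = v *: (g * 'X^i).
  by move=> le_i; rewrite /c (unsplitK (inr _)) inordK.
have eval y : (\row_j (c j).[y]) = point 1 y u v.
  apply: vec_ext.
  - by rewrite mxE c0 point0 !hform1 ?nf_size_m0 // hornerD !hornerZ.
  - by rewrite mxE c1 point1 !hform1 ?nf_size_m1 // hornerD !hornerZ.
  move=> i le_i; rewrite mxE cZ // pointZ // hform1 // hornerZ hornerM hornerXn.
  by rewrite expr1n mul1r mulrA.
rewrite (@dir_deriv_curve _ _ F c t).
- set E := pcurve F c; suff -> : E = 0 by rewrite deriv0 horner0.
  apply: (poly_fun0 char0) => y; rewrite horner_pcurve.
  rewrite -(vanishes_surfY u v hF vF (nz1 y)) -eval; apply: meval_eq => j.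
  by rewrite mxE.
- by move=> j; rewrite -eval mxE.
move=> j; have -> : (c j)^`().[t] = (\row_j (c j)^`().[t]) 0 j by rewrite mxE.
congr (fun_of_matrix _ 0 j); apply: vec_ext.
- by rewrite mxE c0 vec0 derivD !derivZ hornerD !hornerZ.
- by rewrite mxE c1 vec1 derivD !derivZ hornerD !hornerZ.
move=> i le_i; rewrite mxE cZ // dpointZ // derivZ derivM derivXn.
by rewrite hornerZ hornerD !hornerM hornerMn !hornerXn.
Qed.

Definition tangent_matrix t u v : 'M[k]_(3, 2 + a.+1) :=
  col_mx (point 1 t 1 0) (col_mx (point 1 t 0 1) (dpoint t u v)).

Lemma mul_tangent_matrix t u v (x : 'rV_3) : exists c1 c2 c3,
  x *m tangent_matrix t u v =
  c1 *: point 1 t 1 0 + c2 *: point 1 t 0 1 + c3 *: dpoint t u v /\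
  (c1 = 0 -> c2 = 0 -> c3 = 0 -> x = 0).
Proof.
pose y : 'rV_(1 + (1 + 1)) := x.
exists (lsubmx y 0 0), (lsubmx (rsubmx y) 0 0), (rsubmx (rsubmx y) 0 0); split.
  have sc (z : 'rV[k]_1) (w : 'rV[k]_(2 + a.+1)) : z *m w = z 0 0 *: w.
    by rewrite [z in LHS]mx11_scalar mul_scalar_mx.
  rewrite -!sc -addrA -mul_row_col hsubmxK -mul_row_col hsubmxK.
  by [].
move=> h1 h2 h3; suff -> : x = (0 : 'rV_(1 + (1 + 1))) by [].
rewrite -[LHS](hsubmxK y) -[rsubmx y]hsubmxK.
have z0 (z : 'rV[k]_1) : z 0 0 = 0 -> z = 0.
  by move=> h; rewrite [z]mx11_scalar h raddf0.
by rewrite (z0 _ h1) (z0 _ h2) (z0 _ h3) !row_mx0.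
Qed.

Lemma comb3 n (A B C : 'rV[k]_n) c1 c2 c3 j :
  (c1 *: A + c2 *: B + c3 *: C) 0 j = c1 * A 0 j + c2 * B 0 j + c3 * C 0 j.
Proof. by rewrite !mxE. Qed.

Lemma pairing_comb3 n (h A B C : 'rV[k]_n) c1 c2 c3 :
  (h *m (c1 *: A + c2 *: B + c3 *: C)^T) 0 0 =
  c1 * (h *m A^T) 0 0 + c2 * (h *m B^T) 0 0 + c3 * (h *m C^T) 0 0.
Proof.
rewrite !mxE !mulr_sumr -!big_split /=; apply: eq_bigr => i _.
by rewrite !mxE; ring.
Qed.

Lemma tangent_matrix_sub t u v c1 c2 c3 :
  ((c1 *: point 1 t 1 0 + c2 *: point 1 t 0 1 + c3 *: dpoint t u v)%R
     <= tangent_matrix t u v)%MS.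
Proof.
apply/submxP; exists (row_mx c1%:M (row_mx c2%:M c3%:M) : 'rV_(1 + (1 + 1))).
have e : row_mx c1%:M (row_mx c2%:M c3%:M) *m
    col_mx (point 1 t 1 0) (col_mx (point 1 t 0 1) (dpoint t u v)) =
    c1 *: point 1 t 1 0 + c2 *: point 1 t 0 1 + c3 *: dpoint t u v.
  by rewrite !mul_row_col !mul_scalar_mx addrA.
exact: esym e.
Qed.

Section SmoothPoint.
Variables (t u v : k).
Hypotheses (nzv : v != 0) (nzg : g.[t] != 0).
Local Notation x := (point 1 t u v).
Local Notation r1 := (point 1 t 1 0).
Local Notation r2 := (point 1 t 0 1).
Local Notation r3 := (dpoint t u v).

Let nzvg : v * g.[t] != 0. Proof. exact: mulf_neq0. Qed.

(** The linearized minors propagate the vanishing from the first two of the last coordinates to all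
    of them; along [w] the form [ruling_eq D 0] is then affine, and its slope forces the first two
    coordinates of [w] to be proportional to (P, Q). *)
Lemma ruling_curve_point (w : 'rV[k]_(2 + a.+1)) : w 0 (Zi 0) = 0 -> w 0 (Zi 1) = 0 ->
  tangent_at surfY x w -> exists c, w = c *: r1.
Proof.
move=> w0 w1 tw.
have xZ i : (i <= a)%N -> x 0 (Zi i) = v * g.[t] * t ^+ i.
  by move=> le_i; rewrite pointZ // hform1 // expr1n mul1r.
have wZ i : (i <= a)%N -> w 0 (Zi i) = 0.
  elim: i => // i IH lt_ia.
  have := tw _ _ (minor_homog char0 a 0 i) (minor_surfY char0 a_gt0 lt_ia).
  rewrite -/(dir_deriv _ _ _) dir_derivB !dir_derivM !dir_deriv_coord !mevalXU.
  rewrite w0 w1 IH ?(ltnW lt_ia) // !mul0r !mulr0 !add0r subr0 xZ //.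
  rewrite expr0 mulr1 => /eqP; rewrite mulf_eq0 (negPf nzvg) /=.
  by move/eqP.
have := tw _ _ (ruling_eq_homog char0 D a_gt0) (ruling_eq_surfY char0 a_gt0).
rewrite -/(dir_deriv _ _ _) dir_deriv_line.
pose c := x 0 (Zi 0) ^+ a.-1.
pose R := hform b (g * q) (x 0 (Zi 0)) (x 0 (Zi 1)) * w 0 i0 -
          hform b (g * p) (x 0 (Zi 0)) (x 0 (Zi 1)) * w 0 i1.
have -> : pcurve (ruling_eq D 0) (fun i => (x 0 i)%:P + w 0 i *: 'X) =
    ((ruling_eq D 0).@[x 0])%:P + (c * R) *: 'X.
  apply: (poly_funP char0) => y; rewrite horner_pcurve_line hornerD hornerC hornerZ hornerX.
  have lin j : (x + y *: w) 0 j = x 0 j + y * w 0 j by rewrite mxE [X in _ + X]mxE.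
  rewrite !meval_ruling_eq !lin !wZ // !mulr0 !addr0 subn0 expr0 mulr1 /R /c.
  ring.
rewrite derivD derivC add0r derivZ derivX hornerZ hornerC mulr1 => /eqP.
have nzc : c != 0 by rewrite expf_neq0 // xZ // expr0 mulr1.
rewrite mulf_eq0 (negPf nzc) /= => /eqP.
rewrite /R !xZ // expr0 expr1 hform_gq hform_gp.
rewrite !hform_scale => R0.
have [|d [e0 e1]] := @proportional_PQ _ _ _ D 1 t (w 0 i0) (w 0 i1) (nz1 t).
  have nzf : (v * g.[t]) ^+ (b - a) * (v * g.[t]) ^+ a * g.[t] != 0.
    by rewrite !mulf_neq0 ?expf_neq0.
  apply: (mulfI nzf); rewrite mulr0 -[RHS]R0 (hform1 _ sg).
  ring.
have sE j : (d *: r1) 0 j = d * r1 0 j by rewrite mxE.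
exists d; apply: vec_ext.
- by rewrite sE e0 point0 mul1r mul0r addr0.
- by rewrite sE e1 point1 mul1r mul0r addr0.
by move=> i le_i; rewrite wZ // sE pointZ // !mul0r mulr0.
Qed.

Lemma tangent_surfY (w : 'rV[k]_(2 + a.+1)) :
  tangent_at surfY x w <-> (w <= tangent_matrix t u v)%MS.
Proof.
split=> [tw|/submxP[y ->]]; last first.
  have [c1 [c2 [c3 [-> _]]]] := mul_tangent_matrix t u v y.
  apply: tangentD (tangent_dpoint t u v); apply: tangentD (tangent_ruling _ _ _ _ (nz1 t)).
  rewrite -[c1 *: _]add0r; apply: tangentD (tangent_ruling _ _ _ _ (nz1 t)).
  by apply/tangentP => d F hF vF; rewrite dir_deriv0r.
(* The scalars [c2], [c3] solve the two equations that make the coordinates [Zi 0] and [Zi 1] of w -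
   c2 r2 - c3 r3 vanish, so that [ruling_curve_point] applies. *)
pose c3 := (w 0 (Zi 1) - t * w 0 (Zi 0)) / (v * g.[t]).
pose c2 := (w 0 (Zi 0) - c3 * (v * g^`().[t])) / g.[t].
have lin j : (w + (- c2) *: r2 + (- c3) *: r3) 0 j =
    w 0 j + (- c2) * r2 0 j + (- c3) * r3 0 j.
  by rewrite mxE [X in _ + X]mxE [X in X + _]mxE [X in _ + X + _]mxE.
have [|||c1 wE] := @ruling_curve_point (w + (- c2) *: r2 + (- c3) *: r3).
- rewrite lin pointZ // dpointZ // hform1 // !expr1n !expr0 mulr0n !mulr1 mulr0 addr0 mul1r.
  by rewrite /c2; field.
- rewrite lin pointZ // dpointZ // hform1 // !expr1n !expr1 expr0 mulr1n !mulr1 !mul1r.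
  by rewrite /c2 /c3; field; rewrite nzg.
- apply: tangentD (tangent_dpoint t u v).
  by apply: tangentD (tangent_ruling _ _ _ _ (nz1 t)).
have -> : w = c1 *: r1 + c2 *: r2 + c3 *: r3.
  by rewrite -wE !scaleNr addrAC subrK subrK.
exact: tangent_matrix_sub.
Qed.

Lemma row_free_tangent_matrix : row_free (tangent_matrix t u v).
Proof.
rewrite -kermx_eq0; apply/rowV0P => y /sub_kermxP.
have [c1 [c2 [c3 [-> h]]]] := mul_tangent_matrix t u v y => c0.
have cZ i : (i <= a)%N ->
    c2 * (g.[t] * t ^+ i) + c3 * (v * (g^`().[t] * t ^+ i + g.[t] * (t ^+ i.-1 *+ i))) = 0.
  move=> le_i; have := congr1 (fun z : 'rV[k]_(2 + a.+1) => z 0 (Zi i)) c0.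
  rewrite comb3 !pointZ // dpointZ // hform1 // expr1n !mul1r !mul0r mulr0 add0r.
  by rewrite [RHS]mxE.
have c30 : c3 = 0.
  have h0 := cZ 0%N (leq0n a); have h1 := cZ 1%N a_gt0.
  rewrite expr0 mulr0n mulr0 addr0 !mulr1 in h0.
  rewrite expr0 expr1 mulr1n mulr1 in h1.
  apply: (mulIf (mulf_neq0 nzvg nzg)); rewrite mul0r.
  have -> : c3 * (v * g.[t] * g.[t]) =
    g.[t] * (c2 * (g.[t] * t) + c3 * (v * (g^`().[t] * t + g.[t])) -
       t * (c2 * g.[t] + c3 * (v * g^`().[t]))) by ring.
  by rewrite h0 h1 mulr0 subr0 mulr0.
have c20 : c2 = 0.
  have := cZ 0%N (leq0n a); rewrite c30 mul0r addr0 expr0 mulr1 => /eqP.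
  by rewrite mulf_eq0 (negPf nzg) orbF => /eqP.
apply: h => //; move: c0; rewrite c20 c30 !scale0r !addr0 => /eqP.
rewrite scaler_eq0 => /orP[/eqP //|].
by rewrite (negPf (point_neq0 D (nz1 t) _)) // xpair_eqE oner_eq0.
Qed.

Lemma smooth_point_surfY : smooth_point surfY x.
Proof.
split; first by apply: point_surfY => //; rewrite xpair_eqE (negPf nzv) andbF.
exists 2%N, (tangent_matrix t u v); split; first exact: has_dim_surfY.
  exact: row_free_tangent_matrix.
exact: tangent_surfY.
Qed.

End SmoothPoint.

Lemma pairing (h x : 'rV[k]_(2 + a.+1)) : (h *m x^T) 0 0 =
  h 0 i0 * x 0 i0 + h 0 i1 * x 0 i1 + \sum_(i < a.+1) h 0 (Zi i) * x 0 (Zi i).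
Proof.
rewrite mxE big_split_ord /=; congr (_ + _); last first.
  by apply: eq_bigr => i _; rewrite !mxE /Zi inord_val.
rewrite !big_ord_recl big_ord0 addr0 !mxE (_ : lshift _ (lift _ _) = i1) //.
exact: val_inj.
Qed.

Lemma coef_partC h i : (i <= a)%N -> (partC h)`_i = h 0 (Zi i).
Proof.
move=> le_i; have lt_i : (i < a.+1)%N by [].
by rewrite (coef_row_poly _ (Ordinal lt_i)) mxE; congr (h _ (rshift _ _));
   apply: val_inj; rewrite /= inordK.
Qed.

Lemma pairing_point h s t u v : (h *m (point s t u v)^T) 0 0 =
  u * hform a (formA h) s t + v * hform b (formB h) s t.
Proof.
rewrite pairing point0 point1 /formA /formB !hformD !hformZ.
have -> : hform b (g * partC h) s t = Gf s t * hform a (partC h) s t.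
  by rewrite -hformM ?size_partC // subnK // ltnW.
have -> : hform a (partC h) s t = \sum_(i < a.+1) h 0 (Zi i) * (s ^+ (a - i) * t ^+ i).
  by apply: eq_bigr => i _; rewrite coef_partC // -ltnS.
have -> : \sum_(i < a.+1) h 0 (Zi i) * point s t u v 0 (Zi i) =
    v * Gf s t * \sum_(i < a.+1) h 0 (Zi i) * (s ^+ (a - i) * t ^+ i).
  rewrite mulr_sumr; apply: eq_bigr => i _; rewrite pointZ 1?mulrCA //.
  by rewrite -ltnS.
ring.
Qed.

Lemma pairing_dpoint h t u v : (h *m (dpoint t u v)^T) 0 0 =
  u * (formA h)^`().[t] + v * (formB h)^`().[t].
Proof.
rewrite pairing /dpoint vec0 vec1 /formA /formB !derivD !derivZ !hornerD !hornerZ.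
have -> : (g * partC h)^`().[t] = \sum_(i < a.+1) h 0 (Zi i) * (g * 'X^i)^`().[t].
  rewrite {1}/partC mulr_sumr raddf_sum horner_sum; apply: eq_bigr => i _.
  by rewrite /= -scalerAr derivZ hornerZ mxE /Zi inord_val.
have -> : \sum_(i < a.+1) h 0 (Zi i) * vec (u * p^`().[t] + v * m0^`().[t])
    (u * q^`().[t] + v * m1^`().[t])
    (\poly_(i < a.+1) (v * (g * 'X^i)^`().[t])) 0 (Zi i) =
    v * \sum_(i < a.+1) h 0 (Zi i) * (g * 'X^i)^`().[t].
  rewrite mulr_sumr; apply: eq_bigr => i _; rewrite vecZ; last by rewrite -ltnS.
  by rewrite coef_poly ltn_ord mulrCA.
ring.
Qed.

(** Where [g] vanishes, the two equations are linear in (h0, h1) with determinant the nonzero value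
    of [nf_e]. So tangency occurs where [smooth_point_surfY] applies. *)
Lemma common_root_g h t : h 0 i0 != 0 -> root (formA h) t -> root (formB h) t -> g.[t] != 0.
Proof.
move=> nzh /rootP At /rootP Bt; apply/negP => /eqP gt0.
have [j tj] := g_root gt0; have := nf_e_tau D j; rewrite -tj; apply/negP; rewrite negbK.
move: At Bt; rewrite /formA /formB !hornerD !hornerZ hornerM gt0 mul0r addr0 => At Bt.
apply/eqP/(mulfI nzh); rewrite mulr0.
have -> : h 0 i0 * (q.[t] * m0.[t] - p.[t] * m1.[t]) =
  q.[t] * (h 0 i0 * m0.[t] + h 0 i1 * m1.[t]) -
  m1.[t] * (h 0 i0 * p.[t] + h 0 i1 * q.[t]) by ring.
by rewrite At Bt !mulr0 subr0.
Qed.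

Variables (f K : {mpoly k[2 + a.+1]}).
Hypotheses (fE : forall h, f.@[h 0] = fres h) (KE : forall h, K.@[h 0] = fK h).

Lemma f_homog : f \is (a + b).-homog.
Proof. by apply: (homog_of_scaling char0) => c h; rewrite !fE fresZ. Qed.

Lemma divisible_by_f (F : {mpoly k[2 + a.+1]}) :
  (forall h, f.@[h 0] = 0 -> K.@[h 0] != 0 -> F.@[h 0] = 0) -> exists R, F = R * f.
Proof.
have [v [w [nzv co]]] := exists_good_line char0 fE KE.
exact: generated_of_line f_homog nzv co.
Qed.

(** A tangent hyperplane contains the ruling through the point, so [formA] and [formB] both vanish
    there. Conversely a form vanishing on all tangent hyperplanes vanishes where f = 0 and K <> 0,
    hence is divisible by [f]. *)
Lemma dual_surfY h : dual_variety surfY h <-> h != 0 /\ f.@[h 0] = 0.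
Proof.
split=> -[nzh hh]; split=> //.
  apply: (hh (a + b)%N) => [|h' [_ [x [Yx _] tx]]]; first exact: f_homog.
  have [s [t [u [v [nz _ xE]]]]] := surfY_point char0 Yx.
  have pair u' v' : u' * hform a (formA h') s t + v' * hform b (formB h') s t = 0.
    rewrite -pairing_point tx ?mxE // xE.
    exact: tangent_ruling.
  have A0 : hform a (formA h') s t = 0.
    by have := pair 1 0; rewrite mul1r mul0r addr0.
  have B0 : hform b (formB h') s t = 0.
    by have := pair 0 1; rewrite mul1r mul0r add0r.
  rewrite fE; apply/fres_eq0.
  have [[nzs At]|[s0 Aa]] := hform_eq0_root nz (size_formA D h') A0.
    left; exists (t / s); apply/andP; split; first exact/rootP.
    have [[_ Bt]|[s0 _]] := hform_eq0_root nz (size_formB D h') B0; first exact/rootP.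
    by rewrite s0 eqxx in nzs.
  right; split; first by rewrite -(formA_top D).
  have [[nzs _]|[_ //]] := hform_eq0_root nz (size_formB D h') B0.
  by rewrite s0 eqxx in nzs.
move=> d F hF vF; have [|R ->] := @divisible_by_f F; last by rewrite mevalM hh mulr0.
move=> h' fh' Kh'; rewrite KE in Kh'.
have nzh0 : h' 0 i0 != 0 by move: Kh'; rewrite mulf_eq0 negb_or => /andP[].
have := fh'; rewrite fE => /fres_eq0[[t /andP[rA rB]]|[h0 _]]; last first.
  by rewrite h0 eqxx in nzh0.
have nzA' := fK_simple Kh' rA; have nzg := common_root_g nzh0 rA rB.
apply: vF; split; first by apply: contra nzh0 => /eqP ->; rewrite mxE.
(* Chosen so that the pairing of h' with [dpoint t u 1], namely u A'(t) + B'(t), vanishes. *)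
pose u := - (formB h')^`().[t] / (formA h')^`().[t].
have nz10 : (1 : k) != 0 := oner_neq0 k.
exists (point 1 t u 1); first exact: smooth_point_surfY.
move=> w /(tangent_surfY u nz10 nzg)/submxP[y ->].
have [c1 [c2 [c3 [-> _]]]] := mul_tangent_matrix t u 1 y.
apply/matrixP => i j; rewrite !ord1 [RHS]mxE.
rewrite pairing_comb3 !pairing_point pairing_dpoint.
rewrite !hform1 ?size_formA ?size_formB // (rootP rA) (rootP rB).
by rewrite /u; field.
Qed.

End DualSurface.

(** * The inverse of the polar map *)

Section DividedDifferences.
Variable k : closedFieldType.
Hypothesis char0 : [pchar k] =i pred0.

Lemma mderiv_homog n d (F : {mpoly k[n]}) i :
  F \is d.+1.-homog -> F^`M(i) \is d.-homog.
Proof.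
move=> /dhomogP hF; apply/dhomogP => m; rewrite mcoeff_msupp mcoeff_deriv => nz /=.
have mF : (m + U_(i))%MM \in msupp F.
  by rewrite mcoeff_msupp; apply: contra nz => /eqP ->; rewrite mul0rn.
by have := hF _ mF; rewrite /= mdegD mdeg1 addn1 => -[].
Qed.

Lemma mx_line n (x y : 'rV[k]_n) t j : (x + t *: y) 0 j = x 0 j + t * y 0 j.
Proof. by rewrite !mxE. Qed.

Lemma mx_comb2 n (x y : 'rV[k]_n) c m j :
  (c *: x + m *: y) 0 j = c * x 0 j + m * y 0 j.
Proof. by rewrite !mxE. Qed.

Lemma mx_scale n (x : 'rV[k]_n) c j : (c *: x) 0 j = c * x 0 j.
Proof. by rewrite mxE. Qed.

Lemma dir_deriv_along_line n (F : {mpoly k[n]}) (x v : 'rV_n) t :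
  dir_deriv F (x + t *: v) v = (line F x v)^`().[t].
Proof.
apply: dir_deriv_curve => i.
  by rewrite hornerD hornerC hornerZ hornerX !mxE mulrC.
by rewrite derivD derivC derivZ derivX add0r hornerZ hornerC mulr1.
Qed.

Lemma deriv_prod_lines (I : Type) (r : seq I) (x c : I -> k) :
  (forall i, x i != 0) ->
  (\prod_(i <- r) ((x i)%:P + c i *: 'X))^`().[0] =
  \prod_(i <- r) x i * \sum_(i <- r) c i / x i.
Proof.
move=> nz; elim: r => [|i r IH]; first by rewrite !big_nil derivC horner0 mulr0.
rewrite !big_cons derivM hornerD !hornerM IH derivD derivC add0r derivZ derivX.
have -> : (\prod_(j <- r) ((x j)%:P + c j *: 'X)).[0] = \prod_(j <- r) x j.
  rewrite horner_prod; apply: eq_bigr => j _.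
  by rewrite hornerD hornerC hornerZ hornerX mulr0 addr0.
rewrite hornerD !hornerZ !hornerC hornerX; move: (nz i); set xi := x i => nzi.
by field.
Qed.

(* The divided difference of [A], whose [n]-th coefficient is [drop_poly n.+1 A]. *)
Lemma divided_difference m (A : {poly k}) x y :
  (x - y) * \sum_(n < m) y ^+ n * (drop_poly n.+1 A).[x] =
  A.[x] - \sum_(n < m) A`_n * y ^+ n - y ^+ m * (drop_poly m A).[x].
Proof.
elim: m => [|m IH]; first by rewrite !big_ord0 drop_poly0l subr0 expr0; ring.
have drop : (drop_poly m A).[x] = A`_m + x * (drop_poly m.+1 A).[x].
  have -> : drop_poly m A = (A`_m)%:P + drop_poly m.+1 A * 'X.
    apply/polyP => -[|i]; rewrite coefD coefC coefMX !coef_drop_poly /= ?addr0 ?add0r //.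
    by rewrite addSnnS.
  by rewrite hornerD hornerC hornerMX mulrC.
rewrite !big_ord_recr /= mulrDr IH drop exprS; ring.
Qed.

(** The derivative at y = x of the identity (x - y) T(y) = A(x) - A(y). *)
Lemma divided_difference_diag m (A : {poly k}) x : (size A <= m)%N ->
  \sum_(n < m) x ^+ n * (drop_poly n.+1 A).[x] = A^`().[x].
Proof.
move=> sA; pose T := \sum_(n < m) (drop_poly n.+1 A).[x] *: 'X^n.
have TE y : T.[y] = \sum_(n < m) y ^+ n * (drop_poly n.+1 A).[x].
  by rewrite horner_sum; apply: eq_bigr => n _; rewrite hornerZ hornerXn mulrC.
have eqT : (x%:P - 'X) * T = A.[x]%:P - A.
  apply: (poly_funP char0) => y; rewrite hornerM !hornerD !hornerN !hornerC hornerX TE.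
  rewrite divided_difference drop_poly_eq0 // horner0 mulr0 subr0.
  by rewrite -(horner_coef_wide y sA).
have := congr1 (fun P : {poly k} => P^`().[x]) eqT.
rewrite /= derivM !derivB !derivC derivX !sub0r hornerD !hornerM !hornerN !hornerC.
rewrite hornerD hornerN hornerC hornerX subrr mul0r addr0 mulN1r => /oppr_inj <-.
exact: esym (TE x).
Qed.

(* If appending to [S] the condition that the [i]-th coordinate vanish leaves only
   the trivial solution, Cramer's rule gives the solution of [S] explicitly. *)
Lemma cramer_kernel n (S : 'M[k]_n.+1) i : col ord0 S = 0 ->
  (forall x : 'rV_n.+1, x *m S = 0 -> x 0 i = 0 -> x = 0) ->
  (\adj S) ord0 i != 0 /\ row ord0 (\adj S) *m S = 0.
Proof.
move=> col0 inj.
have detS : \det S = 0.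
  rewrite (expand_det_col _ ord0) big1 // => j _.
  by have /colP/(_ j) := col0; rewrite !mxE => ->; rewrite mul0r.
split; last by rewrite -row_mul mul_adj_mx detS raddf0 linear0.
(* The zero column is replaced by the [i]-th unit vector, which encodes the extra condition;
   expanding along it, the determinant is the entry of the adjugate. *)
pose S' := \matrix_(l, j) if j == ord0 then (l == i)%:R else S l j.
have cofE l : cofactor S' l ord0 = cofactor S l ord0.
  rewrite /cofactor; congr (_ * \det _); apply/matrixP => i' j'.
  by rewrite !mxE eq_sym (negPf (neq_lift _ _)).
have detS' : \det S' = (\adj S) ord0 i.
  rewrite (expand_det_col _ ord0) (bigD1 i) //= mxE !eqxx mul1r cofE mxE.
  rewrite big1 ?addr0 // => l ne; by rewrite mxE eqxx (negPf ne) mul0r.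
rewrite -detS'; apply/negP => /det0P[x nzx xS'].
case/negP: nzx; apply/eqP/inj.
  apply/rowP => j; have [->|ne] := eqVneq j ord0.
    rewrite !mxE big1 // => l _.
    by have /colP/(_ l) := col0; rewrite !mxE => ->; rewrite mulr0.
  have /rowP/(_ j) := xS'; rewrite !mxE => hj; rewrite -[RHS]hj.
  by apply: eq_bigr => l _; rewrite mxE (negPf ne).
have /rowP/(_ ord0) := xS'; rewrite !mxE => h0; rewrite -[RHS]h0.
rewrite (bigD1 i) //= mxE !eqxx mulr1 big1 ?addr0 // => l ne.
by rewrite mxE eqxx (negPf ne) mulr0.
Qed.

End DividedDifferences.

(** * Recovering a hyperplane from the gradient of the resultant *)

Section Homaloidal.
Variable k : closedFieldType.
Hypothesis char0 : [pchar k] =i pred0.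
Variables (a b : nat) (D : normal_form k a b).

Local Notation p := (nf_p D).
Local Notation q := (nf_q D).
Local Notation tau := (nf_tau D).
Local Notation rw := (nf_rw D).
Local Notation g := (nf_g D).
Local Notation formA := (formA D).
Local Notation formB := (formB D).
Local Notation formBc := (formBc D).
Local Notation fres := (fres D).
Local Notation fK := (fK D).
Implicit Type h : 'rV[k]_(2 + a.+1).

Let a_gt0 : (0 < a)%N := nf_a_gt0 D.
Let lt_ab : (a < b)%N := nf_lt_ab D.

Local Notation Zi := (@Zi a).
Notation N2 := (2 + a.+1)%N.
Notation cvec := (vec (0 : k) 0).
Notation d := (a + b)%N.

Variables (f K : {mpoly k[2 + a.+1]}).
Hypotheses (fE : forall h, f.@[h 0] = fres h) (KE : forall h, K.@[h 0] = fK h).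

Let fH := f_homog char0 fE.
Let sp : (size p <= a.+1)%N := proj1 (nf_top_p D).

Definition grad h : 'rV[k]_(2 + a.+1) := apply_tuple (polar_map f) h.
Definition dot (y v : 'rV[k]_(2 + a.+1)) := \sum_j y 0 j * v 0 j.

Lemma dot_grad h v : dir_deriv f h v = dot (grad h) v.
Proof. by apply: eq_bigr => j _; rewrite mxE tnth_mktuple. Qed.

Lemma dotD y v w c : dot y (v + c *: w) = dot y v + c * dot y w.
Proof.
rewrite /dot mulr_sumr -big_split /=; apply: eq_bigr => j _.
by rewrite !mxE; ring.
Qed.

Lemma dotZ y c w : dot y (c *: w) = c * dot y w.
Proof. by rewrite /dot mulr_sumr; apply: eq_bigr => j _; rewrite mxE; ring. Qed.

Lemma dot_split y v : dot y v =
  y 0 i0 * v 0 i0 + y 0 i1 * v 0 i1 + \sum_(i < a.+1) y 0 (Zi i) * v 0 (Zi i).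
Proof. by rewrite -pairing mxE; apply: eq_bigr => j _; rewrite mxE. Qed.

Lemma dot_cvec y (C : {poly k}) :
  dot y (cvec C) = \sum_(i < a.+1) y 0 (Zi i) * C`_i.
Proof.
rewrite dot_split vec0 vec1 !mulr0 !add0r; apply: eq_bigr => i _.
by rewrite vecZ // -ltnS.
Qed.

Lemma formA_cvec h C t : formA (h + t *: cvec C) = formA h.
Proof. by rewrite formAD /formA vec0 vec1 !scale0r addr0 scaler0 addr0. Qed.

Lemma formB_cvec h (C : {poly k}) t : (size C <= a.+1)%N ->
  formB (h + t *: cvec C) = formB h + t *: (g * C).
Proof.
move=> sC; rewrite -!formBc1 formBcD /formBc vec0 vec1 vecC // !scale0r addr0.
by rewrite scaler0 add0r.
Qed.

(* The translations along which the resultant is invariant. *)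
Definition shift h : 'rV[k]_(2 + a.+1) := cvec (formA h).

Lemma shiftD h h' t : shift (h + t *: h') = shift h + t *: shift h'.
Proof.
rewrite /shift formAD; apply: vec_ext; rewrite ?mx_line.
- by rewrite !vec0 mulr0 addr0.
- by rewrite !vec1 mulr0 addr0.
by move=> i le_i; rewrite mx_line !vecZ // coefD coefZ.
Qed.

Lemma shift_cvec C : shift (cvec C) = 0.
Proof.
rewrite /shift /formA vec0 vec1 !scale0r addr0; apply: vec_ext; rewrite ?vec0 ?vec1 ?mxE //.
by move=> i le_i; rewrite vecZ // coef0 mxE.
Qed.

Lemma exists_roots h : fK h != 0 -> exists th : 'I_a -> k,
  injective th /\ forall i, (formA h).[th i] = 0.
Proof.
move=> Kh; have nz0 : h 0 i0 != 0 by move: Kh; rewrite mulf_eq0 negb_or => /andP[].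
have szA : size (formA h) = a.+1.
  exact: has_top_size (conj (size_formA D h) (formA_top D h)) nz0.
have [rs eA] := closed_field_poly_normal (formA h).
have nzl : lead_coef (formA h) != 0 by rewrite lead_coef_eq0 -size_poly_gt0 szA.
have sz : size rs = a.
  by move: szA; rewrite eA size_scale // size_prod_XsubC => -[].
have urs : uniq rs.
  rewrite -separable_prod_XsubC unlock.
  have : coprimep (formA h) (formA h)^`().
    by apply: Pdiv.ClosedField.root_coprimep => x; apply: fK_simple.
  by rewrite eA derivZ coprimepZl // coprimepZr.
exists (fun i : 'I_a => rs`_i); split.
  by move=> i j /eqP; rewrite nth_uniq ?sz // => /eqP /val_inj.
move=> i; apply/rootP; rewrite eA rootZ // root_prod_XsubC.
by apply: mem_nth; rewrite sz.
Qed.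

Lemma fres_prod h (th : 'I_a -> k) : injective th ->
  (forall i, (formA h).[th i] = 0) ->
  fres h = h 0 i0 ^+ b * \prod_i (formB h).[th i].
Proof.
move=> inj rA; rewrite -(formA_top D).
exact: sylv_det_prod inj (size_formA D h) (size_formB D h) rA.
Qed.

(** The direction (0, 0; C) fixes [formA], hence its roots, and moves [formB] linearly, so the
    product formula splits the resultant into linear factors. *)
Lemma line_cvec h (th : 'I_a -> k) (C : {poly k}) : injective th ->
  (forall i, (formA h).[th i] = 0) -> (size C <= a.+1)%N ->
  line f h (cvec C) =
  h 0 i0 ^+ b *: \prod_i (((formB h).[th i])%:P + (g * C).[th i] *: 'X).
Proof.
move=> inj rA sC; apply: (poly_funP char0) => t; rewrite horner_line fE.
rewrite (fres_prod inj) ?formA_cvec // formB_cvec // hornerZ horner_prod.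
have -> : (h + t *: cvec C) 0 i0 = h 0 i0.
  by rewrite mx_line vec0 mulr0 addr0.
congr (_ * _); apply: eq_bigr => i _.
by rewrite !hornerD !hornerZ hornerC hornerX [RHS]addrC addrC [t * _]mulrC.
Qed.

Lemma dir_deriv_cvec h (th : 'I_a -> k) (C : {poly k}) : injective th ->
  (forall i, (formA h).[th i] = 0) -> fres h != 0 -> (size C <= a.+1)%N ->
  dir_deriv f h (cvec C) = fres h * \sum_i (g * C).[th i] / (formB h).[th i].
Proof.
move=> inj rA nzf sC; rewrite dir_deriv_line -/(line _ _ _) (line_cvec inj rA sC).
rewrite derivZ hornerZ deriv_prod_lines; first by rewrite mulrA -fres_prod.
move=> i; apply: contra nzf => /eqP Bi.
by rewrite (fres_prod inj rA) (bigD1 i) //= Bi mul0r mulr0.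
Qed.

Lemma exists_generic_slope (Q : {poly k}) : Q != 0 -> exists t,
  [/\ t != 0, Q.[t] != 0, fK (vec 1 t 0) != 0
    & forall j, (formA (vec 1 t 0)).[tau j] != 0].
Proof.
move=> nzQ; pose fac y : {poly k} := p.[y]%:P + q.[y] *: 'X.
have nz_fac y : fac y != 0.
  apply/negP => /eqP f0; have p0 : p.[y] = 0.
    have := congr1 (fun P : {poly k} => P`_0) f0.
    by rewrite coefD coefC coefZ coefX mulr0 addr0 coef0.
  have q0 : q.[y] = 0.
    have := congr1 (fun P : {poly k} => P`_1) f0.
    by rewrite coefD coefC coefZ coefX mulr1 add0r coef0.
  by have := coprimep_root (nf_coprime D) (introT rootP p0); rewrite q0 eqxx.
have facE y t : (fac y).[t] = (formA (vec 1 t 0)).[y].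
  by rewrite /formA vec0 vec1 !hornerD !hornerZ hornerC hornerX mul1r mulrC.
have [|t] := exists_nonroot char0
    (p := 'X * Q * \prod_(y <- rw) fac y * \prod_j fac (tau j)).
  rewrite !mulf_neq0 // ?polyX_eq0 //.
    by rewrite prodf_seq_neq0; apply/allP => y _; apply: nz_fac.
  by apply/prodf_neq0 => j _; apply: nz_fac.
rewrite !hornerM hornerX !mulf_eq0 !negb_or => /andP[/andP[/andP[nzt Qt] h1] h2].
exists t; split=> //.
  rewrite /fK vec0 mul1r; apply: contra h1; rewrite horner_prod => /eqP h0.
  by rewrite -[X in _ == X]h0; apply/eqP/eq_bigr => y _; rewrite facE.
move=> j; apply: contra h2 => /eqP h0.
by rewrite horner_prod (bigD1 j) //= facE h0 mul0r.
Qed.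

Lemma K_neq0 : K != 0.
Proof.
have [t [_ _ nz _]] := exists_generic_slope (oner_neq0 _).
by apply: contra nz => /eqP K0; rewrite -KE K0 meval0.
Qed.

(** The shift adds a multiple of g A to [formB], which is zero at the roots of A. The product
    formula gives the identity where K <> 0, and density everywhere. *)
Lemma fres_shift c m h : fres (c *: h + m *: shift h) = c ^+ d * fres h.
Proof.
have pf : polyfun (fun h => fres (c *: h + m *: shift h)).
  have [F hF] := polyfun_fres D.
  have [|G hG] := @polyfun_meval _ _ _ F (fun h => c *: h + m *: shift h).
    move=> j; apply: (@polyfun_eq _ _ (fun h => c * h 0 j + m * shift h 0 j)).
      by move=> x; rewrite mx_comb2.
    apply: polyfunD; apply: polyfunM; try exact: polyfun_const; first exact: polyfun_coord.
    rewrite -(splitK j); case: (split j) => l /=.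
      apply: polyfun_eq (polyfun_const _ 0) => x.
      by rewrite /shift /vec row_mxEl mxE if_same.
    apply: polyfun_eq (polyfun_formA D l) => x.
    by rewrite /shift /vec row_mxEr mxE.
  by exists G => x; rewrite hG hF.
have [P1 hP1] := pf.
suff : P1 = c ^+ d *: f.
  by move/(congr1 (meval (h 0))); rewrite hP1 mevalZ fE.
apply/eqP; rewrite -subr_eq0; apply/eqP/(mpoly_row0_off char0 K_neq0) => x.
rewrite KE mevalB hP1 mevalZ fE => /exists_roots[th [inj rA]].
have AE : formA (c *: x + m *: shift x) = c *: formA x.
  by rewrite formA_cvec formAZ.
rewrite !(fres_prod inj) //; last by move=> i; rewrite AE hornerZ rA mulr0.
rewrite mx_comb2 /shift vec0 mulr0 addr0 exprMn exprD.
have -> : \prod_i (formB (c *: x + m *: cvec (formA x))).[th i] =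
    c ^+ a * \prod_i (formB x).[th i].
  rewrite -[in c ^+ a](card_ord a) -prodr_const -big_split; apply: eq_bigr => i _ /=.
  rewrite formB_cvec ?size_formA // formBZ hornerD !hornerZ hornerM rA.
  by rewrite !mulr0 addr0.
by ring.
Qed.

Lemma dot_grad_cvec h (th : 'I_a -> k) (C : {poly k}) : injective th ->
  (forall i, (formA h).[th i] = 0) -> fres h != 0 -> (size C <= a.+1)%N ->
  dot (grad h) (cvec C) = fres h * \sum_i (g * C).[th i] / (formB h).[th i].
Proof. by move=> *; rewrite -dot_grad; apply: dir_deriv_cvec. Qed.

Definition ZP : {mpoly k[2 + a.+1]} := \sum_(i < a.+1) p`_i *: f^`M(Zi i).

Lemma ZP_E h : ZP.@[h 0] = dot (grad h) (cvec p).
Proof.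
rewrite dot_cvec raddf_sum; apply: eq_bigr => i _ /=.
by rewrite mevalZ mxE tnth_mktuple mulrC.
Qed.

(** Along a line in direction (0, 0; p) the resultant has degree exactly [a], its top coefficient
    being the product of the values of g p at the roots of A; in characteristic 0 its derivative is
    not zero. The slope t <> 0 keeps these roots apart from those of [p]. *)
Lemma ZP_neq0 : ZP != 0.
Proof.
have [t [nzt _ nzK nztau]] := exists_generic_slope (oner_neq0 _).
set h := vec 1 t 0 in nzK nztau; have [th [inj rA]] := exists_roots nzK.
have gth i : g.[th i] != 0.
  apply/negP => /eqP/g_root[j tj]; have := nztau j.
  by rewrite -tj rA eqxx.
have pth i : p.[th i] != 0.
  apply/negP => /eqP p0; have := rA i; rewrite /formA vec0 vec1 hornerD !hornerZ p0.
  rewrite mulr0 add0r => /eqP; rewrite mulf_eq0 (negPf nzt) /= => /eqP q0.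
  by have := coprimep_root (nf_coprime D) (introT rootP p0); rewrite q0 eqxx.
set L := line f h (cvec p).
have topL : has_top a L (\prod_i (g * p).[th i]).
  rewrite /L (line_cvec inj rA sp) vec0 expr1n scale1r.
  have := has_top_prod (fun i => has_top_line ((formB h).[th i]) ((g * p).[th i])).
  by rewrite sum_nat_const card_ord muln1.
have nzL' : L^`() != 0.
  apply/negP => /eqP/(congr1 (fun P : {poly k} => P`_a.-1)).
  rewrite coef_deriv prednK // (proj2 topL) coef0 => /eqP.
  rewrite -mulr_natr mulf_eq0 (natr_eq0_char0 char0) -[a == 0%N]negbK -lt0n a_gt0 orbF.
  apply/negP; apply/prodf_neq0 => i _; rewrite hornerM mulf_neq0 //.
have [m nzm] := exists_nonroot char0 nzL'.
apply: contra nzm => /eqP ZP0.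
by rewrite -dir_deriv_along_line dot_grad -ZP_E ZP0 meval0.
Qed.

Implicit Type y : 'rV[k]_(2 + a.+1).

(** At y = grad h this is proportional to [formA h]: [y] is orthogonal to (0, 0; A), so its pairings
    with (0, 0; p) and (0, 0; q) are in the ratio - h1 : h0. *)
Definition formY y : {poly k} := dot y (cvec q) *: p - dot y (cvec p) *: q.
(** If y_n = sum_i w_i theta_i^n over the roots of A, the divided differences make the value at
    theta_l proportional to w_l A'(theta_l), without reference to the individual roots. *)
Definition formW y : {poly k} := \sum_(n < a.+1) y 0 (Zi n) *: drop_poly n.+1 (formY y).
(* The conditions [y = grad h] imposes on a multiple of [h], as a linear system
   in (h, V) with coefficients polynomial in [y]; [V] is the quotient in a
   divisibility by [formY y], which is proportional to [formA h].  The vanishing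
   of the coordinate [Zi a] picks one point of the orbit under [shift],
   and the zero first equation makes the system square. *)
Definition system_poly y (x : 'rV[k]_(2 + a.+1)) (V : 'rV[k]_b) : {poly k} :=
  d%:R *: (formB x * formW y) - dot y x *: (g * (formY y)^`()) - row_poly V * formY y.
Definition system y (X : 'rV[k]_(2 + a.+1 + b)) : 'rV[k]_(1 + (1 + (1 + (a + b)))) :=
  let x := lsubmx X in
  row_mx 0 (row_mx (x 0 i0 * dot y (cvec p) + x 0 i1 * dot y (cvec q))%:M
    (row_mx (x 0 (Zi a))%:M (\row_l (system_poly y x (rsubmx X))`_l))).

Lemma horner_system_poly y x V t : (system_poly y x V).[t] =
  d%:R * ((formB x).[t] * (formW y).[t]) - dot y x * (g.[t] * (formY y)^`().[t]) -
  (row_poly V).[t] * (formY y).[t].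
Proof.
rewrite /system_poly; move: (formB x) (formW y) (formY y) (row_poly V) (g) (dot y x).
by move=> A1 A2 A3 A4 A5 c; rewrite !hornerD !hornerN !hornerM !hornerZ !hornerM.
Qed.

Lemma system_linear y X X' c : system y (X + c *: X') = system y X + c *: system y X'.
Proof.
rewrite /system !scale_row_mx !add_row_mx scaler0 addr0.
have lE : lsubmx (X + c *: X') = lsubmx X + c *: lsubmx X'.
  by rewrite linearD linearZ.
have rE : rsubmx (X + c *: X') = rsubmx X + c *: rsubmx X'.
  by rewrite linearD linearZ.
rewrite lE rE; congr (row_mx _ (row_mx _ (row_mx _ _))).
- by rewrite scale_scalar_mx -raddfD /= !mx_line; congr (_%:M); ring.
- by rewrite scale_scalar_mx -raddfD /= !mx_line.
apply/rowP => l; rewrite !mxE -coefZ -coefD; congr ((polyseq _)`_l).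
rewrite /system_poly dotD row_polyD row_polyZ.
have -> : formB (lsubmx X + c *: lsubmx X') = formB (lsubmx X) + c *: formB (lsubmx X').
  by rewrite -!formBc1 formBcD.
rewrite -!mul_polyC !polyCD !polyCM; ring.
Qed.

(** At the roots of A the system says that [formB x] is a constant multiple of [formB h]. Its first
    condition makes (x0, x1) proportional to (h0, h1), so x - rho h is some (0, 0; C1), and the two
    constants are shown to agree; then C1 vanishes at all roots of A. *)
Lemma kernel_system h X : fK h != 0 -> fres h != 0 ->
  (forall j, (formA h).[tau j] != 0) -> dot (grad h) (cvec p) != 0 ->
  system (grad h) X = 0 -> exists r m,
  lsubmx X = r *: h + m *: shift h /\ (r = 0 -> X = 0).
Proof.
move=> nzK nzf nztau nzp; set y := grad h; set x := lsubmx X; set V := rsubmx X.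
have nz0 : h 0 i0 != 0 by move: nzK; rewrite mulf_eq0 negb_or => /andP[].
have [th [inj rA]] := exists_roots nzK.
have gth i : g.[th i] != 0.
  apply/negP => /eqP/g_root[j tj]; have := nztau j.
  by rewrite -tj rA eqxx.
have Bth i : (formB h).[th i] != 0.
  apply: contra nzf => /eqP Bi.
  by rewrite (fres_prod inj rA) (bigD1 i) //= Bi mul0r mulr0.
rewrite /system -/x -/V => /eqP.
have zE : (0 : 'rV[k]_(1 + (1 + (1 + (a + b))))) = row_mx 0 (row_mx 0 (row_mx 0 0)).
  by rewrite !row_mx0.
move=> /eqP/(fun e => etrans e zE)/eq_row_mx[_ /eq_row_mx[e1 /eq_row_mx[e2 e3]]].
have {}e1 : x 0 i0 * dot y (cvec p) + x 0 i1 * dot y (cvec q) = 0.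
  by have /rowP/(_ 0) := e1; rewrite !mxE eqxx mulr1n.
have {}e2 : x 0 (Zi a) = 0.
  by have /rowP/(_ 0) := e2; rewrite !mxE eqxx mulr1n.
have szA : size (formA h) = a.+1.
  exact: has_top_size (conj (size_formA D h) (formA_top D h)) nz0.
(* These are the weights by which the last coordinates of the gradient are power sums of the roots,
   from the logarithmic derivative of the product formula. *)
pose w i := fres h * g.[th i] / (formB h).[th i].
have nzw i : w i != 0 by rewrite !mulf_neq0 ?invr_eq0.
have dC (C : {poly k}) : (size C <= a.+1)%N -> dot y (cvec C) = \sum_i w i * C.[th i].
  move=> sC; rewrite (dot_grad_cvec inj rA nzf sC) mulr_sumr; apply: eq_bigr => i _.
  by rewrite hornerM /w; ring.
have sq : (size q <= a.+1)%N := leqW (nf_size_q D).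
set zp := dot y (cvec p) in nzp e1; set zq := dot y (cvec q) in e1.
have zA : h 0 i0 * zp + h 0 i1 * zq = 0.
  rewrite /zp /zq !dC // !mulr_sumr -big_split big1 //= => i _.
  have -> : h 0 i0 * (w i * p.[th i]) + h 0 i1 * (w i * q.[th i]) =
    w i * (formA h).[th i] by rewrite /formA hornerD !hornerZ; ring.
  by rewrite rA mulr0.
pose kap := zq / h 0 i0.
have zqE : zq = kap * h 0 i0 by rewrite divfK.
clearbody kap.
have zpE : zp = - (kap * h 0 i1).
  apply: (mulfI nz0); move/eqP: zA; rewrite addr_eq0 => /eqP ->; rewrite zqE; ring.
have nzk : kap != 0 by apply: contra nzp => /eqP k0; rewrite zpE k0 mul0r oppr0.
have YE : formY y = kap *: formA h.
  by rewrite /formY -/zp -/zq zqE zpE scaleNr opprK -!scalerA -scalerDr.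
have yZ n : (n <= a)%N -> y 0 (Zi n) = \sum_i w i * th i ^+ n.
  move=> le_na; have lt_na : (n < a.+1)%N by [].
  have -> : y 0 (Zi n) = dot y (cvec 'X^n).
    rewrite dot_cvec (bigD1 (Ordinal lt_na)) //= coefXn eqxx mulr1 big1 ?addr0 // => i ne.
    by rewrite coefXn -[n]/(val (Ordinal lt_na)) (inj_eq val_inj) (negPf ne) mulr0.
  by rewrite dC ?size_polyXn //; apply: eq_bigr => i _; rewrite hornerXn.
have dropE n : drop_poly n (formY y) = kap *: drop_poly n (formA h).
  by apply/polyP => i; rewrite YE coefZ !coef_drop_poly coefZ.
have WE l : (formW y).[th l] = kap * (w l * (formA h)^`().[th l]).
  rewrite /formW horner_sum.
  have -> : \sum_(n < a.+1) (y 0 (Zi n) *: drop_poly n.+1 (formY y)).[th l] =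
      \sum_i kap * (w i * \sum_(n < a.+1) th i ^+ n * (drop_poly n.+1 (formA h)).[th l]).
    rewrite -mulr_sumr; under [in RHS]eq_bigr do rewrite mulr_sumr.
    rewrite exchange_big mulr_sumr; apply: eq_bigr => n _ /=.
    rewrite dropE !hornerZ yZ; last by rewrite -ltnS.
    by rewrite mulrCA mulr_suml; congr (_ * _); apply: eq_bigr => i _; rewrite mulrA.
  (* A divided difference of A at two distinct roots vanishes, and on the diagonal it is A'; only
     the term i = l survives. *)
  rewrite (bigD1 l) //= divided_difference_diag ?size_formA // big1 ?addr0 // => i ne.
  have := divided_difference a.+1 (formA h) (th l) (th i).
  rewrite drop_poly_eq0 ?size_formA // horner0 mulr0 subr0.
  rewrite -(horner_coef_wide (th i) (size_formA D h)) !rA subrr => /eqP.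
  rewrite mulf_eq0 subr_eq0 (inj_eq inj) eq_sym (negPf ne) /= => /eqP ->.
  by rewrite !mulr0.
have sW : (size (formW y) <= a)%N.
  apply: leq_trans (size_sum _ _ _) _; apply/bigmax_leqP => n _.
  apply: leq_trans (size_scale_leq _ _) _; rewrite size_drop_poly YE.
  rewrite leq_subLR (leq_trans (size_scale_leq _ _)) // (leq_trans (size_formA D h)) //.
  by rewrite addSn ltnS leq_addl.
have sY : (size (formY y) <= a.+1)%N.
  by rewrite YE (leq_trans (size_scale_leq _ _)) // size_formA.
have S0 : system_poly y x V = 0.
  apply/polyP => l; rewrite coef0; have [lt_l|le_l] := ltnP l d.
    by have /rowP/(_ (Ordinal lt_l)) := e3; rewrite !mxE.
  apply/nth_default/leq_trans/le_l; rewrite /system_poly.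
  apply: leq_trans (size_polyD _ _) _; rewrite size_polyN geq_max; apply/andP; split.
    apply: leq_trans (size_polyD _ _) _; rewrite size_polyN geq_max; apply/andP; split.
      apply: leq_trans (size_scale_leq _ _) _; rewrite mulrC.
      exact: size_mulS sW (size_formB D x).
    apply: leq_trans (size_scale_leq _ _) _.
    have sY' : (size (formY y)^`() <= a)%N.
      by apply: leq_trans (size_poly _ _) _; move: sY; case: (size _).
    rewrite mulrC; apply: size_mulS sY' _; rewrite (leq_trans (proj1 (top_g D))) //.
    by rewrite ltnS leq_subr.
  by rewrite addnC; apply: size_mulS (size_row_poly _) sY.
have nzd : (d%:R : k) != 0.
  by rewrite natr_eq0_char0 // addn_eq0 negb_and -!lt0n a_gt0.
have nzA' l : (formA h)^`().[th l] != 0.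
  exact: (fK_simple nzK) (introT rootP (rA l)).
(* For x = r h + m shift h this is [r], by Euler's identity and since [y] is orthogonal to the
   shift. *)
pose sg := dot y x / (d%:R * fres h).
have BE l : (formB x).[th l] = sg * (formB h).[th l].
  have := congr1 (fun P : {poly k} => P.[th l]) S0.
  rewrite horner_system_poly horner0 WE YE derivZ !hornerZ rA !mulr0 subr0 /w => hl.
  have nzc : kap * (formA h)^`().[th l] * g.[th l] != 0 by rewrite !mulf_neq0.
  apply: (mulIf nzc); apply/eqP; rewrite -subr_eq0 /sg.
  have -> : (formB x).[th l] * (kap * (formA h)^`().[th l] * g.[th l]) -
    dot y x / (d%:R * fres h) * (formB h).[th l] *
      (kap * (formA h)^`().[th l] * g.[th l]) =
    (d%:R * ((formB x).[th l] * (kap * (fres h * g.[th l] / (formB h).[th l] *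
       (formA h)^`().[th l]))) - dot y x * (g.[th l] * (kap * (formA h)^`().[th l]))) *
      ((formB h).[th l] / (d%:R * fres h)).
    by field; rewrite -natrD nzd nzf Bth.
  by rewrite hl mul0r.
pose rho := x 0 i0 / h 0 i0.
have x0E : x 0 i0 = rho * h 0 i0 by rewrite divfK.
have x1E : x 0 i1 = rho * h 0 i1.
  apply: (mulfI nzk); apply: (mulfI nz0); apply/eqP; rewrite -subr_eq0; apply/eqP.
  rewrite -[RHS]e1 x0E zqE zpE; ring.
pose C1 := partC (x + (- rho) *: h); have sC1 : (size C1 <= a.+1)%N := size_partC _.
have xE : x = rho *: h + 1 *: cvec C1.
  apply: vec_ext; rewrite ?mx_comb2.
  - by rewrite vec0 mulr0 addr0.
  - by rewrite vec1 mulr0 addr0.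
  move=> i le_i; rewrite mx_comb2 vecZ // coef_partC // mx_line; ring.
have gC1 l : (g * C1).[th l] = (sg - rho) * (formB h).[th l].
  have := BE l; rewrite {1}xE formB_cvec // formBZ hornerD !hornerZ mul1r => hl.
  by rewrite mulrBl -hl addrC addKr.
have dotC1 : dot y (cvec C1) = fres h * (sg - rho) * a%:R.
  rewrite (dot_grad_cvec inj rA nzf sC1) -mulrA; congr (_ * _).
  under eq_bigr do rewrite gC1 mulfK //.
  by rewrite sumr_const card_ord mulr_natr.
have doth : dot y h = d%:R * fres h by rewrite -dot_grad (euler char0 _ fH) fE.
(* Two expressions of [dot y x], sg d f and rho d f + a (sg - rho) f, leave b (sg - rho) f = 0
   because d = a + b. *)
have sgr : sg = rho.
  have nzb : (b%:R : k) != 0 by rewrite natr_eq0_char0 // -lt0n (ltn_trans a_gt0).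
  have e : dot y x = sg * (d%:R * fres h) by rewrite /sg divfK // mulf_neq0.
  rewrite xE dotD dotZ mul1r doth dotC1 in e.
  apply/eqP; rewrite -subr_eq0; apply/eqP.
  apply: (mulIf (mulf_neq0 nzb nzf)); rewrite mul0r.
  have -> : (sg - rho) * (b%:R * fres h) = sg * (d%:R * fres h) -
     (rho * (d%:R * fres h) + fres h * (sg - rho) * a%:R) by rewrite natrD; ring.
  by rewrite -e subrr.
have C10 l : C1.[th l] = 0.
  have := gC1 l; rewrite sgr subrr mul0r hornerM => /eqP.
  by rewrite mulf_eq0 (negPf (gth l)) /= => /eqP.
pose mu := C1`_a / h 0 i0.
have C1E : C1 = mu *: formA h.
  apply/eqP; rewrite -subr_eq0; apply: contraT => nzE.
  have all0 : all (root (C1 - mu *: formA h)) [seq th i | i <- enum 'I_a].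
    apply/allP => _ /mapP[i _ ->]; apply/rootP.
    by rewrite hornerD hornerN hornerZ C10 rA mulr0 subr0.
  have u : uniq [seq th i | i <- enum 'I_a] by rewrite map_inj_uniq ?enum_uniq.
  have := max_poly_roots nzE all0 u; rewrite size_map size_enum_ord ltnNge => /negP[].
  have s1 : (size (C1 - mu *: formA h)%R <= a.+1)%N.
    rewrite (leq_trans (size_polyD _ _)) // geq_max sC1 size_polyN.
    by rewrite (leq_trans (size_scale_leq _ _)) // size_formA.
  rewrite -ltnS ltn_neqAle s1 andbT; apply: contra nzE => /eqP sE.
  rewrite -lead_coef_eq0 lead_coefE sE coefB coefZ formA_top.
  by rewrite /mu divfK // subrr.
have xS : x = rho *: h + mu *: shift h.
  rewrite {1}xE C1E; congr (_ + _); rewrite scale1r /shift.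
  apply: vec_ext.
  - by rewrite mx_scale !vec0 mulr0.
  - by rewrite mx_scale !vec1 mulr0.
  by move=> i le_i; rewrite mx_scale !vecZ // coefZ.
exists rho, mu; split=> // rho0.
(* The coordinate [Zi a] of [shift h] is the top coefficient h0 <> 0 of A, so the normalization of
   [x] kills mu. *)
have mu0 : mu = 0.
  move: e2; rewrite xS mx_comb2 rho0 mul0r add0r vecZ // formA_top => /eqP.
  by rewrite mulf_eq0 (negPf nz0) orbF => /eqP.
have x0 : x = 0 by rewrite xS rho0 mu0 !scale0r addr0.
have V0 : V = 0.
  apply: row_poly_eq0; move: S0; rewrite /system_poly x0.
  have -> : formB 0 = 0 by rewrite -[0 in LHS](scale0r (0 : 'rV[k]_(2 + a.+1))) formBZ scale0r.
  have -> : dot y 0 = 0 by rewrite -[0 in LHS](scale0r (0 : 'rV[k]_(2 + a.+1))) dotZ mul0r.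
  rewrite mul0r scaler0 scale0r !sub0r oppr0 add0r => /eqP; rewrite oppr_eq0 mulf_eq0.
  rewrite YE scaler_eq0 (negPf nzk) -[formA h == 0]size_poly_eq0 szA orbF.
  by move/eqP.
by rewrite -[X]hsubmxK -/x -/V x0 V0 row_mx0.
Qed.

(** The dimensions 2 + a.+1 + b of the source and 1 + (1 + (1 + (a + b))) of the target are
    convertible, so the system is a square matrix and has an adjugate. *)
Definition sysmx y : 'M[k]_((a + b).+2.+1) :=
  \matrix_(i, j) (system y (delta_mx 0 (i : 'I_(2 + a.+1 + b))) : 'rV_((a + b).+2.+1)) 0 j.

Lemma mul_sysmx y (X : 'rV[k]_(2 + a.+1 + b)) : X *m sysmx y = system y X.
Proof.
have sys0 : system y 0 = 0.
  by have := system_linear y 0 0 (-1); rewrite scaler0 addr0 scaleN1r subrr.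
have sysS (r : seq 'I_(2 + a.+1 + b)) (c : 'I_(2 + a.+1 + b) -> k) E :
    system y (\sum_(i <- r) c i *: E i) = \sum_(i <- r) c i *: system y (E i).
  elim: r => [|i r IH]; first by rewrite !big_nil sys0.
  by rewrite !big_cons addrC system_linear IH addrC.
have eX : X = \sum_i X 0 i *: delta_mx 0 i by apply: row_sum_delta.
rewrite [in RHS]eX sysS; apply/rowP => j; rewrite mxE summxE.
by apply: eq_bigr => i _; rewrite !mxE.
Qed.

Definition hstar y : 'rV[k]_(2 + a.+1) :=
  lsubmx (row ord0 (\adj (sysmx y)) : 'rV_(2 + a.+1 + b)).

Lemma hstar_grad h : fK h != 0 -> fres h != 0 ->
  (forall j, (formA h).[tau j] != 0) -> dot (grad h) (cvec p) != 0 ->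
  exists2 r, r != 0 & exists m, hstar (grad h) = r *: h + m *: shift h.
Proof.
move=> nzK nzf nztau nzp; set y := grad h.
have nz0 : h 0 i0 != 0 by move: nzK; rewrite mulf_eq0 negb_or => /andP[].
pose ix : 'I_((a + b).+2.+1) := (lshift b i0 : 'I_(2 + a.+1 + b)).
have ker (X : 'rV[k]_(2 + a.+1 + b)) : system y X = 0 -> exists r m,
    lsubmx X = r *: h + m *: shift h /\ (r = 0 -> X = 0).
  exact: kernel_system.
have lsub0 (X : 'rV[k]_(2 + a.+1 + b)) r m : lsubmx X = r *: h + m *: shift h ->
    X 0 (lshift b i0) = r * h 0 i0.
  move=> /rowP/(_ i0); rewrite mxE => ->.
  by rewrite mx_comb2 /shift vec0 mulr0 addr0.
have [||nzc kc] := @cramer_kernel k _ (sysmx y) ix.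
- apply/colP => i; rewrite mxE [in LHS]mxE [RHS]mxE /system.
  rewrite (_ : ord0 = lshift (1 + (1 + (a + b))) (ord0 : 'I_1)); last exact: val_inj.
  by apply: etrans (row_mxEl _ _ _ (ord0 : 'I_1)) _; rewrite mxE.
- move=> X; rewrite mul_sysmx => /ker[r [m [eX h0]]] Xix; apply: h0.
  have := lsub0 _ _ _ eX; rewrite (Xix : X 0 (lshift b i0) = 0) => /esym/eqP.
  by rewrite mulf_eq0 (negPf nz0) orbF => /eqP.
rewrite mul_sysmx in kc; have [r [m [eX _]]] := ker _ kc.
exists r; last by exists m.
apply: contra nzc => /eqP r0; have := lsub0 _ _ _ eX; rewrite r0 mul0r.
by rewrite mxE => ->.
Qed.

Lemma polyfun_dot n (y v : 'rV[k]_n -> 'rV[k]_(2 + a.+1)) :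
  (forall j, polyfun (fun x => y x 0 j)) -> (forall j, polyfun (fun x => v x 0 j)) ->
  polyfun (fun x => dot (y x) (v x)).
Proof. by move=> hy hv; apply: polyfun_sum => j; apply: polyfunM. Qed.

Lemma polyfun_dotl v : polyfun (fun y => dot y v).
Proof.
by apply: polyfun_dot => j; [apply: polyfun_coord | apply: polyfun_const].
Qed.

Lemma polyfun_formY : polyfun_poly formY.
Proof.
apply: polyfun_polyD; last apply: polyfun_polyN;
  by apply: polyfun_polyZ; [apply: polyfun_dotl | apply: polyfun_polyC].
Qed.

Lemma polyfun_formW : polyfun_poly formW.
Proof.
apply: polyfun_poly_sum => n; apply: polyfun_polyZ; first exact: polyfun_coord.
move=> i; apply: polyfun_eq (polyfun_formY (i + n.+1)) => y.
by rewrite coef_drop_poly.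
Qed.

Lemma polyfun_system_poly x V : polyfun_poly (fun y => system_poly y x V).
Proof.
apply: polyfun_polyD; last first.
  apply: polyfun_polyN; apply: polyfun_polyM polyfun_formY.
  exact: polyfun_polyC.
apply: polyfun_polyD; last first.
  apply: polyfun_polyN; apply: polyfun_polyZ; first exact: polyfun_dotl.
  by apply: polyfun_polyM (polyfun_deriv polyfun_formY); apply: polyfun_polyC.
apply: polyfun_polyZ; first exact: polyfun_const.
by apply: polyfun_polyM polyfun_formW; apply: polyfun_polyC.
Qed.

Lemma polyfun_sysmx i j : polyfun (fun y => sysmx y i j).
Proof.
pose X : 'rV[k]_(2 + a.+1 + b) := delta_mx 0 i.
suff hX : polyfun (fun y => system y X 0 j).
  by apply: polyfun_eq hX => y; rewrite [RHS]mxE.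
have pdc C : polyfun (fun y => dot y (cvec C)) := polyfun_dotl _.
pose jj : 'I_(1 + (1 + (1 + (a + b)))) := j; change j with jj; rewrite /system.
rewrite -(splitK jj); case: (split jj) => l /=.
  by apply: polyfun_eq (polyfun_const _ 0) => y; rewrite row_mxEl mxE.
rewrite -(splitK l); case: (split l) => l' /=.
  have pe := polyfunD (polyfunM (polyfun_const (2 + a.+1) (lsubmx X 0 i0)) (pdc p))
     (polyfunM (polyfun_const (2 + a.+1) (lsubmx X 0 i1)) (pdc q)).
  by apply: polyfun_eq pe => y; rewrite row_mxEr row_mxEl ord1 [RHS]mxE eqxx mulr1n.
rewrite -(splitK l'); case: (split l') => l2 /=.
  apply: polyfun_eq (polyfun_const _ (lsubmx X 0 (Zi a))) => y.
  by rewrite !row_mxEr row_mxEl ord1 [RHS]mxE eqxx mulr1n.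
apply: polyfun_eq (polyfun_system_poly (lsubmx X) (rsubmx X) l2) => y.
by rewrite !row_mxEr [RHS]mxE.
Qed.

Lemma polyfun_hstar j : polyfun (fun y => hstar y 0 j).
Proof.
have [P hP] := polyfun_adj (ord0 : 'I_((a + b).+2.+1))
  (lshift b j : 'I_(2 + a.+1 + b)) polyfun_sysmx.
by exists P => y; rewrite hP /hstar !mxE.
Qed.

Lemma polyfun_shift n (x : 'rV[k]_n -> 'rV[k]_(2 + a.+1)) j :
  (forall j, polyfun (fun z => x z 0 j)) -> polyfun (fun z => shift (x z) 0 j).
Proof.
move=> hx; rewrite -(splitK j); case: (split j) => l /=.
  apply: polyfun_eq (polyfun_const _ 0) => z.
  by rewrite /shift /vec row_mxEl mxE if_same.
have [P hP] := polyfun_formA D l; have [Q hQ] := polyfun_meval P hx.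
by exists Q => z; rewrite hQ hP /shift /vec row_mxEr mxE.
Qed.

(** With x = r h + m shift h, differentiating the invariance of f gives r f_0(x) + m (grad x . (0,
    0; p)) = r^d y_0 and r (grad x . (0, 0; p)) = r^d (y . (0, 0; p)), where the index 0 stands for
    [i0]. These determine m / r; the coefficients clear its denominator, using f(x) = r^d f(h) and
    (y . x) / d = r f(h), so that the multiple of [shift h] cancels. *)
Definition psi y : 'rV[k]_(2 + a.+1) :=
  let x := hstar y in
  (dot y (cvec p) * f.@[x 0]) *: x +
  (dot y x / d%:R * (f^`M(i0)).@[x 0] - y 0 i0 * f.@[x 0]) *: shift x.

Lemma polyfun_psi j : polyfun (fun y => psi y 0 j).
Proof.
have ph := polyfun_hstar; have pfh := polyfun_meval f ph.
have pe : polyfun (fun y => dot y (cvec p) * f.@[(hstar y) 0] * hstar y 0 j +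
    (dot y (hstar y) / d%:R * (f^`M(i0)).@[(hstar y) 0] - y 0 i0 * f.@[(hstar y) 0]) *
      shift (hstar y) 0 j).
  apply: polyfunD.
    by apply: polyfunM => //; apply: polyfunM => //; apply: polyfun_dotl.
  apply: polyfunM; last exact: polyfun_shift.
  apply: polyfunB; last by apply: polyfunM => //; apply: polyfun_coord.
  apply: polyfunM; last exact: polyfun_meval.
  apply: polyfunM; last exact: polyfun_const.
  by apply: polyfun_dot => // l; apply: polyfun_coord.
by apply: polyfun_eq pe => y; rewrite mx_comb2.
Qed.

(** The shift is linear, so the invariance [fres_shift] can be differentiated along the line h + t
    v. *)
Lemma dir_deriv_shift r m h v :
  dir_deriv f (r *: h + m *: shift h) (r *: v + m *: shift v) = r ^+ d * dir_deriv f h v.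
Proof.
rewrite !dir_deriv_line -hornerZ -derivZ; congr (_^`().[0]).
apply: (poly_funP char0) => t; rewrite hornerZ !horner_pcurve_line !fE -(fres_shift r m).
congr fres; rewrite shiftD !scalerDr !scalerA [t * r]mulrC [t * m]mulrC.
by rewrite addrACA.
Qed.

Lemma dot_e0 y : dot y (vec 1 0 0) = y 0 i0.
Proof.
rewrite dot_split vec0 vec1 mulr1 mulr0 addr0 big1 ?addr0 // => i _.
rewrite vecZ; last by rewrite -ltnS.
by rewrite coef0 mulr0.
Qed.

Lemma psi_grad h : fK h != 0 -> fres h != 0 ->
  (forall j, (formA h).[tau j] != 0) -> dot (grad h) (cvec p) != 0 ->
  exists2 s, s != 0 & psi (grad h) = s *: h.
Proof.
move=> nzK nzf nztau nzp; set y := grad h.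
have [r nzr [m hE]] := hstar_grad nzK nzf nztau nzp.
have nzd : (d%:R : k) != 0.
  by rewrite natr_eq0_char0 // addn_eq0 negb_and -!lt0n a_gt0.
exists (dot y (cvec p) * r ^+ d * fres h * r).
  by rewrite !mulf_neq0 ?expf_neq0.
have [th [inj rA]] := exists_roots nzK.
have yN : dot y (shift h) = 0.
  rewrite /shift (dot_grad_cvec inj rA nzf (size_formA D h)) big1 ?mulr0 // => i _.
  by rewrite hornerM rA mulr0 mul0r.
have yh : dot y h = d%:R * fres h by rewrite -dot_grad (euler char0 _ fH) fE.
set x := hstar y in hE; have fx : f.@[x 0] = r ^+ d * fres h.
  by rewrite hE fE fres_shift.
have Ne0 : shift (vec 1 0 0) = cvec p.
  by rewrite /shift /formA vec0 vec1 scale1r scale0r addr0.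
have eq1 : r * (f^`M(i0)).@[x 0] + m * dot (grad x) (cvec p) = r ^+ d * y 0 i0.
  have := dir_deriv_shift r m h (vec 1 0 0); rewrite -hE !dot_grad dotD dotZ.
  by rewrite Ne0 !dot_e0 mxE tnth_mktuple.
have eq2 : r * dot (grad x) (cvec p) = r ^+ d * dot y (cvec p).
  have := dir_deriv_shift r m h (cvec p); rewrite -hE shift_cvec scaler0 addr0.
  by rewrite !dot_grad dotZ.
have yx : dot y x / d%:R = r * fres h.
  by rewrite hE dotD dotZ yN mulr0 addr0 yh mulrCA [_ * (r * _)]mulrC mulfK.
have Nx : shift x = r *: shift h.
  have := shiftD 0 h r; rewrite add0r.
  have s0 : shift 0 = 0.
    by have := shiftD 0 0 (-1); rewrite scaler0 addr0 scaleN1r subrr.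
  rewrite s0 add0r => sr; rewrite hE shiftD sr.
  by rewrite [shift (shift h)]shift_cvec scaler0 addr0.
rewrite /psi -/x fx yx Nx {1}hE scalerDr !scalerA -addrA -scalerDl.
rewrite [X in X *: shift h](_ : _ = 0) ?scale0r ?addr0.
  by congr (_ *: _); ring.
have -> : dot y (cvec p) * (r ^+ d * fres h) * m +
   (r * fres h * (f^`M(i0)).@[x 0] - y 0 i0 * (r ^+ d * fres h)) * r =
   fres h * (m * (r ^+ d * dot y (cvec p)) +
     r * (r * (f^`M(i0)).@[x 0] - r ^+ d * y 0 i0)) by ring.
by rewrite -eq1 -eq2; ring.
Qed.

Lemma birational_polar_map : birational (polar_map f).
Proof.
have [c hc] := fin_all_exists polyfun_psi.
pose psit := [tuple c j | j < 2 + a.+1].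
have psiE y : apply_tuple psit y = psi y.
  by apply/rowP => j; rewrite mxE tnth_mktuple hc.
have [v [w [nzv _]]] := exists_good_line char0 fE KE.
have nzf : f != 0 by apply: contra nzv => /eqP ->; rewrite meval0.
have [T hT] : polyfun (fun h => \prod_j (formA h).[tau j]).
  by apply: polyfun_prod => j; apply: polyfun_horner (size_formA D) (polyfun_formA D).
have nzT : T != 0.
  have [t [_ _ _ nzt]] := exists_generic_slope (oner_neq0 _).
  have : \prod_j (formA (vec 1 t 0)).[tau j] != 0 by apply/prodf_neq0 => j _; apply: nzt.
  by apply: contraNneq => T0; rewrite -hT T0 meval0.
have [n dn] : exists n, d = n.+1 by exists d.-1; rewrite prednK // addn_gt0 a_gt0.
apply: (@birational_of_left_inverse k char0 a.+1 (polar_map f) psit n (f * K * ZP * T)).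
- by move: dn lt_ab a_gt0; lia.
- by move=> i; rewrite tnth_mktuple; apply: mderiv_homog; rewrite -dn.
- by rewrite !mulf_neq0 ?K_neq0 ?ZP_neq0.
move=> h; rewrite !mevalM !mulf_eq0 !negb_or => /andP[/andP[/andP[nzfh nzK] nzp] nztau].
rewrite fE in nzfh; rewrite KE in nzK; rewrite ZP_E in nzp; rewrite hT in nztau.
rewrite psiE; apply: psi_grad => // j.
by apply: contra nztau => /eqP t0; rewrite (bigD1 j) //= t0 mul0r.
Qed.

Lemma hypersurface_eq_f : hypersurface_eq d f (dual_variety (surfY D)).
Proof.
have [v [w [nzv _]]] := exists_good_line char0 fE KE.
split; first by rewrite addn_gt0 a_gt0.
- exact: fH.
- by apply: contra nzv => /eqP ->; rewrite meval0.
- exact: dual_surfY fE KE.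
move=> G vG; apply: (divisible_by_f char0 fE KE) => h fh Kh; apply: vG.
apply/(dual_surfY char0 fE KE); split=> //.
apply: contra Kh => /eqP ->; rewrite KE /fK mxE mul0r.
by [].
Qed.

End Homaloidal.

Lemma normal_form_dual (k : closedFieldType) (char0 : [pchar k] =i pred0) a b
    (D : normal_form k a b) :
  is_hypersurface (a + b) (dual_variety (surfY D)) /\
  homaloidal (dual_variety (surfY D)).
Proof.
have [f fE] := polyfun_fres D; have [K KE] := polyfun_fK D.
have hf := hypersurface_eq_f char0 fE KE; split; first by exists f.
exists (a + b)%N, f; split=> //; last exact: birational_polar_map fE KE.
by have := nf_lt_ab D; have := nf_a_gt0 D; lia.
Qed.

(** * General projections *)

Section Projections.
Variable k : closedFieldType.
Hypothesis char0 : [pchar k] =i pred0.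

Lemma projected_projected l m n (X : pset k l) (Q : 'M[k]_(l, m)) (R : 'M[k]_(m, n)) :
  projected (projected X Q) R = projected X (Q *m R).
Proof.
apply: pset_ext => x; split=> -[nzx cl]; split=> // d f hf vf.
  apply: (cl d f hf) => y [nzy [z [nzz clz] ey]]; rewrite {y}ey in nzy *.
  (* The factor ['X_i] makes the form vanish at 0 even when d = 0, which takes care of the points of
     X lying in the centre of the composite projection. *)
  have fX i : (f * 'X_i).@[(z *m R) 0] = 0.
    rewrite -meval_lin_comp; apply: (clz d.+1).
      apply: lin_comp_homog => //; rewrite -addn1; apply: dhomogM hf _.
      by rewrite dhomogX; apply/eqP/mdeg1.
    move=> _ [_ [w Xw ->]]; rewrite meval_lin_comp mevalM mevalXU -mulmxA.
    have [->|nz] := eqVneq (w *m (Q *m R)) 0; first by rewrite mxE mulr0.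
    by rewrite vf ?mul0r //; split=> //; exists w.
  have [i nzi] : exists i, (z *m R) 0 i != 0 by apply/rV0Pn.
  apply: (mulIf nzi).
  by rewrite mul0r -(fX i) mevalM mevalXU.
apply: (cl d f hf) => y [nzy [z Xz ey]]; rewrite {y}ey in nzy *; apply: vf; split=> //.
exists (z *m Q); last by rewrite mulmxA.
have nzQ : z *m Q != 0 by apply: contra nzy => /eqP zQ; rewrite mulmxA zQ mul0mx.
by split=> // e F _ vF; apply: vF; split=> //; exists z.
Qed.

Lemma projected_linpre m n (X : pset k m) (Q : 'M[k]_(m, n)) (H : 'M[k]_n) :
  H \in unitmx -> projected X Q = linpre H (projected X (Q *m H)).
Proof.
move=> uH; rewrite /projected -zariski_closure_linpre //; congr zariski_closure.
apply: pset_ext => y; split=> -[nzy [x Xx e]].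
  split; last by exists x; rewrite // e mulmxA.
  by apply: contra nzy => /eqP yH; rewrite -(mulmxK uH y) yH mul0mx.
split; first by apply: contra nzy => /eqP->; rewrite mul0mx.
by exists x => //; apply: (can_inj (mulmxK uH)); rewrite e mulmxA.
Qed.

Lemma for_generalI m n (D P : 'M[k]_(m, n) -> Prop) (F : 'M[k]_(m, n) -> k) :
  polyfun (fun x => F (vec_mx x)) -> (exists A, D A /\ F A != 0) ->
  (forall A, D A -> F A != 0 -> P A) -> for_general D P.
Proof.
move=> [f hf] [A [DA FA]] h; exists f; split.
  by exists A; rewrite hf mxvecK.
by move=> B DB; rewrite hf mxvecK; apply: h.
Qed.

Lemma polyfun_vec_mx m n i j : polyfun (fun x : 'rV[k]_(m * n) => vec_mx x i j).
Proof.
by apply: polyfun_eq (polyfun_coord _ (mxvec_index i j)) => x; rewrite mxE.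
Qed.

Lemma polyfun_col_mx N m1 m2 n (A : 'rV[k]_N -> 'M[k]_(m1, n)) (B : 'rV[k]_N -> 'M[k]_(m2, n)) :
  (forall i j, polyfun (fun x => A x i j)) -> (forall i j, polyfun (fun x => B x i j)) ->
  forall i j, polyfun (fun x => col_mx (A x) (B x) i j).
Proof.
move=> hA hB i j; rewrite -(splitK i); case: (split i) => l /=.
  by apply: polyfun_eq (hA l j) => x; rewrite col_mxEu.
by apply: polyfun_eq (hB l j) => x; rewrite col_mxEd.
Qed.

Lemma det_neq0_of_kernel n (M : 'M[k]_n) :
  (forall w : 'cV_n, M *m w = 0 -> w = 0) -> \det M != 0.
Proof.
move=> inj; rewrite -det_tr; apply/det0P => -[w nzw wM].
have := inj w^T; rewrite -[M]trmxK -trmx_mul wM trmx0 => /(_ erefl) w0.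
by move: nzw; rewrite -[w]trmxK w0 trmx0 eqxx.
Qed.

Definition bordered n (L : 'M[k]_(n, n.+2)) (e c : 'rV[k]_n.+2) : 'M[k]_n.+2 :=
  col_mx c (col_mx e L).

(** The expansion of the bordered determinant along its first row, read as a binary form when that
    row is [veronese]; the cofactors do not depend on the first row, set to 0 here. *)
Definition bordered_poly n (L : 'M[k]_(n, n.+2)) e : {poly k} :=
  \poly_(j < n.+2) cofactor (bordered L e 0) ord0 (inord j).

Lemma hform_bordered n (L : 'M[k]_(n, n.+2)) e s t :
  hform n.+1 (bordered_poly L e) s t = \det (bordered L e (veronese n.+1 s t)).
Proof.
rewrite (expand_det_row _ ord0); apply: eq_bigr => j _.
rewrite coef_poly ltn_ord inord_val mulrC; congr (_ * _).
  rewrite (_ : ord0 = lshift (1 + n) (ord0 : 'I_1)); last exact: val_inj.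
  by apply/esym/(etrans (col_mxEu (veronese n.+1 s t) _ _ _)); rewrite mxE.
have row'E c : row' ord0 (col' j (bordered L e c)) = col' j (col_mx e L).
  apply/matrixP => i l; rewrite mxE mxE [RHS]mxE.
  rewrite (_ : lift ord0 i = rshift 1 (i : 'I_(1 + n))); last exact: val_inj.
  exact: (col_mxEd c (col_mx e L)).
by rewrite /cofactor !row'E.
Qed.

Lemma det_bordered_eq0 n (L : 'M[k]_(n, n.+2)) e c : (c <= L)%MS -> \det (bordered L e c) = 0.
Proof.
move=> cL; apply/eqP; apply: contraT => nz.
have uB : bordered L e c \in unitmx by rewrite unitmxE unitfE.
have LeL : (L <= col_mx e L)%MS by rewrite -addsmxE addsmxSr.
have sB : (bordered L e c <= col_mx e L)%MS.
  by rewrite (@col_mx_sub _ 1 (1 + n)) submx_refl (submx_trans cL).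
have := leq_trans (mxrankS sB) (rank_leq_row _); rewrite (mxrank_unit uB).
by rewrite add1n ltnn.
Qed.

(* The row space of [L] meets the rational normal curve when the two determinants,
   seen as binary forms in (s, t), have a common zero. *)
Lemma generic_centre n m b : m = n ->
  exists F : 'M[k]_(m, n.+2 + b.+1) -> k, [/\ polyfun (fun x => F (vec_mx x)),
    exists A, basis_of_subspace (@spanE k n.+1 b) A /\ F A != 0
    & forall A, F A != 0 -> forall s t, (s, t) != (0, 0) ->
        ~~ (veronese n.+1 s t <= lsubmx A)%MS].
Proof.
move=> ->{m}; pose p e (A : 'M[k]_(n, n.+2 + b.+1)) := bordered_poly (lsubmx A) e.
pose e0 : 'rV[k]_n.+2 := delta_mx 0 ord0; pose ea : 'rV[k]_n.+2 := delta_mx 0 ord_max.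
have sp e A : (size (p e A) <= n.+2)%N by apply: size_poly.
have resP A := @sylv_det_eq0 k n.+1 n.+1 (p e0 A) (p ea A) (isT : 0 < n.+1 + n.+1)%N
  (sp e0 A) (sp ea A).
exists (fun A => \det (sylv n.+1 n.+1 (p e0 A) (p ea A))); split.
- apply: polyfun_det => i j.
  have pp e : polyfun_poly (fun x => p e (vec_mx x)).
    move=> l; have [lt_l|le_l] := ltnP l n.+2; last first.
      by apply: polyfun_eq (polyfun_const _ 0) => x; rewrite nth_default // (leq_trans (sp _ _)).
    have pb i' j' :
        polyfun (fun x => bordered (lsubmx (vec_mx x : 'M[k]_(n, n.+2 + b.+1))) e 0 i' j').
      have pL i1 j1 : polyfun (fun x => lsubmx (vec_mx x : 'M[k]_(n, n.+2 + b.+1)) i1 j1).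
        have pv := polyfun_vec_mx i1 (lshift b.+1 j1).
        by apply: polyfun_eq pv => x; rewrite [RHS]mxE.
      have pc (c : 'rV[k]_n.+2) i1 j1 : polyfun (fun x : 'rV[k]_(n * (n.+2 + b.+1)) => c i1 j1).
        exact: polyfun_const.
      exact: (polyfun_col_mx (pc 0) (polyfun_col_mx (pc e) pL)).
    have padj := polyfun_adj (inord l) ord0 pb.
    by apply: polyfun_eq padj => x; rewrite [LHS]mxE /p coef_poly lt_l.
  by apply: polyfun_sylv.
(* For the span of the inner unit vectors, the determinants bordered by [e0] and [ea] are, up to
   sign, t^(n+1) and s^(n+1), which have no common zero. *)
- pose A : 'M[k]_(n, n.+2 + b.+1) := row_mx (\matrix_(i, j) (j == i.+1 :> nat)%:R) 0.
  have lA : lsubmx A = \matrix_(i, j) (j == i.+1 :> nat)%:R by rewrite row_mxKl.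
  have sL (w : 'cV[k]_n.+2) i : (lsubmx A *m w) i 0 = w (inord i.+1) 0.
    rewrite mxE (bigD1 (inord i.+1)) //= big1 ?addr0 => [|j ne_j].
      by rewrite lA mxE inordK ?ltnS 1?ltnW // eqxx mul1r.
    by rewrite lA mxE -[i.+1](@inordK n.+1) ?ltnS 1?ltnW // (inj_eq val_inj) (negPf ne_j) mul0r.
  have nzdet (r r' : 'I_n.+2) (c : 'rV[k]_n.+2) :
      (forall j : 'I_n.+2, j != r' -> j = r \/ exists i : 'I_n, j = inord i.+1) ->
      c 0 r' != 0 -> \det (bordered (lsubmx A) (delta_mx 0 r) c) != 0.
    move=> cover nzc; apply: det_neq0_of_kernel => w.
    rewrite (@mul_col_mx _ 1 (1 + n)) mul_col_mx => /eqP.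
    rewrite (@col_mx_eq0 _ 1 (1 + n)) col_mx_eq0 => /and3P[/eqP cw /eqP rw /eqP Lw].
    have w0 j : j != r' -> w j 0 = 0.
      case/cover=> [->|[i ->]]; last by rewrite -sL Lw mxE.
      by have /rowP/(_ 0) := rw; rewrite -rowE !mxE.
    apply/colP => j; rewrite mxE; have [->|/w0//] := eqVneq j r'.
    have /rowP/(_ 0) := cw; rewrite !mxE (bigD1 r') //= big1 => [|i /w0->]; last by rewrite mulr0.
    by move/eqP; rewrite addr0 mulf_eq0 (negPf nzc) => /eqP.
  have inner (j : 'I_n.+2) : j != ord0 -> j != ord_max -> exists i : 'I_n, j = inord i.+1.
    case: j => -[//|j] ltj _ nj; have ltjn : (j < n)%N.
      rewrite ltn_neqAle -ltnS -ltnS ltj andbT; apply: contra nj => /eqP jn.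
      by apply/eqP/val_inj; rewrite /= jn.
    by exists (Ordinal ltjn); apply: val_inj; rewrite /= inordK.
  exists A; split; first split.
  + apply/row_freeP; exists (col_mx (lsubmx A)^T 0).
    rewrite mul_row_col mul0mx addr0 -lA; apply/matrixP => i j.
    have <- : (lsubmx A *m col j (lsubmx A)^T) i 0 = (lsubmx A *m (lsubmx A)^T) i j.
      by rewrite mxE [RHS]mxE; apply: eq_bigr => l _; congr (_ * _); rewrite mxE.
    by rewrite sL mxE mxE lA mxE [RHS]mxE inordK ?ltnS 1?ltnW // eqSS eq_sym.
  + by apply/submxP; exists (lsubmx A); rewrite /spanE mul_mx_row mulmx1 mulmx0 row_mxKl.
  apply/eqP => /resP[[x /andP[_ /rootP]]|[+ _]]; apply/eqP.
    rewrite -(hform1 x (sp ea A)) hform_bordered; apply: (nzdet _ ord0).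
      by move=> j nj; have [->|] := eqVneq j ord_max; [left | right; apply: inner].
    by rewrite mxE expr1n expr0 mulr1 oner_eq0.
  have -> : (p e0 A)`_n.+1 = hform n.+1 (p e0 A) 0 1 by rewrite hform0 expr1n mulr1.
  rewrite hform_bordered; apply: (nzdet _ ord_max).
    by move=> j nj; have [->|] := eqVneq j ord0; [left | right; apply: inner].
  by rewrite mxE subnn expr0 expr1n mulr1 oner_eq0.
move=> A /eqP nz s t nzst; apply/negP => le_ver; apply/nz/resP.
have p0 e : hform n.+1 (p e A) s t = 0 by rewrite hform_bordered det_bordered_eq0.
have h e := hform_eq0_root nzst (sp e A) (p0 e).
case: (h e0) (h ea) => [[nzs r0]|[s0 r0]] [[nzs' ra]|[s0' ra]].
- by left; exists (t / s); rewrite !rootE r0 ra eqxx.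
- by rewrite s0' eqxx in nzs.
- by rewrite s0 eqxx in nzs'.
- by right.
Qed.

End Projections.

(** * The first projection, restricted to the span of E *)

Section PencilOfProjection.
Variable k : closedFieldType.

Lemma exists_unitmx_row n (u : 'rV[k]_n.+1) :
  u != 0 -> exists2 W : 'M_n.+1, W \in unitmx & u *m W = delta_mx 0 0.
Proof.
rewrite -mxrank_eq0 => nzu; have r1 : \rank u = 1%N.
  by apply/eqP; rewrite eqn_leq rank_leq_row lt0n.
pose c := col_ebase u 0 0; have uC := col_ebase_unit u.
have nzc : c != 0 by move: uC; rewrite unitmxE det_mx11 unitfE.
exists (c^-1 *: invmx (row_ebase u)).
  by rewrite unitmxZ ?unitmx_inv ?row_ebase_unit // unitfE invr_neq0.
have eu : u = c *: (pid_mx 1 *m row_ebase u).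
  by rewrite -{1}(mulmx_ebase u) r1 [col_ebase u]mx11_scalar mul_scalar_mx scalemxAl.
rewrite {1}eu -scalemxAl -scalemxAr scalerA mulfV // scale1r mulmxK ?row_ebase_unit //.
by apply/rowP => j; rewrite !mxE /= eq_sym; case: j => -[].
Qed.

Lemma rank_factorization m n r (A : 'M[k]_(m, n)) : \rank A = r ->
  exists (U : 'M_(m, r)) (V : 'M_(r, n)), [/\ A = U *m V, row_full U & row_free V].
Proof.
move=> <-; exists (col_base A), (row_base A).
by rewrite mulmx_base col_base_full row_base_free.
Qed.

Lemma veronese01 n : veronese n 0 1 = delta_mx 0 ord_max :> 'rV[k]_n.+1.
Proof.
apply/rowP => j; rewrite !mxE expr1n mulr1 expr0n subn_eq0 eqxx /=.
by rewrite -(inj_eq val_inj) /= eqn_leq leq_ord.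
Qed.

(** The centre has rank a - 1 in the span of E, of rank a + 1, so the restriction of [Q] to this
    span has rank 2 and factors as U V, with the rows of V spanning Lambda. The columns of U will be
    [p] and [q]; they have no common zero because the centre misses E. *)
Lemma pencil_of_projection a b (L : 'M[k]_(a - 1, a.+1 + b.+1)) Q :
  (0 < a)%N -> basis_of_subspace (spanE k a b) L -> projection_from L Q ->
  (forall s t, (s, t) != (0, 0) -> ~~ (veronese a s t <= lsubmx L)%MS) ->
  exists (U : 'M[k]_(a.+1, 2)) (V : 'M[k]_(2, b.+3)),
  [/\ row_full U, row_free V & usubmx Q = U *m V] /\
  [/\ row ord_max U = delta_mx 0 0,
    forall s t, (s, t) != (0, 0) -> veronese a s t *m U != 0
    & forall n (x : 'M_(n, a.+1)) (y : 'M_(n, b.+1)), row_mx x y *m Q = 0 -> y = 0].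
Proof.
move=> a_gt0 [freeL /submxP[D defL]] [_ /andP[kerL Lker]] avoid.
have {}defL : L = row_mx D 0 by rewrite defL mul_mx_row mulmx1 mulmx0.
have lD : lsubmx L = D by rewrite defL row_mxKl.
have kerQ n (x : 'M_(n, a.+1)) (y : 'M_(n, b.+1)) :
    row_mx x y *m Q = 0 -> y = 0 /\ (x <= D)%MS.
  move/sub_kermxP => /submx_trans/(_ kerL)/submxP[X]; rewrite defL mul_mx_row mulmx0.
  by move/eq_row_mx => [-> ->]; rewrite submxMl.
have EQ n (x : 'M_(n, a.+1)) : row_mx x 0 *m Q = x *m usubmx Q.
  by rewrite -[Q in LHS]vsubmxK mul_row_col mul0mx addr0.
have rankE : \rank (usubmx Q) = 2.
  have : \rank (kermx (usubmx Q)) = (a - 1)%N.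
    apply/eqP; rewrite eqn_leq; apply/andP; split.
      apply: leq_trans (rank_leq_row D); apply: mxrankS.
      by have [] := kerQ _ (kermx (usubmx Q)) 0; rewrite // EQ mulmx_ker.
    have <- : \rank D = (a - 1)%N.
      apply/eqP; rewrite eqn_leq rank_leq_row -[X in (X <= _)%N](eqP freeL).
      by rewrite defL -[X in row_mx X _]mulmx1 -(mulmx0 _ D) -mul_mx_row mxrankM_maxl.
    apply/mxrankS/sub_kermxP; rewrite -EQ -defL; exact/sub_kermxP.
  have := rank_leq_row (usubmx Q); rewrite mxrank_ker.
  by move: (\rank _) => r; lia.
have [U0 [V0 [defE fullU freeV]]] := rank_factorization rankE.
have nzver s t : (s, t) != (0, 0) -> veronese a s t *m U0 != 0.
  move=> /avoid; apply: contra => /eqP vU.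
  have [] := kerQ _ (veronese a s t) 0; last by rewrite lD.
  by rewrite EQ defE mulmxA vU mul0mx.
(* Coordinates on Lambda in which the point of E at infinity has image (1 : 0); this makes [p] monic
   of degree a and deg q < a. *)
have [W uW rW] : exists2 W : 'M_2, W \in unitmx & row ord_max U0 *m W = delta_mx 0 0.
  apply: exists_unitmx_row; rewrite rowE -veronese01; apply: nzver.
  by rewrite xpair_eqE oner_eq0 andbF.
exists (U0 *m W), (invmx W *m V0); split; split.
- have /row_fullP[B BU] := fullU; apply/row_fullP; exists (invmx W *m B).
  by rewrite mulmxA -(mulmxA (invmx W)) BU mulmx1 mulVmx.
- have /row_freeP[B VB] := freeV; apply/row_freeP; exists (B *m W).
  by rewrite mulmxA -(mulmxA (invmx W)) VB mulmx1 mulVmx.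
- by rewrite mulmxA mulmxK.
- by rewrite row_mul.
- move=> s t /nzver; apply: contra => /eqP; rewrite mulmxA => h.
  by rewrite -(mulmxK uW (_ *m U0)) h mul0mx.
by move=> n x y /kerQ[].
Qed.

End PencilOfProjection.

(** * The general rulings *)

Section GenericRulings.
Variable k : closedFieldType.
Hypothesis char0 : [pchar k] =i pred0.
Variables (a : nat) (p q : {poly k}).
Hypotheses (a_gt0 : (0 < a)%N) (top_p : has_top a p 1) (sq : (size q <= a)%N).
Hypothesis co_pq : coprimep p q.

(** If the Wronskian were zero, then p would divide p' q, hence p', which is nonzero of smaller
    degree in characteristic 0. *)
Lemma wronskian_roots :
  exists r : seq k, forall x, p.[x] * q^`().[x] - p^`().[x] * q.[x] = 0 -> x \in r.
Proof.
pose w := p * q^`() - p^`() * q; have nzp' : p^`() != 0.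
  apply/eqP => /polyP/(_ a.-1); rewrite coef_deriv prednK // (proj2 top_p) coef0 => /eqP.
  by rewrite natr_eq0_char0 // -leqn0 leqNgt a_gt0.
have nzw : w != 0.
  rewrite subr_eq0; apply/eqP => e; have : p %| p^`().
    by rewrite -(Gauss_dvdpl _ co_pq) -e dvdp_mulr.
  move=> /(dvdp_leq nzp'); rewrite leqNgt lt_size_deriv //.
  by apply: contra nzp' => /eqP->; rewrite deriv0.
have [r defw] := closed_field_poly_normal w; exists r => x wx.
have : root w x by rewrite rootE hornerD hornerN !hornerM wx.
rewrite defw rootZ ?lead_coef_eq0 // => rx.
by rewrite -root_prod_XsubC.
Qed.

Lemma polyfun_hform n P (s t : 'rV[k]_n -> k) d :
  polyfun s -> polyfun t -> polyfun (fun x => hform d P (s x) (t x)).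
Proof.
move=> hs ht; apply: polyfun_sum => i; apply: polyfunM; first exact: polyfun_const.
by apply: polyfunM; apply: polyfunX.
Qed.

(** The conditions are written with binary forms in the rows of [A], so that they are polynomial in
    the homogeneous coordinates; the factor [A j 0] keeps the rulings away from infinity.
    [exists_generic_points] provides a witness. *)
Lemma generic_rulings n (r : seq k) : exists F : 'M[k]_(n, 2) -> k,
  [/\ polyfun (fun x => F (vec_mx x)), exists A, points_of_line A /\ F A != 0
    & forall A, F A != 0 -> let tau j := A j 1 / A j 0 in
      [/\ forall j, A j 0 != 0, forall j, q.[tau j] != 0,
        forall i j, i != j -> q.[tau i] * p.[tau j] - p.[tau i] * q.[tau j] != 0
        & forall j x, x \in r -> q.[tau j] * p.[x] - p.[tau j] * q.[x] != 0]].
Proof.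
pose P (A : 'M[k]_(n, 2)) j := hform a p (A j 0) (A j 1).
pose Q (A : 'M[k]_(n, 2)) j := hform a q (A j 0) (A j 1).
pose F1 (A : 'M[k]_(n, 2)) j := A j 0 * Q A j * \prod_(x <- r) (Q A j * p.[x] - P A j * q.[x]).
pose F2 (A : 'M[k]_(n, 2)) i j := if i == j then 1 else Q A i * P A j - P A i * Q A j.
exists (fun A => \prod_j F1 A j * \prod_i \prod_j F2 A i j); split.
- have hP j : polyfun (fun x => P (vec_mx x) j) by apply: polyfun_hform; apply: polyfun_vec_mx.
  have hQ j : polyfun (fun x => Q (vec_mx x) j) by apply: polyfun_hform; apply: polyfun_vec_mx.
  apply: polyfunM; apply: polyfun_prod => i.
    apply: polyfunM; first by apply: polyfunM (hQ i); apply: polyfun_vec_mx.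
    apply: polyfun_prod => x; apply: polyfunB.
      by apply: polyfunM (hQ i) _; apply: polyfun_const.
    by apply: polyfunM (hP i) _; apply: polyfun_const.
  apply: polyfun_prod => j; rewrite /F2; case: (i == j); first exact: polyfun_const.
  by apply: polyfunB; apply: polyfunM.
- pose W y := p.[y] *: q - q.[y] *: p.
  have nzW y : W y != 0 := pencil_neq0 a_gt0 top_p sq co_pq y.
  have WE x y : (W y).[x] = q.[x] * p.[y] - p.[x] * q.[y].
    by rewrite hornerD hornerN !hornerZ mulrC [q.[y] * _]mulrC.
  have [|s [szs /allP hs pws]] :=
      exists_generic_points char0 (l := [::]) (Q := q * \prod_(y <- r) W y) n nzW _ isT.
    apply: mulf_neq0; first exact: pencil_right_neq0 a_gt0 top_p co_pq.
    by rewrite prodf_seq_neq0; apply/allP => y _; apply: nzW.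
  pose A : 'M[k]_(n, 2) := \matrix_(i, j) if j == 0 then 1 else s`_i.
  have A0 i : A i 0 = 1 by rewrite mxE.
  have A1 i : A i 1 = s`_i by rewrite mxE.
  have PE i : P A i = p.[s`_i] by rewrite /P A0 A1 hform1 // (proj1 top_p).
  have QE i : Q A i = q.[s`_i] by rewrite /Q A0 A1 hform1 // leqW.
  exists A; split=> [i|].
    by apply/eqP => /rowP/(_ 0); rewrite !mxE => /eqP; rewrite oner_eq0.
  rewrite mulf_neq0 //; apply/prodf_neq0 => i _.
    have : s`_i \in s by rewrite mem_nth // szs.
    move=> /hs; rewrite hornerM mulf_eq0 negb_or horner_prod.
    rewrite prodf_seq_neq0 => /andP[nzq /allP nzW'].
    rewrite /F1 A0 mul1r QE mulf_neq0 // prodf_seq_neq0; apply/allP => x /nzW' /=.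
    by rewrite WE PE.
  apply/prodf_neq0 => j _; rewrite /F2; case: ifPn => [_|ne_ij]; first exact: oner_neq0.
  rewrite cats0 in pws; rewrite !PE !QE.
  have pw (l m : 'I_n) : (l < m)%N -> (W s`_m).[s`_l] != 0.
    by move=> lt_lm; apply: (pairwiseP 0 pws); rewrite ?inE ?szs.
  have := ne_ij; rewrite -(inj_eq val_inj) neq_ltn => /orP[/pw|/pw]; rewrite WE //.
  by move=> h; rewrite -oppr_eq0 opprB mulrC [q.[s`_i] * _]mulrC.
move=> A; rewrite mulf_eq0 negb_or => /andP[/prodf_neq0 nz1 /prodf_neq0 nz2] tau.
have nz0 j : A j 0 != 0 by have := nz1 j isT; rewrite !mulf_eq0 !negb_or -andbA => /andP[].
have PE j : P A j = A j 0 ^+ a * p.[tau j] by apply: hform_affine (nz0 j) (proj1 top_p).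
have QE j : Q A j = A j 0 ^+ a * q.[tau j] by apply: hform_affine (nz0 j) (leqW sq).
split=> // [j|i j ne_ij|j x rx].
- have := nz1 j isT; rewrite !mulf_eq0 !negb_or -andbA QE => /and3P[_ + _].
  by rewrite mulf_eq0 negb_or => /andP[].
- have /prodf_neq0/(_ j isT) := nz2 i isT; rewrite /F2 (negPf ne_ij) !PE !QE.
  apply: contra => /eqP e0; apply/eqP; move: e0.
  set u := _ ^+ a; set v := _ ^+ a => e0.
  have -> : u * q.[tau i] * (v * p.[tau j]) - u * p.[tau i] * (v * q.[tau j]) =
    u * v * (q.[tau i] * p.[tau j] - p.[tau i] * q.[tau j]) by ring.
  by rewrite e0 mulr0.
have := nz1 j isT; rewrite /F1 mulf_eq0 negb_or prodf_seq_neq0 => /andP[_ /allP/(_ _ rx)] /=.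
apply: contra => /eqP e0; rewrite PE QE -!mulrA -mulrBr; apply/eqP.
by rewrite e0 mulr0.
Qed.

End GenericRulings.

(** * The second projection and the reduction to normal form *)

Section SecondProjection.
Variable k : closedFieldType.
Variables (a b : nat) (U : 'M[k]_(a.+1, 2)) (V : 'M[k]_(2, b.+3)).
Variable Q : 'M[k]_(a.+1 + b.+1, b.+3).
Hypotheses (a_gt0 : (0 < a)%N) (lt_ab : (a < b)%N).
Hypotheses (fullU : row_full U) (freeV : row_free V) (EQ : usubmx Q = U *m V).
Hypothesis rowU : row ord_max U = delta_mx 0 0.
Hypothesis nzver : forall s t, (s, t) != (0, 0) -> veronese a s t *m U != 0.
Hypothesis kerQ : forall n (x : 'M_(n, a.+1)) (y : 'M_(n, b.+1)), row_mx x y *m Q = 0 -> y = 0.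

Lemma veronese_mul n (c : 'cV[k]_n.+1) x :
  (veronese n 1 x *m c) 0 0 = (row_poly c^T).[x].
Proof.
rewrite mxE horner_row_poly; apply: eq_bigr => j _.
by rewrite !mxE expr1n mul1r mulrC.
Qed.

Definition col_poly m n (C : 'M[k]_(m, n)) j : {poly k} := row_poly (col j C)^T.

Lemma coef_col_poly m n (C : 'M[k]_(m, n)) j (i : 'I_m) : (col_poly C j)`_i = C i j.
Proof. by rewrite coef_row_poly !mxE. Qed.

Lemma horner_col_poly m n (C : 'M[k]_(m.+1, n)) j x :
  (col_poly C j).[x] = (veronese m 1 x *m C) 0 j.
Proof. by rewrite -veronese_mul !mxE; apply: eq_bigr => i _; rewrite !mxE. Qed.

Lemma size_col_poly m n (C : 'M[k]_(m, n)) j : (size (col_poly C j) <= m)%N.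
Proof. exact: size_row_poly. Qed.

Let p := col_poly U 0.
Let q := col_poly U 1.

Let Utop j : U ord_max j = (j == 0)%:R.
Proof. by have /rowP/(_ j) := rowU; rewrite !mxE. Qed.

Lemma centre_top_p : has_top a p 1.
Proof. by split; rewrite ?size_col_poly // (coef_col_poly U 0 ord_max) Utop. Qed.

Lemma centre_size_q : (size q <= a)%N.
Proof.
apply/leq_sizeP => i; rewrite leq_eqVlt => /orP[/eqP<-|lt_ai].
  by rewrite (coef_col_poly U 1 ord_max) Utop.
by rewrite nth_default // (leq_trans (size_col_poly _ _)).
Qed.

Lemma centre_coprime : coprimep p q.
Proof.
apply/Pdiv.ClosedField.coprimepP => x /rootP px; apply/eqP => qx.
have := @nzver 1 x; rewrite xpair_eqE oner_eq0 => /(_ isT)/eqP[].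
apply/rowP => j; rewrite [RHS]mxE -horner_col_poly.
by have [->|->] : j = 0 \/ j = 1; last 1 [exact: px | exact: qx];
  case: j => -[|[|//]] lt_j; [left | right]; apply: val_inj.
Qed.

Variable tau : 'I_(b - a) -> k.
Hypothesis q_tau : forall j, q.[tau j] != 0.
Hypothesis wedge_tau :
  forall i j, i != j -> q.[tau i] * p.[tau j] - p.[tau i] * q.[tau j] != 0.

Let Ver : 'M[k]_(b - a, b.+1) := \matrix_(i, j) tau i ^+ j.
Let N : 'M[k]_(b - a, b.+3) := Ver *m dsubmx Q.
(** A basis of Phi: [V] spans Lambda, and row j of [N] is the image of the point u = 0, v = 1 of the
    ruling over [tau j]. *)
Let frame := col_mx V N.

Let row_Ver i : row i Ver = veronese b 1 (tau i).
Proof. by apply/rowP => j; rewrite !mxE expr1n mul1r. Qed.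

Let tau_inj : injective tau.
Proof.
move=> i j e; apply/eqP; apply: contraT => /wedge_tau; rewrite e.
by rewrite [p.[_] * _]mulrC subrr eqxx.
Qed.

Let mul_Ver n (C : 'M_(b.+1, n)) i j : (Ver *m C) i j = (col_poly C j).[tau i].
Proof. by rewrite horner_col_poly -row_Ver -row_mul [RHS]mxE. Qed.

(** Lagrange interpolation at the distinct points [tau] gives a right inverse. *)
Let free_Ver : row_free Ver.
Proof.
pose l i := \prod_(j < b - a | j != i) ('X - (tau j)%:P).
have sl i : (size (l i) <= b.+1)%N.
  rewrite /l -big_filter size_prod_XsubC size_filter ltnS.
  apply: leq_trans (count_size _ _) _.
  by rewrite /index_enum -enumT size_enum_ord leq_subr.
pose C : 'M[k]_(b.+1, b - a) := \matrix_(j, i) ((l i)`_j / (l i).[tau i]).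
apply/row_freeP; exists C; apply/matrixP => i j; rewrite mul_Ver mxE.
have -> : col_poly C j = (l j).[tau j]^-1 *: l j.
  apply/polyP => m; rewrite coefZ; have [lt_m|le_m] := ltnP m b.+1.
    by rewrite (coef_col_poly C j (Ordinal lt_m)) mxE mulrC.
  by rewrite !nth_default ?mulr0 // ?(leq_trans (sl _)) // (leq_trans (size_col_poly _ _)).
rewrite hornerZ; have [->|ne_ij] := eqVneq i j.
  rewrite mulVf // horner_prod; apply/prodf_neq0 => m ne_mj.
  by rewrite hornerXsubC subr_eq0 (inj_eq tau_inj) eq_sym.
by rewrite [X in _ * X]horner_prod (bigD1 i) //= hornerXsubC subrr mul0r mulr0.
Qed.

(** The rows of [V] lift to the span of E, so a relation between the rows lifts to a vector in the
    kernel of [Q]; its second component vanishes by [kerQ], and [Ver] and [V] are free. *)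
Lemma row_free_frame : row_free frame.
Proof.
rewrite -kermx_eq0 -submx0; apply/rV_subP => z; rewrite sub_kermx => /eqP.
rewrite -[z]hsubmxK mul_row_col; set X := lsubmx z; set O := rsubmx z => z0.
have eX : X = X *m pinvmx U *m U by rewrite mulmxKpV // submx_full.
have O0 : O = 0.
  have /eqP : O *m Ver = 0.
    apply: (kerQ (x := X *m pinvmx U)); rewrite -[Q]vsubmxK mul_row_col EQ.
    by rewrite mulmxA -eX -mulmxA.
  by rewrite -(mul0mx _ Ver) => /eqP/(row_free_inj free_Ver).
have /(row_free_inj freeV) -> : X *m V = 0 *m V.
  by move: z0; rewrite O0 !mul0mx addr0.
by rewrite O0 row_mx0 sub0mx.
Qed.

Lemma span_frame (T : 'M[k]_(b - a, 2)) :
  (forall j, T j 0 != 0) -> (forall j, tau j = T j 1 / T j 0) ->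
  (spanPhi Q T == frame)%MS.
Proof.
move=> nzT tauE.
have eE : spanE k a b *m Q = U *m V.
  by rewrite -EQ -[Q in LHS]vsubmxK mul_row_col mul1mx mul0mx addr0.
have eR s t : ruling a b s t *m Q =
    col_mx (veronese a s t *m U *m V) (veronese b s t *m dsubmx Q).
  by rewrite -[Q in LHS]vsubmxK mul_block_col !mul0mx add0r addr0 EQ mulmxA.
have eN j : veronese b (T j 0) (T j 1) *m dsubmx Q = T j 0 ^+ b *: row j N.
  rewrite row_mul row_Ver scalemxAl; congr (_ *m _); apply/rowP => i.
  have eb : T j 0 ^+ b = T j 0 ^+ (b - i) * T j 0 ^+ i by rewrite -exprD subnK ?leq_ord.
  rewrite !mxE expr1n mul1r tauE exprMn exprVn eb -mulrA; congr (_ * _).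
  by rewrite mulrCA mulfV ?mulr1 // expf_neq0.
have leV : (V <= frame)%MS by rewrite -addsmxE addsmxSl.
have leN : (N <= frame)%MS by rewrite -addsmxE addsmxSr.
apply/andP; split.
  rewrite addsmx_sub eE (submx_trans (submxMl _ _)) //.
  apply/sumsmx_subP => j _; rewrite genmxE eR col_mx_sub (submx_trans (submxMl _ _)) //=.
  by rewrite eN scalemx_sub // (submx_trans (row_sub _ _)).
rewrite col_mx_sub; apply/andP; split.
  apply: submx_trans (addsmxSl _ _); rewrite eE.
  by rewrite -[X in (X <= _)%MS]mul1mx -(mulVpmx fullU) -mulmxA submxMl.
apply/row_subP => j; apply: submx_trans (addsmxSr _ _).
apply: (sumsmx_sup j) => //; rewrite genmxE eR.
have -> : row j N = (T j 0 ^+ b)^-1 *: (veronese b (T j 0) (T j 1) *m dsubmx Q).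
  by rewrite eN scalerA mulVf ?scale1r // expf_neq0.
by rewrite scalemx_sub // -addsmxE addsmxSr.
Qed.

(** Since (m0, m1) will take the value - E at [tau j], this is the opposite of q m0 - p m1 there. *)
Let wedge_at (E : 'M[k]_(b - a, 2)) j := E j 0 * q.[tau j] - E j 1 * p.[tau j].

(** In the frame, [Psi] has coordinates (X, O). When O is invertible, Psi = O (E V + N) with E =
    O^-1 X; the adjugate replaces the inverse to keep the condition polynomial. *)
Lemma generic_second_centre : exists F : 'M[k]_(b - a, b.+3) -> k,
  [/\ polyfun (fun x => F (vec_mx x)),
    exists Psi, (row_free Psi /\ (Psi <= frame)%MS) /\ F Psi != 0
    & forall Psi, (Psi <= frame)%MS -> F Psi != 0 ->
      exists O E, Psi = O *m (E *m V + N) /\ forall j, wedge_at E j != 0].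
Proof.
pose X Psi := lsubmx (Psi *m pinvmx frame) : 'M_(b - a, 2).
pose O Psi := rsubmx (Psi *m pinvmx frame) : 'M_(b - a).
exists (fun Psi => \det (O Psi) * \prod_j wedge_at (\adj (O Psi) *m X Psi) j); split.
- have pK i j : polyfun (fun x => ((vec_mx x : 'M_(b - a, b.+3)) *m pinvmx frame) i j).
    by apply: polyfun_mulmx => *; [apply: polyfun_vec_mx | apply: polyfun_const].
  have pO i j : polyfun (fun x => O (vec_mx x) i j).
    by apply: polyfun_eq (pK i (rshift 2 j)) => x; rewrite [RHS]mxE.
  have pX i j : polyfun (fun x => X (vec_mx x) i j).
    by apply: polyfun_eq (pK i (lshift _ j)) => x; rewrite [RHS]mxE.
  apply: polyfunM; first exact: polyfun_det.
  have pA i j : polyfun (fun x => (\adj (O (vec_mx x)) *m X (vec_mx x)) i j).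
    by apply: polyfun_mulmx => // *; apply: polyfun_adj.
  apply: polyfun_prod => j; apply: polyfunB; apply: polyfunM (pA _ _) _; exact: polyfun_const.
(* With every row of E equal to (1, 0), [wedge_at E j] is the value of q at [tau j], which is
   nonzero. *)
- pose E : 'M[k]_(b - a, 2) := \matrix_(i, j) (j == 0)%:R.
  pose Psi := row_mx E 1%:M *m frame.
  have PK : Psi *m pinvmx frame = row_mx E 1%:M by rewrite mulmxKp ?row_free_frame.
  exists Psi; split; first split.
  + apply/row_freeP; exists (pinvmx frame *m col_mx 0 1%:M).
    by rewrite mulmxA PK mul_row_col mulmx0 add0r mulmx1.
  + exact: submxMl.
  rewrite /O /X PK row_mxKl row_mxKr det1 mul1r adj1 mul1mx.
  by apply/prodf_neq0 => j _; rewrite /wedge_at !mxE mul1r mul0r subr0.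
move=> Psi le_Psi; rewrite mulf_eq0 negb_or => /andP[nzO /prodf_neq0 nzw].
have uO : O Psi \in unitmx by rewrite unitmxE unitfE.
exists (O Psi), (invmx (O Psi) *m X Psi); split=> [|j].
  by rewrite mulmxDr mulmxA mulKVmx // -mul_row_col hsubmxK mulmxKpV.
have := nzw j isT; apply: contra; rewrite /wedge_at => /eqP w0.
have -> : \adj (O Psi) = \det (O Psi) *: invmx (O Psi).
  by rewrite /invmx uO scalerA mulfV // scale1r.
by rewrite -scalemxAl ![(_ *: _ : 'M_(_, _)) _ _]mxE -!mulrA -mulrBr w0 mulr0.
Qed.

Variable r : seq k.
Hypothesis r_ramification : forall x, p.[x] * q^`().[x] - p^`().[x] * q.[x] = 0 -> x \in r.
Hypothesis tau_r : forall j x, x \in r -> q.[tau j] * p.[x] - p.[tau j] * q.[x] != 0.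
Variable E : 'M[k]_(b - a, 2).
Hypothesis wedge_E : forall j, wedge_at E j != 0.

(** A solution of [Ver *m M = - E]: its columns, read as m0 and m1, interpolate - E at the points
    [tau]. This makes the normal form vanish on lifts of the rows of E V + N. *)
Let M : 'M[k]_(b.+1, 2) := - (pinvmx Ver *m E).

Let mul_Ver_M : Ver *m M = - E.
Proof. by rewrite mulmxN mulmxA mulmxVp // mul1mx. Qed.

Let e_tau j : q.[tau j] * (col_poly M 0).[tau j] - p.[tau j] * (col_poly M 1).[tau j] != 0.
Proof.
rewrite -!mul_Ver mul_Ver_M; apply: contra (wedge_E j) => /eqP e0.
by rewrite -oppr_eq0 -[X in _ == X]e0; apply/eqP; rewrite /wedge_at !mxE; ring.
Qed.

Definition projection_normal_form : normal_form k a b :=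
  NormalForm a_gt0 lt_ab centre_top_p centre_size_q (size_col_poly M 0) (size_col_poly M 1)
    centre_coprime r_ramification e_tau q_tau wedge_tau tau_r.
Let D := projection_normal_form.
Let G : 'M[k]_(b.+1, a.+1) := \matrix_(i, j) (nf_g D * 'X^j)`_i.

Let nfE : nf_matrix D = block_mx U 0 M G.
Proof.
have I2 (j : 'I_2) : j = 0 \/ j = 1.
  by case: j => -[|[|//]] lt_j; [left | right]; apply: val_inj.
rewrite /nf_matrix /=; congr block_mx; apply/matrixP => i j; rewrite mxE;
  by case: (I2 j) => -> /=; rewrite coef_col_poly.
Qed.

Let mul_Ver_G : Ver *m G = 0.
Proof.
apply/matrixP => i j; rewrite mul_Ver mxE.
have -> : col_poly G j = nf_g D * 'X^j.
  apply/polyP => m; have [lt_m|le_m] := ltnP m b.+1.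
    by rewrite (coef_col_poly G j (Ordinal lt_m)) mxE.
  rewrite !nth_default // ?(leq_trans (size_col_poly _ _)) //.
  by rewrite (leq_trans (size_gC _ _)) // size_polyXn.
by rewrite hornerM (g_tau D i) mul0r.
Qed.

Let nf_inj (w : 'cV_(2 + a.+1)) : nf_matrix D *m w = 0 -> w = 0.
Proof.
rewrite nfE -[w]vsubmxK mul_block_col mul0mx addr0 => /eqP; rewrite col_mx_eq0.
set w1 := usubmx w; set w2 := dsubmx w => /andP[/eqP w1E /eqP w2E].
have w10 : w1 = 0 by apply: (row_full_inj fullU); rewrite w1E mulmx0.
rewrite w10 mulmx0 add0r in w2E; rewrite w10.
suff -> : w2 = 0 by rewrite col_mx0.
have /eqP : nf_g D * row_poly w2^T = 0.
  apply/polyP => i; rewrite coef0; have [lt_i|le_i] := ltnP i b.+1; last first.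
    by rewrite nth_default // (leq_trans (size_gC _ (size_row_poly _))).
  have /colP/(_ (Ordinal lt_i)) := w2E; rewrite !mxE; apply: etrans.
  rewrite /row_poly mulr_sumr coef_sum; apply: eq_bigr => j _.
  by rewrite !mxE -scalerAr coefZ mulrC.
rewrite mulf_eq0 => /orP[/eqP g0|/eqP/row_poly_eq0 w20].
  have := proj2 (top_g D); rewrite g0 coef0 => /eqP.
  by rewrite eq_sym oner_eq0.
by rewrite -[w2]trmxK w20 trmx0.
Qed.

(** The kernel of Q R is contained in that of the normal form, because [M] compensates E and the
    columns of [G] vanish at the points [tau]. The normal form thus factors through Q R, and the
    factor is invertible because the normal form has independent columns. *)
Lemma projection_normal_formP (O : 'M[k]_(b - a)) (R : 'M[k]_(b.+3, a.+3)) :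
  (kermx R <= O *m (E *m V + N))%MS ->
  exists2 H : 'M[k]_a.+3, H \in unitmx & nf_matrix D = Q *m R *m H.
Proof.
move=> kerR; pose H : 'M[k]_a.+3 := pinvmx (Q *m R) *m nf_matrix D.
have ker n (x : 'M_(n, a.+1)) (y : 'M_(n, b.+1)) :
    row_mx x y *m (Q *m R) = 0 -> row_mx x y *m nf_matrix D = 0.
  rewrite mulmxA => /sub_kermxP/submx_trans/(_ kerR)/submxP[c' ec].
  have {c' ec}[c ec] : exists c, row_mx x y *m Q = c *m (E *m V + N).
    by exists (c' *m O); rewrite ec mulmxA.
  pose x0 := c *m E *m pinvmx U.
  have x0U : x0 *m U = c *m E by rewrite mulmxKpV // submx_full.
  have split_Q n' (x' : 'M_(n', a.+1)) y' : row_mx x' y' *m Q = x' *m U *m V + y' *m dsubmx Q.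
    by rewrite -[Q in LHS]vsubmxK mul_row_col EQ mulmxA.
  have e0 : row_mx (x - x0) (y - c *m Ver) *m Q = 0.
    rewrite split_Q !mulmxBl x0U; move: ec; rewrite split_Q mulmxDr !mulmxA => ec.
    by rewrite addrACA ec -opprD subrr.
  have yE : y = c *m Ver by apply/eqP; rewrite -subr_eq0; apply/eqP/(kerQ e0).
  have xU : x *m U = c *m E.
    apply/eqP; rewrite -subr_eq0 -x0U -mulmxBl; apply/eqP/(row_free_inj freeV).
    by rewrite mul0mx; move: e0; rewrite split_Q yE subrr mul0mx addr0.
  rewrite nfE mul_row_block mulmx0 add0r xU yE -!mulmxA mul_Ver_M mul_Ver_G.
  by rewrite mulmxN subrr mulmx0 row_mx0.
have defN : nf_matrix D = Q *m R *m H.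
  apply/eqP; rewrite eq_sym -subr_eq0 /H mulmxA -[X in _ - X]mul1mx -mulmxBl; apply/eqP.
  rewrite -[_ - _]hsubmxK; apply: ker; rewrite hsubmxK.
  by rewrite mulmxBl mul1mx mulmxKpV ?submx_refl // subrr.
exists H; rewrite // unitmxE unitfE; apply: det_neq0_of_kernel => w Hw.
by apply: nf_inj; rewrite defN -[LHS]mulmxA [X in _ *m X]Hw mulmx0.
Qed.

End SecondProjection.

Lemma general_surfY (k : closedFieldType) (char0 : [pchar k] =i pred0) a b
    (P : pset k a.+3 -> Prop) : (0 < a)%N -> (a < b)%N ->
  (forall (D : normal_form k a b) (H : 'M_a.+3), H \in unitmx -> P (linpre H (surfY D))) ->
  for_general_Y k a b P.
Proof.
move=> a_gt0 lt_ab hP.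
have [n def_a] : exists n, a = n.+1 by exists a.-1; rewrite prednK.
subst a; have [F [pF wF hF]] := generic_centre k (n := n) b (subn1 n.+1).
apply: for_generalI pF wF _ => L dL /hF avoid Q hQ.
have [U [V [[fullU freeV EQ] [rowU nzver kerQ]]]] :=
  pencil_of_projection a_gt0 dL hQ avoid.
have top_p := centre_top_p rowU; have sq := centre_size_q rowU.
have co := centre_coprime nzver.
have [r hr] := wronskian_roots char0 a_gt0 top_p co.
have [F' [pF' wF' hF']] := generic_rulings char0 a_gt0 top_p sq co (b - n.+1) r.
apply: for_generalI pF' wF' _ => T _ /hF' [nzT q_tau wedge_tau tau_r].
have /andP[sF Fs] := span_frame fullU EQ nzT (fun=> erefl).
have [F'' [pF'' [Psi0 [[free0 le0] nz0]] hF'']] :=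
  generic_second_centre fullU freeV EQ kerQ q_tau wedge_tau.
apply: for_generalI pF'' _ _.
  by exists Psi0; split=> //; split=> //; apply: submx_trans Fs.
move=> Psi [_ le_Psi] /(hF'' _ (submx_trans le_Psi sF)) [O [E [defPsi wE]]] R [_ /andP[kerR _]].
rewrite defPsi in kerR.
have [H uH defN] := projection_normal_formP a_gt0 lt_ab fullU freeV EQ rowU nzver kerQ
  q_tau wedge_tau hr tau_r wE kerR.
rewrite /surfX (projected_projected char0).
have -> := projected_linpre char0 (@scroll k n.+1 b) (Q *m R) uH.
by rewrite -defN; apply: hP.
Qed.

(* The ambient space is P^((r - 2) + 2) = P^r. *)
Theorem theorem3p13 (k : closedFieldType) (char0 : [pchar k]%R =i pred0)
    (r d : nat) (hr : (3 <= r)%N) (hd : (2 * r - 3 <= d)%N) :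
  for_general_Y k (r - 2) (d - r + 2)
    (fun Y => is_hypersurface d (dual_variety Y) /\
              homaloidal (dual_variety Y)).
Proof.
apply: general_surfY => //; [by lia | by lia | move=> D H uH].
have uHt : (invmx H)^T \in unitmx by rewrite unitmx_tr unitmx_inv.
have [hyp hom] := normal_form_dual char0 D.
rewrite dual_variety_linpre //; split; last exact: homaloidal_linpre.
apply: is_hypersurface_linpre => //.
have dE : (r - 2 + (d - r + 2) = d)%N by lia.
by rewrite dE in hyp.
Qed.
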